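(* Let $c\ge0$, $\alpha\in(0,1)$, $n^*\in\mathbb{N}$, and let $N_0\ge 2$ be a threshold (depending on $n^*,\alpha,c$) for which the following ''generation of chaos'' property holds: for every $B\ge1$ there is a constant $C_1$, depending only on $B$, such that for every $N\ge N_0$ and every symmetric Radon probability measure $F_0^N$ on $S^{N-1}(\sqrt N)$ whose energy cumulants satisfy $$\max_{1\le n\le n^*}\ \max_{r\in\mathscr{C}_n}\left(\frac{|\kappa_0^n[e_r]|\,N^{\alpha(\mathrm{len}(r)-1)-c(n-1)}}{(n-1)!}\right)^{1/n}\le B, \qquad (\ast)$$ one has $\|\kappa_t^{n,N}\|_\alpha\le C_1^{n^2}n!\,(N^{c(n-1)}e^{-t/4}+1)$ for all $n\le n^*$ and $t\ge0$. Let $B\ge1$. Then there is a constant $C$, depending only on $B$, such that the following holds for every $N\ge N_0$ and every symmetric Radon probability measure $F_0^N$ on $S^{N-1}(\sqrt N)$ satisfying $(\ast)$. Let $t_0\ge0$ be such that $N^{c(n^*-1)}e^{-\frac14 t_0}\le1$. Let $\mu_0$ be the first marginal of $F_{t_0}^N$ and let $(\mu_T)_{T\ge0}$ be the corresponding weak solution of the Boltzmann--Kac equation with initial datum $\mu_0$. Denote the joint energy cumulants of the product measure $\bigotimes_{i=1}^N\mu_T$ on $\mathbb{R}^N$ by $\tilde\kappa_T^{n,N}[e_r]$, and those of $F_t^N$ by $\kappa_t^{n,N}[e_r]$. Then for all $T\ge0$, all $n\le n^*$ and all $r\in\mathscr{C}_n$, $$\left|\kappa^{n,N}_{t_0+T}[e_r]-\tilde\kappa_T^{n,N}[e_r]\right|\le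 2(N-1)^{-\alpha}C^{n^2}n! ,$$ which is $O(N^{-\alpha})$.
   Context: Stochastic Kac model. For $N\ge 2$ the state space is the sphere $S^{N-1}(\sqrt N)=\{v\in\mathbb{R}^N: |v|^2=N\}$. For $i\ne j$ and $\theta\in(-\pi,\pi]$, let $R_{i,j}(\theta)$ be the rotation of $\mathbb{R}^N$ with $(R_{i,j}(\theta)v)_i=\cos(\theta)v_i+\sin(\theta)v_j$, $(R_{i,j}(\theta)v)_j=-\sin(\theta)v_i+\cos(\theta)v_j$, and all other components unchanged. Define $(Q_N\phi)(v)=\frac{1}{N(N-1)}\sum_{i\ne j}\int_{-\pi}^{\pi}\frac{d\theta}{2\pi}\phi(R_{i,j}(\theta)v)$. The stochastic Kac process is the Markov jump process on $S^{N-1}(\sqrt N)$ with generator $N(Q_N-I)$; if its initial law is $F_0^N$, its law $F_t^N$ at time $t\ge0$ satisfies $\frac{d}{dt}\int\phi\,dF_t^N=\int N(Q_N-I)\phi\,dF_t^N$ for all continuous $\phi$. A measure on the sphere is symmetric if it is invariant under all permutations of the coordinates $v_1,\dots,v_N$; symmetry is preserved by the evolution. The first marginal of $F_t^N$ is the law of $v_1$ on $\mathbb{R}$. Energies: $e_i=v_i^2$. Joint cumulants: for labels $i_1,\dots,i_n\in\{1,\dots,N\}$ (repetitions allowed) and a probability measure $F$ on $\mathbb{R}^N$ with exponential energy moments, the joint cumulant of $e_{i_1},\dots,e_{i_n}$ under $F$ is $\partial_{\xi_{i_1}}\cdots\partial_{\xi_{i_n}}\log\int e^{\sum_i\xi_i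 v_i^2}F(dv)$ at $\xi=0$; $\kappa_t$ denotes cumulants under $F_t^N$. Partition classifiers: $\mathscr{C}_n$ is the set of $r=(r_1,\dots,r_n)\in\mathbb{N}_0^n$ with $r_1\ge\dots\ge r_n\ge0$ and $\sum_k r_k=n$. $\mathrm{len}(r)$ is the number of nonzero components of $r$. $1_n=(1,\dots,1)$ and $\mathscr{C}_n'=\mathscr{C}_n\setminus\{1_n\}$. For $r\in\mathscr{C}_n$, the cumulant indexed by $e_r$ is the order-$n$ joint cumulant in which $e_k$ is repeated $r_k$ times, $k=1,\dots,\mathrm{len}(r)$ (it is understood that $N\ge n$ so that the labels make sense). $\kappa_t^{n,N}=(\kappa_t^n[e_r])_{r\in\mathscr{C}_n'}$. Norm: for $\kappa=(\kappa_r)_{r\in\mathscr{C}_n'}$, $\|\kappa\|_\alpha=\sup_{r\in\mathscr{C}_n'}|\kappa_r|(N-1)^{\alpha(\mathrm{len}(r)-1)}$ (equal to $0$ if $\mathscr{C}_n'=\emptyset$). Boltzmann--Kac equation (weak form): a family of Radon probability measures $(\mu_T)_{T\ge0}$ on $\mathbb{R}$ is a weak solution if for all $\phi\in C_c(\mathbb{R})$, $$\frac{d}{dT}\int\phi\,d\mu_T=-2\int\phi\,d\mu_T+2\int_{-\pi}^{\pi}\int_{\mathbb{R}}\int_{\mathbb{R}}\phi(\cos(\theta)v-\sin(\theta)w)\,\mu_T(dv)\,\mu_T(dw)\,\frac{d\theta}{2\pi}.$$ Only solutions conserving total mass and mean energy $\int v^2\mu_T(dv)$ are considered; it is taken as known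 that for every initial probability measure with finite second moment there is a unique global such solution, and for initial data as in the claim this solution has exponential moments of $v^2$. *)

(* Defs.v *)
From HB Require Import structures.
From mathcomp Require Import all_boot all_order all_algebra all_fingroup.
From mathcomp Require Import all_classical all_reals all_analysis.

Set Implicit Arguments.
Unset Strict Implicit.
Unset Printing Implicit Defensive.

Import Order.TTheory GRing.Theory Num.Theory.
Import numFieldNormedType.Exports.

Local Open Scope classical_set_scope.
Local Open Scope ring_scope.

(** R^N is [N.-tuple R] with the library's product sigma-algebra, which is the
    Borel one.  Borel probability measures on R^N and on R are automatically
    Radon. *)

Section StateSpace.
Variables (R : realType) (N : nat).

Definition kac_sphere : set (N.-tuple R) :=
  [set v | \sum_(i < N) (tnth v i) ^+ 2 = N%:R].

(* The library has no topology on tuples: continuity is read on row vectors. *)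
Definition tuple_of_row (x : 'rV[R]_N) : N.-tuple R := [tuple x ord0 i | i < N].

Definition continuous_on_sphere (phi : N.-tuple R -> R) : Prop :=
  {within tuple_of_row @^-1` kac_sphere, continuous (phi \o tuple_of_row)}.

Definition rotation (i j : 'I_N) (theta : R) (v : N.-tuple R) : N.-tuple R :=
  [tuple if k == i then cos theta * tnth v i + sin theta * tnth v j
         else if k == j then - sin theta * tnth v i + cos theta * tnth v j
         else tnth v k | k < N].

Definition kac_average (phi : N.-tuple R -> R) (v : N.-tuple R) : R :=
  (N%:R * (N%:R - 1))^-1 *
  \sum_(p : 'I_N * 'I_N | p.1 != p.2)
    \int[@lebesgue_measure R]_(theta in `[- pi, pi])
      (phi (rotation p.1 p.2 theta v) / (2 * pi)).

Definition kac_generator (phi : N.-tuple R -> R) (v : N.-tuple R) : R :=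
  N%:R * (kac_average phi v - phi v).

Definition symmetric_measure (P : probability (N.-tuple R) R) : Prop :=
  forall (s : 'S_N) (A : set (N.-tuple R)), measurable A ->
    P [set v | A [tuple tnth v (s i) | i < N]] = P A.

End StateSpace.
Arguments kac_sphere : clear implicits.

(* At t = 0 the filter only sees h > 0: the derivative is one-sided there. *)
Definition has_derivative_on_nonneg (R : realType) (f df : R -> R) : Prop :=
  forall t, 0 <= t ->
    h^-1 * (f (t + h) - f t) @[h --> within [set h | 0 <= t + h] 0^'] --> df t.

(** Laws [F t], [t >= 0], of the stochastic Kac process started from [F 0].
    The generator is bounded on the continuous functions of the sphere, so the
    forward equation determines [F t] from [F 0]. *)
Definition kac_law (R : realType) (N : nat)
    (F : R -> probability (N.-tuple R) R) : Prop :=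
  (forall t, 0 <= t -> F t (kac_sphere R N) = 1%E) /\
  (forall phi : N.-tuple R -> R, continuous_on_sphere phi ->
    has_derivative_on_nonneg
      (fun t => \int[F t]_(v in kac_sphere R N) phi v)
      (fun t => \int[F t]_(v in kac_sphere R N) kac_generator phi v)).

Section Cumulants.
Variables (R : realType) (N : nat).

Definition log_energy_mgf (P : probability (N.-tuple R) R) (xi : 'rV[R]_N) : R :=
  ln (\int[P]_v expR (\sum_(i < N) xi ord0 i * (tnth v i) ^+ 2)).

Definition partial (i : 'I_N) (f : 'rV[R]_N -> R) : 'rV[R]_N -> R :=
  fun xi => 'D_(delta_mx ord0 i) f xi.

Definition energy_cumulant (P : probability (N.-tuple R) R) (s : seq 'I_N) : R :=
  foldr partial (log_energy_mgf P) s 0.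

End Cumulants.

Section Classifiers.

(* Encodes r_1 >= ... >= r_n >= 0 with sum n; every part is at most n, hence
   the finite type ['I_n.+1]. *)
Definition classifiers (n : nat) : {set n.-tuple 'I_n.+1} :=
  [set r : n.-tuple 'I_n.+1 |
    sorted geq (map val r) && (\sum_(k < n) tnth r k == n)%N]%SET.

Definition all_ones (n : nat) : n.-tuple 'I_n.+1 := [tuple inord 1 | _ < n].

Definition classifiers' (n : nat) : {set n.-tuple 'I_n.+1} :=
  (classifiers n :\ all_ones n)%SET.

Definition classifier_len (n : nat) (r : n.-tuple 'I_n.+1) : nat :=
  #|[pred k | tnth r k != ord0]|.

(* The label [i] (counted from 0) is repeated r_(i+1) times.  Labels run over
   ['I_N], so this is the intended list as soon as [n <= N]. *)
Definition classifier_labels (N n : nat) (r : n.-tuple 'I_n.+1) : seq 'I_N :=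
  flatten [seq nseq (nth ord0 r i) i | i : 'I_N <- enum 'I_N].

Definition classifier_cumulant (R : realType) (N n : nat)
    (P : probability (N.-tuple R) R) (r : n.-tuple 'I_n.+1) : R :=
  energy_cumulant P (classifier_labels N r).

End Classifiers.

(** All the quantities are nonnegative, so maxima are taken with default 0. *)
Definition cumulant_norm (R : realType) (N n : nat) (alpha : R)
    (kappa : n.-tuple 'I_n.+1 -> R) : R :=
  \big[Num.max/0]_(r in classifiers' n)
    (`|kappa r| * (N%:R - 1) `^ (alpha * ((classifier_len r)%:R - 1))).

(** The order [n] is restricted to [n <= N], where the labels make sense. *)
Definition initial_cumulant_bound (R : realType) (c alpha B : R)
    (nstar N : nat) (P : probability (N.-tuple R) R) : Prop :=
  \big[Num.max/0]_(1 <= n < nstar.+1 | (n <= N)%N)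
    \big[Num.max/0]_(r in classifiers n)
      ((`|classifier_cumulant P r| *
         N%:R `^ (alpha * ((classifier_len r)%:R - 1) - c * (n%:R - 1))
        / (n.-1)`!%:R) `^ (n%:R^-1))
  <= B.

(** [C1 B] is the constant associated with [B]; it is the same function for
    all the [c, alpha, nstar, N0] to which the property is applied. *)
Definition generation_of_chaos (R : realType) (C1 : R -> R) (c alpha : R)
    (nstar N0 : nat) : Prop :=
  forall B : R, 1 <= B ->
  forall N : nat, (N0 <= N)%N ->
  forall F : R -> probability (N.-tuple R) R,
    kac_law F -> symmetric_measure (F 0) ->
    initial_cumulant_bound c alpha B nstar (F 0) ->
  forall n : nat, (1 <= n <= nstar)%N -> (n <= N)%N ->
  forall t : R, 0 <= t ->
    cumulant_norm N alpha (@classifier_cumulant R N n (F t))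
    <= C1 B ^+ (n ^ 2) * n`!%:R *
       (N%:R `^ (c * (n%:R - 1)) * expR (- t / 4) + 1).

Section BoltzmannKac.
Variable R : realType.

Definition test_function (phi : R -> R) : Prop :=
  continuous phi /\ compact (closure [set x | phi x != 0]).

Definition bk_gain (phi : R -> R) (mu : probability R R) : R :=
  \int[@lebesgue_measure R]_(theta in `[- pi, pi])
    ((\int[mu]_v \int[mu]_w phi (cos theta * v - sin theta * w)) / (2 * pi)).

Definition boltzmann_kac_solution (mu : R -> probability R R) : Prop :=
  (forall phi, test_function phi ->
    has_derivative_on_nonneg
      (fun T => \int[mu T]_v phi v)
      (fun T => - 2 * (\int[mu T]_v phi v) + 2 * bk_gain phi (mu T))) /\
  (forall T, 0 <= T ->
    (\int[mu T]_v ((v ^+ 2)%R)%:E = \int[mu 0%R]_v ((v ^+ 2)%R)%:E)%E).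

End BoltzmannKac.

Section ProductMeasure.
Variable R : realType.

Definition tuple_cons (n : nat) (x : R * n.-tuple R) : n.+1.-tuple R :=
  [the n.+1.-tuple R of x.1 :: x.2].

Lemma measurable_tuple_cons n : measurable_fun setT (@tuple_cons n).
Proof. exact: measurable_cons. Qed.

HB.instance Definition _ n :=
  isMeasurableFun.Build _ _ _ _ (@tuple_cons n) (@measurable_tuple_cons n).

Fixpoint product_probability (mu : probability R R) (N : nat) :
    probability (N.-tuple R) R :=
  match N with
  | 0 => \d_[tuple]
  | n.+1 => distribution (mu \x product_probability mu n)%E (@tuple_cons n)
  end.

End ProductMeasure.

Definition first_marginal (R : realType) (N : nat)
    (P : probability (N.-tuple R) R) (mu : probability R R) : Prop :=
  forall A : set R, measurable A -> mu A = P [set v | A (nth 0 v 0)].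

(* Main.v *)
Require Import Defs.
From HB Require Import structures.
From mathcomp Require Import all_boot all_order all_algebra all_fingroup.
From mathcomp Require Import all_classical all_reals all_analysis.
From mathcomp Require Import measurable_realfun.
From mathcomp Require Import zify ring lra.

Set Implicit Arguments.
Unset Strict Implicit.
Unset Printing Implicit Defensive.

Import Order.TTheory GRing.Theory Num.Theory.
Import numFieldNormedType.Exports.

Local Open Scope classical_set_scope.
Local Open Scope ring_scope.

(** Put eps = (N - 1)^(-alpha).  From time t_0 on, generation of chaos bounds the
    cumulants, and those involving two distinct sites are O(eps); for the
    all-distinct cumulant, which the norm does not see, this follows from the
    conservation of energy.  Hence the joint moments of v_1^2 and v_2^2 factorise
    up to O(eps).  The moments m_n of v_1^2 under F_t and those of mu_T satisfy
      m_n' = 2 p_n (2 m_n + sum_(0 < k < n) 'C(n, k) m_(n-k, k)) - 2 m_n,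
    where p_n is the mean of cos^(2n) and where m_(n-k, k) is respectively the
    joint moment and the product m_(n-k) m_k.  For n >= 2 one has p_n <= 3/8, so
    that the linear part is a contraction and, by induction on n, the difference
    of the moments is O(eps) uniformly in T; for n = 1 both sides are 1 by
    conservation of energy.  The equation for mu_T is only given against C_c test
    functions: it is used with min(v^2, K)^n - K^n, and K tends to infinity.
    Finally cumulants are polynomials in the moments, and the mixed cumulants of
    the product measure vanish. *)

(** * Differential inequalities and circle means *)

(** Bounds are kept in the form K^(n^2). Two complementary blocks of sizes a and b satisfy a^2 + b^2
    <= (a + b)^2, with enough room for the 2^n ways to split a list, so the inductions over moments
    and cumulants close with a base that depends neither on n nor on N.

    The moment hierarchy of F_t is not closed. At each time F_t is compared with the product of its
    own first marginal at that time: the one-site cumulants coincide and the mixed ones of the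
    product vanish, so the two-site moments factorise up to O(eps).

    The integrability of mu_T is proved, not assumed. On the sphere v_1^2 <= N, so the moments of
    mu_0 are at most N^n, and the truncated equation propagates a bound n! q^n with q depending on N
    and T. Such bounds only serve to make the cumulants of mu_T genuine derivatives and to let K
    tend to infinity; they disappear from the final constant.

    Symmetry at positive times is also proved: monomials of a given degree solve a finite linear
    system that commutes with relabelling the sites. *)

Section NonnegDerivative.
Context {R : realType}.
Implicit Types (u du : R -> R) (lam T e : R).

(** At 0 only right continuity is kept: with the derivative at positive times it is what the mean
    value theorem on [[0, T]] asks for. *)
Definition deriv_nonneg u du :=
  (forall t : R, 0 < t -> is_derive t 1 u (du t)) /\ u x @[x --> 0^'+] --> u 0.

Lemma has_derivative_on_nonnegP u du :
  has_derivative_on_nonneg u du -> deriv_nonneg u du.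
Proof.
move=> D; split=> [t t0|].
  have cv : h^-1 *: (u (h *: 1 + t) - u t) @[h --> 0^'] --> du t.
    apply/cvgrPdist_le => e e0.
    have /cvgrPdist_le/(_ e e0) := D t (ltW t0).
    rewrite near_withinE => near1.
    have near2 : \forall h \near 0^', 0 <= t + h.
      apply: nbhs_dnbhs.
      have : \forall h \near (0:R), `|h| < t.
        by apply/nbhs_normP; exists t => //= y /=; rewrite sub0r normrN.
      by apply: filterS => h; rewrite ltr_norml; lra.
    near=> h; have -> : h *: 1 + t = t + h by rewrite /GRing.scale/= mulr1 addrC.
    have := near near1 h; rewrite /= /GRing.scale/=; apply => //.
    by near: h.
  by apply: DeriveDef; [apply/cvg_ex; exists (du t)|apply/cvg_lim].
have D0 := D 0 (lexx _).
have cv : h^-1 * (u h - u 0) @[h --> 0^'+] --> du 0.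
  apply/cvgrPdist_le => e e0.
  have /cvgrPdist_le/(_ e e0) := D0.
  rewrite near_withinE near_withinE => near1.
  rewrite near_withinE; apply: filterS near1 => h.
  move=> H h0; have h0' : 0 <= 0 + h by rewrite add0r ltW.
  by have := H (lt0r_neq0 h0) h0'; rewrite add0r.
(* Right continuity at 0: [u h - u 0] is [h] times a convergent difference quotient. *)
have -> : u 0 = 0 * du 0 + u 0 by rewrite mul0r add0r.
have : h * (h^-1 * (u h - u 0)) + u 0 @[h --> 0^'+] --> 0 * du 0 + u 0.
  apply: cvgD; last exact: cvg_cst.
  apply: cvgM => //.
  by apply: cvg_within_filter; exact: cvg_id.
apply: cvg_trans; apply: near_eq_cvg; near=> h.
by rewrite mulrA divff ?mul1r ?subrK// gt_eqF.
Unshelve. all: by end_near. Qed.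

Lemma deriv_nonneg_continuous u du T : deriv_nonneg u du -> 0 < T ->
  {within `[0, T], continuous u}.
Proof.
move=> [du0 cu] T0; apply/continuous_within_itvP => //; split => //.
  move=> x; rewrite in_itv/= => /andP[x0 _].
  have [d _] := du0 _ x0.
  by apply/differentiable_continuous/derivable1_diffP.
have [d _] := du0 _ T0.
have : {for T, continuous u}.
  by apply/differentiable_continuous/derivable1_diffP.
by move=> /cvg_at_left_filter.
Qed.

Lemma is_derive_expRM (b x : R) :
  is_derive x 1 (fun t : R => expR (b * t)) (b * expR (b * x)).
Proof.
have d3 : is_derive x 1 ( *%R b) b.
  by apply: is_derive_eq; rewrite /GRing.scale/= mulr1.
have d4 : is_derive x 1 (expR \o ( *%R b)) (b * expR (b * x)).
  by apply: is_derive_eq; rewrite mulrC.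
exact: d4.
Qed.

(** The integrating factor makes [g] nonincreasing. The sign of [lam] is free, so the lemma serves
    both for growth and for relaxation. *)
Lemma gronwall_le u du lam T : deriv_nonneg u du -> 0 <= T ->
  (forall t, 0 < t < T -> du t <= lam * u t) -> u T <= expR (lam * T) * u 0.
Proof.
move=> Du; rewrite le_eqVlt => /predU1P[<- _|T0 H].
  by rewrite mulr0 expR0 mul1r.
pose g := fun t => expR (- lam * t) * u t.
have cE : continuous (fun t : R => expR (- lam * t)).
  move=> x; apply: continuous_comp; last exact: continuous_expR.
  by apply: mulrl_continuous.
have cg : {within `[0, T], continuous g}.
  have cu := deriv_nonneg_continuous Du T0.
  move=> x; apply: cvgM; last exact: cu.
  by apply: continuous_subspaceT.
have dg x : x \in `]0, T[%R ->
    is_derive x 1 g (expR (- lam * x) * (du x - lam * u x)).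
  rewrite in_itv/= => /andP[x0 _].
  have d1 := Du.1 x x0.
  have d2 : is_derive x 1 (fun t : R => expR (- lam * t))
              (- lam * expR (- lam * x)).
    exact: is_derive_expRM.
  have := @is_deriveM _ _ _ _ x 1 _ _ d2 d1.
  move=> d3; apply: (is_derive_eq d3).
  by rewrite /GRing.scale/=; ring.
have [c cT E] := MVT T0 dg cg.
have : g T <= g 0.
  rewrite -subr_le0 E pmulr_lle0 ?subr0//.
  rewrite pmulr_rle0 ?expR_gt0// subr_le0; apply: H.
  by move: cT; rewrite in_itv.
rewrite /g mulr0 expR0 mul1r mulNr expRN -ler_pdivlMl ?invr_gt0 ?expR_gt0//.
by rewrite invrK.
Qed.

Lemma deriv_nonneg_shift u du (k : R) : deriv_nonneg u du ->
  deriv_nonneg (fun t => u t + k) du.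
Proof.
move=> [d c]; split.
  move=> t t0; have := d t t0 => dt.
  have -> : (fun t => u t + k) = u \+ cst k by [].
  by apply: is_derive_eq; rewrite addr0.
by apply: cvgD => //; exact: cvg_cst.
Qed.

Lemma deriv_nonnegN u du : deriv_nonneg u du ->
  deriv_nonneg (fun t => - u t) (fun t => - du t).
Proof.
move=> [d c]; split; last exact: cvgN.
by move=> t t0; have := d t t0 => dt; apply: is_deriveN.
Qed.

Lemma deriv_nonnegD u du v dv : deriv_nonneg u du -> deriv_nonneg v dv ->
  deriv_nonneg (fun t => u t + v t) (fun t => du t + dv t).
Proof.
move=> [d c] [d' c']; split; last exact: cvgD.
move=> t t0; have := d t t0 => dt; have := d' t t0 => dt'; exact: is_deriveD.
Qed.

Lemma deriv_nonnegM u du v dv : deriv_nonneg u du -> deriv_nonneg v dv ->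
  deriv_nonneg (fun t => u t * v t) (fun t => u t * dv t + v t * du t).
Proof.
move=> [d c] [d' c']; split; last exact: cvgM.
move=> t t0; have := d t t0 => dt; have := d' t t0 => dt'; exact: is_deriveM.
Qed.

Lemma deriv_nonneg_sum (I : Type) (s : seq I) (u du : I -> R -> R) :
  (forall i, deriv_nonneg (u i) (du i)) ->
  deriv_nonneg (fun t => \sum_(i <- s) u i t) (fun t => \sum_(i <- s) du i t).
Proof.
move=> H; elim: s => [|i s IH].
  under [X in deriv_nonneg X _]eq_fun do rewrite big_nil.
  under [X in deriv_nonneg _ X]eq_fun do rewrite big_nil.
  split; last exact: cvg_cst.
  by move=> t t0; apply: is_derive_cst.
under [X in deriv_nonneg X _]eq_fun do rewrite big_cons.
under [X in deriv_nonneg _ X]eq_fun do rewrite big_cons.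
exact: deriv_nonnegD.
Qed.

Lemma deriv_nonneg_exp (a b : R) :
  deriv_nonneg (fun t => a * expR (b * t)) (fun t => b * (a * expR (b * t))).
Proof.
have dE (x : R) : is_derive x 1 (fun t : R => a * expR (b * t)) (b * (a * expR (b * x))).
  have := @is_deriveZ _ _ _ _ a x 1 _ (is_derive_expRM b x).
  by move=> d5; apply: (is_derive_eq d5); rewrite /GRing.scale/=; ring.
split => [x _|]; first exact: dE.
apply: cvg_at_right_filter; have [d _] := dE 0.
by move/derivable1_diffP/differentiable_continuous: d.
Qed.

Lemma deriv_nonneg_eq u du du' : deriv_nonneg u du ->
  (forall t, 0 < t -> du t = du' t) -> deriv_nonneg u du'.
Proof. by move=> [d c] E; split=> // t t0; rewrite -E//; exact: d. Qed.

(** After a shift by the equilibrium [e / lam] the inequality is homogeneous with rate [- lam].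
    Nothing grows with [T], which is the source of the uniformity in time of the final estimate. *)
Lemma gronwall_forced u du lam e T : deriv_nonneg u du -> 0 <= T -> 0 < lam ->
  0 <= e ->
  (forall t, 0 < t < T -> `|du t + lam * u t| <= e) ->
  `|u T| <= `|u 0| + e / lam.
Proof.
move=> Du T0 l0 e0 H.
have elam : 0 <= e / lam by rewrite divr_ge0// ltW.
have key v dv : deriv_nonneg v dv ->
    (forall t, 0 < t < T -> dv t + lam * v t <= e) -> v T <= `|v 0| + e / lam.
  move=> Dv Hv.
  have Hv' t : 0 < t < T -> dv t <= - lam * (v t + - (e / lam)).
    move=> /Hv; rewrite mulrDr !mulNr mulrN opprK mulrCA divff ?gt_eqF//.
    by rewrite mulr1; lra.
  have G := gronwall_le (deriv_nonneg_shift (- (e / lam)) Dv) T0 Hv'.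
  have : expR (- lam * T) * (v 0 - e / lam) <= `|v 0|.
    apply: (@le_trans _ _ (expR (- lam * T) * `|v 0|)).
      by rewrite ler_wpM2l ?expR_ge0//; have := ler_norm (v 0); lra.
    by rewrite ler_piMl// -expR0 ler_expR mulNr oppr_le0 mulr_ge0// ltW.
  by lra.
rewrite ler_norml; apply/andP; split; last first.
  by apply: key Du _ => t /H; rewrite ler_norml => /andP[].
have HN t : 0 < t < T -> - du t + lam * - u t <= e.
  by move=> /H; rewrite ler_norml mulrN; lra.
by have := key _ _ (deriv_nonnegN Du) HN; rewrite normrN; lra.
Qed.

End NonnegDerivative.

Section CircleMean.
Context {R : realType}.
Implicit Types (v w : R) (n : nat).

(** The mean of cos^(2n) over the circle, as a product of the ratios (2m + 1) / (2m + 2). *)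
Fixpoint wallis n : R :=
  if n is m.+1 then wallis m * ((m.*2.+1)%:R / (m.*2.+2)%:R) else 1.

Lemma wallis_ge0 n : 0 <= wallis n.
Proof. by elim: n => //= n IH; rewrite mulr_ge0. Qed.

Lemma wallis_le1 n : wallis n <= 1.
Proof.
elim: n => //= n IH; rewrite mulr_ile1 ?wallis_ge0 ?divr_ge0//.
by rewrite ler_pdivrMr ?ltr0n// mul1r ler_nat.
Qed.

(** The sequence is nonincreasing and 3/8 is its value at 2. Being below 1/2, it makes the rate
    [2 - 4 * wallis n] of the moment equation positive. *)
Lemma wallis2_le n : (2 <= n)%N -> wallis n <= 3 / 8.
Proof.
elim: n => // n IH; rewrite leq_eqVlt => /predU1P[[<-]|].
  rewrite [wallis 2](_ : _ = 1 * (1%:R / 2%:R) * (3%:R / 4%:R))//; lra.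
rewrite ltnS => /IH /= w.
apply: le_trans w; rewrite ler_piMr ?wallis_ge0//.
by rewrite ler_pdivrMr ?ltr0n// mul1r ler_nat.
Qed.

(** First component of the rotated pair (v, w); its derivative in [theta] is [circ w (- v)], the
    second component. *)
Definition circ v w (theta : R) : R := cos theta * v + sin theta * w.

Lemma is_derive_circ v w (x : R) :
  is_derive x 1 (circ v w) (- sin x * v + cos x * w).
Proof.
have -> : circ v w = (v \*: (@cos R) + w \*: (@sin R)) :> (R -> R).
  by apply/funext => y; rewrite /circ /= mulrC [sin _ * _]mulrC.
by apply: is_derive_eq; rewrite /GRing.scale/=; ring.
Qed.

Lemma continuous_circ v w : continuous (circ v w).
Proof.
move=> x; have [d _] := is_derive_circ v w x.
by apply/differentiable_continuous/derivable1_diffP.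
Qed.

Lemma circ_integrable (f : R -> R) : continuous f ->
  (@lebesgue_measure R).-integrable `[- pi, pi] (EFin \o f).
Proof.
move=> cf; apply: continuous_compact_integrable; first exact: segment_compact.
exact: continuous_subspaceT.
Qed.

Lemma lebesgue_circle : @lebesgue_measure R `[- pi, pi] = (2 * pi)%:E.
Proof.
rewrite lebesgue_measure_itv/= lte_fin.
have := pi_gt0 R => p0; rewrite ifT; last by lra.
by rewrite -EFinD; congr EFin; lra.
Qed.

Lemma continuous_circX v w n : continuous (fun x => circ v w x ^+ n).
Proof.
move=> x; apply: (@continuous_comp _ _ _ (circ v w) (fun y => y ^+ n)).
  exact: continuous_circ.
exact: exprn_continuous.
Qed.

(* With c = circ v w one has (c^(2n+1) c')' = (2n+1)(v^2+w^2) c^(2n) - (2n+2) c^(2n+2),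
   and the left-hand side integrates to 0 over the circle. *)
Lemma circle_mean v w n :
  \int[@lebesgue_measure R]_(theta in `[- pi, pi]) (circ v w theta ^+ (n.*2))
  = 2 * pi * wallis n * (v ^+ 2 + w ^+ 2) ^+ n.
Proof.
elim: n => [|n IH].
  under eq_Rintegral do rewrite expr0.
  rewrite Rintegral_cst//= [fine _](_ : _ = 2 * pi); last first.
    by rewrite [X in fine X]lebesgue_circle.
  by rewrite expr0; ring.
pose F (x : R) := circ v w x ^+ (n.*2.+1) * circ w (- v) x.
pose f (x : R) := (n.*2.+1)%:R * (v ^+ 2 + w ^+ 2) * circ v w x ^+ n.*2
                  - (n.*2.+2)%:R * circ v w x ^+ (n.+1).*2.
have dF (x : R) : is_derive x 1 F (f x).
  have d1 := is_derive_circ v w x.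
  have d2 := is_derive_circ w (- v) x.
  have d3 := @is_deriveX _ _ (circ v w) (n.*2.+1) x 1 _ d1.
  have d4 := @is_deriveM _ _ _ _ x 1 _ _ d3 d2.
  have FE : F = (circ v w) ^+ (n.*2.+1) * circ w (- v).
    by rewrite exprfctE; apply/funext.
  rewrite FE; apply: (is_derive_eq d4); rewrite exprfctE.
  rewrite /f /= /GRing.scale/= doubleS.
  set c := circ v w x; set c' := circ w (- v) x.
  have E1 : - sin x * v + cos x * w = c' by rewrite /c' /circ; ring.
  have E2 : - sin x * w + cos x * - v = - c by rewrite /c /circ; ring.
  have E3 : v ^+ 2 + w ^+ 2 = c ^+ 2 + c' ^+ 2.
    rewrite /c /c' /circ; have := cos2Dsin2 x => E.
    transitivity ((cos x ^+ 2 + sin x ^+ 2) * (v ^+ 2 + w ^+ 2)); last by ring.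
    by rewrite E mul1r.
  rewrite E1 E2 E3 -[in RHS]natr1 -mulr_natl !exprS.
  have -> : (c * (c * c ^+ n.*2)) = c ^+ n.*2 * c ^+ 2 by ring.
  rewrite -!natr1; ring.
have cf : continuous f.
  move=> x; rewrite /f; apply: cvgB; apply: cvgM; try exact: cvg_cst.
    exact: continuous_circX.
  exact: continuous_circX.
have cF : continuous F.
  move=> x; have [d _] := dF x.
  by apply/differentiable_continuous/derivable1_diffP.
have p0 := pi_gt0 R.
have If : \int[@lebesgue_measure R]_(theta in `[- pi, pi]) f theta = 0.
  rewrite /Rintegral (@continuous_FTC2 _ f F).
  - rewrite -EFinD /= [F pi](_ : _ = F (- pi)) ?subrr//.
    by rewrite /F /circ cosN sinN sinpi oppr0.
  - by lra.
  - exact: continuous_subspaceT.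
  - split.
    + by move=> x _; have [] := dF x.
    + by apply: cvg_at_right_filter; exact: cF.
    + by apply: cvg_at_left_filter; exact: cF.
  - move=> x _; rewrite derive1E; have d := dF x; exact: derive_val.
have icX k (a : R) : (@lebesgue_measure R).-integrable `[- pi, pi]
    (EFin \o (fun x => a * circ v w x ^+ k)).
  apply: circ_integrable => x; apply: cvgM; first exact: cvg_cst.
  exact: continuous_circX.
have icX1 k : (@lebesgue_measure R).-integrable `[- pi, pi]
    (EFin \o (fun x => circ v w x ^+ k)).
  by apply: circ_integrable => x; exact: continuous_circX.
rewrite /f RintegralB// RintegralZl// RintegralZl// in If.
rewrite IH in If.
set J := Rintegral _ _ _ in If *.
have n0 : (n.*2.+2)%:R != 0 :> R by rewrite pnatr_eq0.
apply: (mulfI n0); move/eqP: If; rewrite subr_eq0 => /eqP <-.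
have -> : wallis n.+1 = wallis n * (n.*2.+1%:R / n.*2.+2%:R) by [].
rewrite [_ ^+ n.+1]exprS.
by move: n0; set a := n.*2.+1%:R; set b := n.*2.+2%:R => b0; field.
Qed.

End CircleMean.

(** * Moments and cumulants *)

Section MomentCumulantRecursion.
Context {R : realType}.

(** Positions are distributed, not values: equal entries are told apart, as Leibniz's rule requires
    for repeated derivatives. *)
Fixpoint splits (I : Type) (s : seq I) : seq (seq I * seq I) :=
  if s is x :: s' then
    [seq (x :: p.1, p.2) | p <- splits s'] ++
    [seq (p.1, x :: p.2) | p <- splits s']
  else [:: ([::], [::])].

Lemma size_splits (I : Type) (s : seq I) : size (splits s) = (2 ^ size s)%N.
Proof. by elim: s => //= x s IH; rewrite size_cat !size_map IH addnn expnS mul2n. Qed.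

Lemma big_splits_cons (V : nmodType) (I : Type) (x : I) (s : seq I)
    (F : seq I * seq I -> V) :
  \sum_(p <- splits (x :: s)) F p =
  \sum_(p <- splits s) F (x :: p.1, p.2) + \sum_(p <- splits s) F (p.1, x :: p.2).
Proof. by rewrite /= big_cat !big_map. Qed.

Lemma splits_map (I J : Type) (f : I -> J) (s : seq I) :
  splits (map f s) = [seq (map f p.1, map f p.2) | p <- splits s].
Proof.
by elim: s => //= x s ->; rewrite map_cat -!map_comp.
Qed.

(* Proper splits: the first block is not the whole sequence. *)
Fixpoint psplits (I : Type) (s : seq I) : seq (seq I * seq I) :=
  if s is x :: s' then
    [seq (x :: p.1, p.2) | p <- psplits s'] ++
    [seq (p.1, x :: p.2) | p <- splits s']
  else [::].

Lemma big_splits_proper (V : nmodType) (I : Type) (s : seq I)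
    (F : seq I * seq I -> V) :
  \sum_(p <- splits s) F p = F (s, [::]) + \sum_(p <- psplits s) F p.
Proof.
elim: s F => [|x s IH] F; first by rewrite /= big_seq1 big_nil addr0.
by rewrite big_splits_cons (IH (fun p => F (x :: p.1, p.2))) /= big_cat !big_map
  /= addrA.
Qed.

Lemma splits_size (I : eqType) (s : seq I) p : p \in splits s ->
  (size p.1 + size p.2 = size s)%N.
Proof.
elim: s p => [|x s IH] p /=; first by rewrite inE => /eqP ->.
rewrite mem_cat => /orP[] /mapP[q /IH E ->] /=.
  by rewrite addSn E.
by rewrite addnS E.
Qed.

Lemma psplits_size (I : eqType) (s : seq I) p : p \in psplits s ->
  (size p.1 + size p.2 = size s /\ size p.1 < size s)%N.
Proof.
elim: s p => [|x s IH] p //=.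
rewrite mem_cat => /orP[] /mapP[q qs ->] /=.
  by have [E L] := IH _ qs; rewrite addSn E.
by have := splits_size qs => E; rewrite addnS E ltnS -E leq_addr.
Qed.

Lemma size_psplits (I : Type) (s : seq I) : (size (psplits s)).+1 = (2 ^ size s)%N.
Proof.
elim: s => //= x s IH; rewrite size_cat !size_map -addSn IH size_splits.
by rewrite addnn expnS mul2n.
Qed.

(** The sum over set partitions, organised by the block that contains the first label. In this
    recursive form either family determines the other on nonempty lists, and no partition has to be
    handled. *)
Definition moment_cumulant (I : Type) (kappa E : seq I -> R) :=
  E [::] = 1 /\
  forall z s, E (z :: s) = \sum_(p <- splits s) kappa (z :: p.1) * E p.2.

(** Restricts the recursion to selected sites: with labels in [unit] or [bool], estimates are
    required only for cumulants at one or two sites. *)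
Lemma moment_cumulant_map (I J : Type) (f : I -> J) (kappa E : seq J -> R) :
  moment_cumulant kappa E ->
  moment_cumulant (kappa \o map f) (E \o map f).
Proof.
move=> [E0 rec]; split=> //= z s.
by rewrite rec splits_map big_map.
Qed.

Section Bounds.
Context {I : eqType}.
Implicit Types (s : seq I) (kappa E : seq I -> R).

Lemma sum_seq_le (T : eqType) (r : seq T) (F : T -> R) (B : R) (k : nat) :
  0 <= B -> (size r <= k)%N -> (forall p, p \in r -> `|F p| <= B) ->
  `|\sum_(p <- r) F p| <= k%:R * B.
Proof.
move=> B0 rk H; apply: le_trans (ler_norm_sum _ _ _) _.
rewrite big_seq; apply: (@le_trans _ _ (\sum_(p <- r | p \in r) B)).
  exact: ler_sum.
rewrite -big_seq big_const_seq count_predT iter_addr_0 -[_ *+ size r]mulr_natl.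
by rewrite ler_wpM2r// ler_nat.
Qed.

Lemma expr2_ge1 (n : nat) : (1 : R) <= 2 ^+ n.
Proof. by rewrite exprn_ege1// ler1n. Qed.

Lemma sqr_split_le (K : R) (a b n : nat) : 1 <= K -> (a + b = n)%N ->
  K ^+ (a ^ 2) * K ^+ (b ^ 2) <= K ^+ (n ^ 2).
Proof.
move=> K1 <-; rewrite -exprD ler_weXn2l// sqrnD; exact: leq_addr.
Qed.

Variables (n0 : nat) (K eps : R).
Hypotheses (K1 : 1 <= K) (eps0 : 0 <= eps).
Let K0 : 0 <= K := le_trans ler01 K1.

(** The powers of [K] combine by (j + 1)^2 + m^2 <= (k + 1)^2, while the extra factor 2^(m^2) is at
    most 2^(k^2). *)
Lemma le_sq_term (j m k : nat) (x y : R) : 0 <= x -> x <= K ^+ (j.+1 ^ 2) ->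
  0 <= y -> y <= (2 * K) ^+ (m ^ 2) -> (j + m = k)%N ->
  x * y <= 2 ^+ (k ^ 2) * K ^+ (k.+1 ^ 2).
Proof.
move=> x0 xK y0 yK jmk.
apply: (@le_trans _ _ (K ^+ (j.+1 ^ 2) * (2 * K) ^+ (m ^ 2))).
  exact: ler_pM.
rewrite exprMn mulrCA; apply: ler_pM; rewrite ?mulr_ge0 ?exprn_ge0//.
- by rewrite ler_weXn2l ?ler1n// leq_sqr -jmk leq_addl.
- by apply: sqr_split_le; rewrite ?addSn ?jmk.
Qed.

(** The gap (k + 1)^2 - k^2 = 2k + 1 between exponents pays for the 2^k splits of a list of size k,
    and for a further factor 2 in the Lipschitz estimates. *)
Lemma sq_final (a k : nat) : (a <= k * 2 + 1)%N ->
  (2 ^+ a * (2 ^+ (k ^ 2) * K ^+ (k.+1 ^ 2)) <= (2 * K) ^+ (k.+1 ^ 2) :> R).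
Proof.
move=> ak; rewrite mulrA -exprD exprMn ler_wpM2r ?exprn_ge0 ?K0//.
rewrite ler_weXn2l ?ler1n//; move: ak; rewrite -(addn1 k) sqrnD; lia.
Qed.

Lemma moment_bound kappa E : moment_cumulant kappa E ->
  (forall s, (0 < size s <= n0)%N -> `|kappa s| <= K ^+ (size s ^ 2)) ->
  forall s, (size s <= n0)%N -> `|E s| <= (2 * K) ^+ (size s ^ 2).
Proof.
move=> [E0 rec] Hk s; have [m] := ubnP (size s).
elim: m s => // m IH [|z s]//=; rewrite ?E0 ?normr1 ?expr0// ltnS => sm sn.
rewrite rec.
apply: (le_trans _ (@sq_final (size s) (size s) _)); last by lia.
rewrite -natrX; apply: sum_seq_le.
- by rewrite mulr_ge0 ?exprn_ge0//.
- by rewrite size_splits.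
- move=> [a b] /splits_size /= ps; rewrite normrM; apply: (le_sq_term _ _ _ _ ps) => //.
    by apply: (Hk (z :: a)); rewrite /= (leq_ltn_trans _ sn)// -ps leq_addr.
  by apply: IH; lia.
Qed.

(** Moments are polynomials in the cumulants, so an error [eps] is transported linearly; the
    induction is that of [moment_bound], with each product difference telescoped. *)
Lemma moment_lipschitz kappa kappa' E E' :
  moment_cumulant kappa E -> moment_cumulant kappa' E' ->
  (forall s, (0 < size s <= n0)%N -> `|kappa s| <= K ^+ (size s ^ 2)) ->
  (forall s, (0 < size s <= n0)%N -> `|kappa' s| <= K ^+ (size s ^ 2)) ->
  (forall s, (0 < size s <= n0)%N ->
     `|kappa s - kappa' s| <= eps * K ^+ (size s ^ 2)) ->
  forall s, (size s <= n0)%N -> `|E s - E' s| <= eps * (2 * K) ^+ (size s ^ 2).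
Proof.
move=> H H' Hk Hk' D s.
have bE := moment_bound H Hk; move: H H' => [E0 rec] [E0' rec'].
have [m] := ubnP (size s).
elim: m s => // m IH [|z s]//=.
  by rewrite E0 E0' subrr normr0 expr0 mulr1.
rewrite ltnS => sm sn; rewrite rec rec' -sumrB.
(* The exponent [(size s).+1] counts the 2^k splits and the two terms into which each difference of
   products is cut. *)
apply: (le_trans _ (ler_wpM2l eps0 (@sq_final (size s).+1 (size s) _))); last by lia.
rewrite mulrCA exprSr -mulrA -natrX; apply: sum_seq_le.
- by rewrite !mulr_ge0 ?exprn_ge0//.
- by rewrite size_splits.
- move=> [a b] /splits_size /= ps.
  have s1 : (0 < size (z :: a) <= n0)%N.
    by rewrite /= (leq_ltn_trans _ sn)// -ps leq_addr.
  have -> : kappa (z :: a) * E b - kappa' (z :: a) * E' b =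
    (kappa (z :: a) - kappa' (z :: a)) * E b
    + kappa' (z :: a) * (E b - E' b) by ring.
  apply: le_trans (ler_normD _ _) _.
  rewrite !normrM mulr_natl mulr2n; apply: lerD.
    apply: le_trans (ler_pM _ _ (D _ s1) (bE b _)) _ => //; first by lia.
    rewrite -mulrA ler_wpM2l//; apply: (le_sq_term _ _ _ _ ps) => //.
    - by rewrite exprn_ge0.
    - by rewrite exprn_ge0// mulr_ge0.
  apply: le_trans (ler_pM _ _ (Hk' _ s1) (IH b _ _)) _ => //; [by lia|by lia|].
  rewrite mulrCA ler_wpM2l//; apply: (le_sq_term _ _ _ _ ps) => //.
  - by rewrite exprn_ge0.
  - by rewrite exprn_ge0// mulr_ge0.
Qed.

Lemma cumulant_rec kappa E z s : moment_cumulant kappa E ->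
  kappa (z :: s) = E (z :: s) - \sum_(p <- psplits s) kappa (z :: p.1) * E p.2.
Proof.
by move=> [E0 rec]; rewrite rec big_splits_proper /= E0 mulr1 addrK.
Qed.

(** Here the inductive factor 2 sits on the cumulant. Its block is proper, so j + 1 <= k and
    2^((j+1)^2) still fits in 2^(k^2). *)
Lemma le_sq_term' (j m k : nat) (x y : R) : 0 <= x ->
  x <= (2 * K) ^+ (j.+1 ^ 2) ->
  0 <= y -> y <= K ^+ (m ^ 2) -> (j + m = k)%N -> (j < k)%N ->
  x * y <= 2 ^+ (k ^ 2) * K ^+ (k.+1 ^ 2).
Proof.
move=> x0 xK y0 yK jmk jk.
apply: (@le_trans _ _ ((2 * K) ^+ (j.+1 ^ 2) * K ^+ (m ^ 2))).
  exact: ler_pM.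
rewrite exprMn -mulrA; apply: ler_pM; rewrite ?mulr_ge0 ?exprn_ge0//.
- by rewrite ler_weXn2l ?ler1n// leq_sqr.
- by apply: sqr_split_le; rewrite ?addSn ?jmk.
Qed.

Lemma le_sq_base (k : nat) : K ^+ (k.+1 ^ 2) <= 2 ^+ (k ^ 2) * K ^+ (k.+1 ^ 2).
Proof. by rewrite ler_peMl ?expr2_ge1// exprn_ge0. Qed.

Lemma cumulant_bound kappa E : moment_cumulant kappa E ->
  (forall s, (size s <= n0)%N -> `|E s| <= K ^+ (size s ^ 2)) ->
  forall s, (0 < size s <= n0)%N -> `|kappa s| <= (2 * K) ^+ (size s ^ 2).
Proof.
move=> H HE s; have [m] := ubnP (size s).
elim: m s => // m IH [|z s]//=; rewrite ltnS => sm sn.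
rewrite (cumulant_rec z s H).
apply: (le_trans _ (@sq_final (size s) (size s) _)); last by lia.
apply: le_trans (ler_normB _ _) _.
(* There are 2^k - 1 proper splits; the unit left over from 2^k pays for the moment [E (z :: s)]. *)
rewrite -natrX -size_psplits -natr1 mulrDl mul1r addrC; apply: lerD; last first.
  by apply: le_trans (le_sq_base _); exact: HE.
apply: sum_seq_le => //.
- by rewrite mulr_ge0 ?exprn_ge0//.
- move=> [a b] /psplits_size[/= ps pl]; rewrite normrM.
  apply: (le_sq_term' _ _ _ _ ps) => //.
    by apply: (IH (z :: a)); rewrite /= ?(leq_ltn_trans _ sn)// -?ps ?leq_addr//; lia.
  by apply: HE; lia.
Qed.

Lemma cumulant_lipschitz kappa kappa' E E' :
  moment_cumulant kappa E -> moment_cumulant kappa' E' ->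
  (forall s, (size s <= n0)%N -> `|E s| <= K ^+ (size s ^ 2)) ->
  (forall s, (size s <= n0)%N -> `|E' s| <= K ^+ (size s ^ 2)) ->
  (forall s, (size s <= n0)%N -> `|E s - E' s| <= eps * K ^+ (size s ^ 2)) ->
  forall s, (0 < size s <= n0)%N ->
    `|kappa s - kappa' s| <= eps * (2 * K) ^+ (size s ^ 2).
Proof.
move=> H H' HE HE' D s.
have bk := cumulant_bound H HE; have bk' := cumulant_bound H' HE'.
have [m] := ubnP (size s).
elim: m s => // m IH [|z s]//=; rewrite ltnS => sm sn.
rewrite (cumulant_rec z s H) (cumulant_rec z s H').
apply: (le_trans _ (ler_wpM2l eps0 (@sq_final (size s).+1 (size s) _))); last by lia.
set S := \sum_(p <- _) _; set S' := \sum_(p <- _) _.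
have -> : E (z :: s) - S - (E' (z :: s) - S') = (E (z :: s) - E' (z :: s)) + (S' - S).
  by ring.
rewrite -sumrB.
apply: le_trans (ler_normD _ _) _.
rewrite [in X in _ <= X]exprSr -natrX -size_psplits -natr1 mulrDl mul1r.
rewrite mulrDl mulrDr addrC; apply: lerD; last first.
  apply: le_trans (D _ _) _ => //; rewrite ler_wpM2l//.
  apply: le_trans (le_sq_base _) _; rewrite ler_peMl ?ler1n//.
  by rewrite mulr_ge0 ?exprn_ge0//.
rewrite -mulrA mulrCA; apply: sum_seq_le => //.
- by rewrite !mulr_ge0 ?exprn_ge0//.
- move=> [a b] /psplits_size[/= ps pl].
  have s1 : (0 < size (z :: a) <= n0)%N.
    by rewrite /= (leq_ltn_trans _ sn)// -ps leq_addr.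
  have -> : kappa' (z :: a) * E' b - kappa (z :: a) * E b =
    - ((kappa (z :: a) - kappa' (z :: a)) * E b
    + kappa' (z :: a) * (E b - E' b)) by ring.
  rewrite normrN; apply: le_trans (ler_normD _ _) _.
  rewrite !normrM [2 * _]mulr_natl mulr2n mulrDr; apply: lerD.
    apply: le_trans (ler_pM _ _ (IH (z :: a) _ s1) (HE b _)) _ => //;
      [by rewrite /=; lia|by lia|].
    rewrite -mulrA ler_wpM2l//; apply: (le_sq_term' _ _ _ _ ps) => //.
    - by rewrite exprn_ge0// mulr_ge0.
    - by rewrite exprn_ge0.
  apply: le_trans (ler_pM _ _ (bk' _ s1) (D b _)) _ => //; first by lia.
  rewrite mulrCA ler_wpM2l//; apply: (le_sq_term' _ _ _ _ ps) => //.
  - by rewrite exprn_ge0// mulr_ge0.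
  - by rewrite exprn_ge0.
Qed.

End Bounds.
End MomentCumulantRecursion.

(** * Energy cumulants of a probability measure *)

Section LineDerivative.
Context {R : realType} {V : normedModType R}.
Implicit Types (f g : V -> R) (x v : V).

(** Carries partial derivatives to one real variable, where the chain rule and the locality of the
    derivative are applied. *)
Lemma is_derive_line f x v (l : R) :
  is_derive x v f l <-> is_derive (0 : R) 1 (fun h : R => f (h *: v + x)) l.
Proof.
have E : (fun h : R => h^-1 *: (f (h *: v + x) - f x)) =
    (fun h : R => h^-1 *: (((fun h : R => f (h *: v + x)) \o shift 0) (h *: (1 : R))
      - f (0 *: v + x))).
  by apply/funext => h /=; rewrite addr0 scale0r add0r [_%:A]mulr1.
split=> -[d e]; apply: DeriveDef.
- by have /derivable1P := d.
- by rewrite -e /derive /= E.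
- by apply/derivable1P.
- by rewrite -e /derive /= E.
Qed.

Lemma is_derive_line_comp f (g : R -> R) x v (l k : R) :
  is_derive x v f l -> is_derive (f x) 1 g k -> is_derive x v (g \o f) (k * l).
Proof.
move=> /is_derive_line df dg; apply/is_derive_line.
have dg' : is_derive (f (0 *: v + x)) 1 g k by rewrite scale0r add0r.
exact: (@is_derive1_comp _ g (fun h : R => f (h *: v + x)) 0 k l dg' df).
Qed.

Lemma is_derive_line_unique f g x v (l k : R) :
  (\forall h \near (0 : R), f (h *: v + x) = g (h *: v + x)) ->
  is_derive x v f l -> is_derive x v g k -> l = k.
Proof.
move=> fg /is_derive_line df /is_derive_line dg.
have dg' := near_eq_is_derive fg df.
by have [_ <-] := dg; have [_ <-] := dg'.
Qed.

End LineDerivative.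

Section EnergyMoments.
Context {R : realType} {N : nat}.
Implicit Types (v : N.-tuple R) (xi : 'rV[R]_N) (s : seq 'I_N) (P : probability (N.-tuple R) R).

Definition energy s v : R := \prod_(i <- s) (tnth v i) ^+ 2.
Definition total_energy v : R := \sum_(i < N) (tnth v i) ^+ 2.
Definition tilt xi v : R := expR (\sum_(i < N) xi ord0 i * (tnth v i) ^+ 2).
(** Unnormalised moment under the tilted measure: the moment generating function for the empty list,
    and each partial derivative adds one label. *)
Definition energy_mgf P s xi : R := \int[P]_v (energy s v * tilt xi v).
Definition energy_moment P s : R := \int[P]_v energy s v.

Lemma energy_ge0 s v : 0 <= energy s v.
Proof. by rewrite prodr_ge0// => i _; exact: sqr_ge0. Qed.

Lemma total_energy_ge0 v : 0 <= total_energy v.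
Proof. by rewrite sumr_ge0// => i _; exact: sqr_ge0. Qed.

Lemma energy_le s v : energy s v <= total_energy v ^+ size s.
Proof.
elim: s => [|i s IH]; rewrite /energy ?big_nil ?expr0// big_cons /= [_ ^+ (size s).+1]exprS.
apply: ler_pM => //; [exact: sqr_ge0|exact: energy_ge0|].
rewrite /total_energy (bigD1 i)//= lerDl sumr_ge0// => j _; exact: sqr_ge0.
Qed.

Lemma energy_cons i s v : energy (i :: s) v = tnth v i ^+ 2 * energy s v.
Proof. by rewrite /energy big_cons. Qed.

Lemma energy_cat s1 s2 v : energy (s1 ++ s2) v = energy s1 v * energy s2 v.
Proof. by rewrite /energy big_cat. Qed.

Lemma energy_perm s1 s2 v : perm_eq s1 s2 -> energy s1 v = energy s2 v.
Proof. exact: perm_big. Qed.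

Lemma measurable_coordX (i : 'I_N) k :
  measurable_fun setT (fun v : N.-tuple R => tnth v i ^+ k).
Proof. by apply: measurable_funX; exact: measurable_tnth. Qed.

Lemma measurable_energy s : measurable_fun setT (energy s).
Proof. by apply: measurable_prod => i _; exact: measurable_coordX. Qed.

Lemma measurable_total_energy : measurable_fun setT total_energy.
Proof. by apply: measurable_sum => i; exact: measurable_coordX. Qed.

Lemma measurable_tilt xi : measurable_fun setT (tilt xi).
Proof.
apply: measurableT_comp => //; apply: measurable_sum => i.
by apply: measurable_funM => //; exact: measurable_coordX.
Qed.

Lemma measurable_energy_tilt s xi :
  measurable_fun setT (fun v => energy s v * tilt xi v).
Proof.
by apply: measurable_funM; [exact: measurable_energy|exact: measurable_tilt].
Qed.

Lemma tilt_shift xi i (h : R) v :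
  tilt (h *: delta_mx ord0 i + xi) v = expR (h * tnth v i ^+ 2) * tilt xi v.
Proof.
rewrite /tilt -expRD; congr expR.
under eq_bigr do rewrite mxE mulrDl.
rewrite big_split /=; congr (_ + _).
rewrite (bigD1 i)//= big1 ?addr0 ?mxE ?eqxx ?mulr1// => j ji.
by rewrite !mxE (negbTE ji) andbF mulr0 mul0r.
Qed.

Lemma tilt0 v : tilt 0 v = 1.
Proof. by rewrite /tilt big1 ?expR0// => i _; rewrite mxE mul0r. Qed.

(** One term of the exponential series. A power costs an arbitrarily small part of the rate, so
    tilted moments stay integrable strictly below the critical rate. *)
Lemma expr_le_expR (k : nat) (eta x : R) : 0 <= x -> 0 < eta ->
  x ^+ k <= k`!%:R / eta ^+ k * expR (eta * x).
Proof.
move=> x0 e0.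
have h : (eta * x) ^+ k <= k`!%:R * expR (eta * x).
  case: k => [|k].
    by rewrite fact0 mul1r expr0 -expR0 ler_expR mulr_ge0// ltW.
  have := @expR_ge1Dxn _ (eta * x) k (mulr_ge0 (ltW e0) x0).
  rewrite -ler_pdivrMl ?ltr0n ?fact_gt0// [_^-1 * _]mulrC.
  by apply: le_trans; rewrite lerDr.
rewrite mulrAC ler_pdivlMr ?exprn_gt0//.
by rewrite -exprMn mulrC.
Qed.

Variable P : probability (N.-tuple R) R.
Variable eps : R.
Hypothesis eps0 : 0 < eps.
Hypothesis intP : P.-integrable setT (EFin \o (fun v => expR (eps * total_energy v))).

(** Energies are nonnegative, so upper bounds suffice. The domain contains 0 and is open along each
    coordinate line, so identities that hold on it can be differentiated. *)
Definition tilt_dom xi := forall i, xi ord0 i < eps.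

Lemma tilt_dom0 : tilt_dom 0.
Proof. by move=> i; rewrite mxE. Qed.

Lemma energy_tilt_integrable s xi : tilt_dom xi ->
  P.-integrable setT (EFin \o (fun v => energy s v * tilt xi v)).
Proof.
(* The largest rate that occurs, with a default below [eps]; the gap [eps - e'] absorbs the
   polynomial factor. *)
move=> xiD; pose e' := \big[Num.max/(eps / 2)]_i xi ord0 i.
have e2 : eps / 2 < eps by rewrite ltr_pdivrMr// ltr_pMr// ltr1n.
have e'lt : e' < eps by apply: bigmax_lt.
have xie' i : xi ord0 i <= e' by apply: le_bigmax.
pose C := (size s)`!%:R / (eps - e') ^+ size s.
have := integrableZl measurableT C intP.
apply: le_integrable => //.
  by apply/measurable_EFinP; exact: measurable_energy_tilt.
move=> v _ /=; rewrite lee_fin.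
rewrite !ger0_norm ?mulr_ge0 ?energy_ge0 ?expR_ge0 ?divr_ge0 ?exprn_ge0 ?subr_ge0 ?(ltW e'lt)//.
apply: (@le_trans _ _ (total_energy v ^+ size s * expR (e' * total_energy v))).
  apply: ler_pM; rewrite ?energy_ge0 ?expR_ge0 ?energy_le//.
  rewrite ler_expR /total_energy mulr_sumr; apply: ler_sum => i _.
  by rewrite ler_wpM2r ?sqr_ge0.
have e1 : 0 < eps - e' by rewrite subr_gt0.
have := expr_le_expR (size s) (total_energy_ge0 v) e1.
move=> /(ler_wpM2r (expR_ge0 (e' * total_energy v))) /le_trans; apply.
  by rewrite -[X in X <= _]mulrA -expRD -mulrDl subrK.
by rewrite invr_ge0 exprn_ge0// subr_ge0 ltW.
Qed.

Lemma tilt_dom_line xi i : tilt_dom xi ->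
  \forall h \near (0 : R), tilt_dom (h *: delta_mx ord0 i + xi).
Proof.
move=> xiD; have r0 : 0 < eps - xi ord0 i by rewrite subr_gt0.
have : \forall h \near (0 : R), `|h| < eps - xi ord0 i.
  by apply/nbhs_normP; exists (eps - xi ord0 i) => //= y /=; rewrite sub0r normrN.
apply: filterS => h; rewrite ltr_norml => /andP[_ hlt] j; rewrite !mxE /=.
have [->|ji] := eqVneq j i; first by rewrite mulr1; lra.
by rewrite mulr0 add0r.
Qed.

Lemma is_derive_energy_mgf s xi i : tilt_dom xi ->
  is_derive xi (delta_mx ord0 i) (energy_mgf P s) (energy_mgf P (i :: s) xi).
Proof.
move=> xiD; apply/is_derive_line.
pose r := (eps - xi ord0 i) / 2.
have r0 : 0 < r by rewrite divr_gt0// subr_gt0.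
pose f (h : R) v := energy s v * tilt (h *: delta_mx ord0 i + xi) v.
(* The derivative in [h] is nonnegative and nondecreasing in [h], so its value at the right end [r]
   dominates it on the interval. *)
pose G v := energy (i :: s) v * tilt (r *: delta_mx ord0 i + xi) v.
have domh (h : R) : h <= r -> tilt_dom (h *: delta_mx ord0 i + xi).
  move=> hr j; rewrite !mxE /=; have [->|ji] := eqVneq j i.
    by rewrite mulr1; rewrite /r in hr; have := xiD i; lra.
  by rewrite mulr0 add0r.
have df v (h : R) : is_derive h 1 (f ^~ v)
    (energy (i :: s) v * tilt (h *: delta_mx ord0 i + xi) v).
  have -> : f ^~ v = (energy s v * tilt xi v) \*: (fun h : R => expR (tnth v i ^+ 2 * h)).
    apply/funext => k; rewrite /f tilt_shift /= /GRing.scale/= [k * _]mulrC.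
    by ring.
  have d := @is_deriveZ _ _ _ _ (energy s v * tilt xi v) h 1 _ (is_derive_expRM (tnth v i ^+ 2) h).
  apply: (is_derive_eq d); rewrite /GRing.scale/= tilt_shift energy_cons.
  by rewrite [h * _]mulrC; ring.
have I0 : [set` `]-r, r[%R] (0 : R) by rewrite /= in_itv/= oppr_lt0 r0.
have f1 x : [set` `]-r, r[%R] x -> P.-integrable setT (EFin \o f x).
  rewrite /= in_itv/= => /andP[_ xr].
  by apply: energy_tilt_integrable; apply: domh; exact: ltW.
have f2 x y : [set` `]-r, r[%R] x -> setT y -> derivable (f ^~ y) x 1.
  by move=> _ _; have [] := df y x.
have f3 v : 0 <= G v by rewrite mulr_ge0 ?energy_ge0 ?expR_ge0.
have f4 : P.-integrable setT (EFin \o G).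
  by apply: energy_tilt_integrable; exact: domh.
have f5 x y : [set` `]-r, r[%R] x -> setT y -> `|partial1of2 f x y| <= G y.
  rewrite /= in_itv/= => /andP[_ xr] _; rewrite partial1of2E.
  have [_ ->] := df y x; rewrite ger0_norm ?mulr_ge0 ?energy_ge0 ?expR_ge0//.
  rewrite ler_wpM2l ?energy_ge0// !tilt_shift ler_wpM2r ?expR_ge0//.
  by rewrite ler_expR ler_wpM2r ?sqr_ge0// ltW.
have E : (fun h : R => energy_mgf P s (h *: delta_mx ord0 i + xi)) =
    (fun h => \int[P]_(v in setT) f h v) by [].
apply: DeriveDef; rewrite E.
  exact: (derivable_under_integral measurableT I0 f1 f2 f3 f4 f5).
rewrite -derive1E (differentiation_under_integral measurableT I0 f1 f2 f3 f4 f5).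
apply: eq_Rintegral => v _; rewrite partial1of2E.
by have [_ ->] := df v 0; rewrite scale0r add0r.
Qed.

Lemma energy_mgf_gt0 xi : tilt_dom xi -> 0 < energy_mgf P [::] xi.
Proof.
move=> xiD; have int := energy_tilt_integrable [::] xiD.
rewrite lt_neqAle Rintegral_ge0 ?andbT; last first.
  by move=> v _; rewrite mulr_ge0 ?energy_ge0 ?expR_ge0.
apply/negP => /eqP/esym I0.
have : (\int[P]_(v in setT) `|(energy [::] v * tilt xi v)%:E|)%E = 0%E.
  rewrite -[RHS]/(0%:E) -I0 /energy_mgf /Rintegral fineK; last first.
    exact: integrable_fin_num.
  apply: eq_integral => v _ /=; rewrite ger0_norm//.
  by rewrite mulr_ge0 ?energy_ge0 ?expR_ge0.
move/ae_eq_integral_abs => /(_ measurableT) H.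
have {H} [|A [mA A0 H]] := H.
  by apply/measurable_EFinP; exact: measurable_energy_tilt.
(* The integrand vanishes nowhere, so the exceptional null set [A] is the whole space. *)
have AT : A = setT.
  rewrite eqEsubset; split => // v _; apply: H => /= /(_ I) [] /eqP.
  by rewrite /energy big_nil mul1r gt_eqF ?expR_gt0.
have := probability_setT P; rewrite -AT A0 => /esym/eqP.
by rewrite eqe oner_eq0.
Qed.

Lemma energy_mgf0 s : energy_mgf P s 0 = energy_moment P s.
Proof. by apply: eq_Rintegral => v _; rewrite tilt0 mulr1. Qed.

Lemma energy_moment_nil : energy_moment P [::] = 1.
Proof.
rewrite /energy_moment /energy; under eq_Rintegral do rewrite big_nil.
by rewrite Rintegral_cst//= mul1r [X in fine X]probability_setT.
Qed.

Lemma energy_mgf_perm s1 s2 xi : perm_eq s1 s2 ->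
  energy_mgf P s1 xi = energy_mgf P s2 xi.
Proof. by move=> p; apply: eq_Rintegral => v _; rewrite (energy_perm v p). Qed.

(* Formal expressions in the tilted moments; the formal derivations
   commute, which replaces Schwarz's theorem for the iterated partials. *)
Inductive mgf_expr :=
  | Mom of seq 'I_N | InvM | LogM | Cst of R
  | Add of mgf_expr & mgf_expr | Mul of mgf_expr & mgf_expr.

Fixpoint mgf_eval (e : mgf_expr) xi : R :=
  match e with
  | Mom s => energy_mgf P s xi
  | InvM => (energy_mgf P [::] xi)^-1
  | LogM => ln (energy_mgf P [::] xi)
  | Cst c => c
  | Add e f => mgf_eval e xi + mgf_eval f xi
  | Mul e f => mgf_eval e xi * mgf_eval f xi
  end.

Fixpoint mgf_deriv i (e : mgf_expr) : mgf_expr :=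
  match e with
  | Mom s => Mom (i :: s)
  | InvM => Mul (Cst (-1)) (Mul (Mul InvM InvM) (Mom [:: i]))
  | LogM => Mul InvM (Mom [:: i])
  | Cst _ => Cst 0
  | Add e f => Add (mgf_deriv i e) (mgf_deriv i f)
  | Mul e f => Add (Mul (mgf_deriv i e) f) (Mul e (mgf_deriv i f))
  end.

Lemma is_derive_mgf_eval e xi i : tilt_dom xi ->
  is_derive xi (delta_mx ord0 i) (mgf_eval e) (mgf_eval (mgf_deriv i e) xi).
Proof.
move=> xiD; elim: e => [s||| c|e IHe f IHf|e IHe f IHf] /=.
- exact: is_derive_energy_mgf.
- have M0 : energy_mgf P [::] xi != 0 by rewrite gt_eqF// energy_mgf_gt0.
  have d1 := is_derive_energy_mgf [::] i xiD.
  have d2 := @is_deriveV _ (@id R) (energy_mgf P [::] xi) 1 1 M0 (is_derive_id _ _).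
  have d3 := is_derive_line_comp d1 d2.
  apply: (is_derive_eq d3).
  by rewrite /GRing.scale/= mulr1 mulN1r mulNr -exprVn expr2.
- have d1 := is_derive_energy_mgf [::] i xiD.
  have d2 := is_derive1_ln (energy_mgf_gt0 xiD).
  exact: (is_derive_line_comp d1 d2).
- exact: is_derive_cst.
- exact: is_deriveD.
- have d := @is_deriveM _ _ _ _ xi (delta_mx ord0 i) _ _ IHe IHf.
  by apply: (is_derive_eq d); rewrite /GRing.scale/= addrC mulrC.
Qed.

(** Formal derivatives evaluate to actual ones, so they agree as soon as the values agree on the
    domain, whatever the syntax. This is how analytic identities enter the formal calculus. *)
Lemma mgf_deriv_congr e f i : (forall xi, tilt_dom xi -> mgf_eval e xi = mgf_eval f xi) ->
  forall xi, tilt_dom xi ->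
    mgf_eval (mgf_deriv i e) xi = mgf_eval (mgf_deriv i f) xi.
Proof.
move=> H xi xiD.
apply: (is_derive_line_unique _ (is_derive_mgf_eval e i xiD) (is_derive_mgf_eval f i xiD)).
by apply: filterS (tilt_dom_line i xiD) => h; exact: H.
Qed.

Definition mgf_derivs e s := foldl (fun e i => mgf_deriv i e) e s.

Lemma mgf_derivs_congr s e f :
  (forall xi, tilt_dom xi -> mgf_eval e xi = mgf_eval f xi) ->
  forall xi, tilt_dom xi ->
    mgf_eval (mgf_derivs e s) xi = mgf_eval (mgf_derivs f s) xi.
Proof.
elim: s e f => [|i s IH] e f H //=; apply: IH; exact: mgf_deriv_congr.
Qed.

(** On the generators this is the symmetry of a product of energies in its labels; sums and products
    follow by Leibniz's rule. *)
Lemma mgf_deriv_comm i j e xi :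
  mgf_eval (mgf_deriv i (mgf_deriv j e)) xi =
  mgf_eval (mgf_deriv j (mgf_deriv i e)) xi.
Proof.
have p : energy_mgf P [:: i; j] xi = energy_mgf P [:: j; i] xi.
  by apply: energy_mgf_perm; rewrite (perm_catC [:: i] [:: j]).
elim: e => [s||| c|e IHe f IHf|e IHe f IHf] //=; rewrite ?p.
- by apply: energy_mgf_perm; rewrite (perm_catCA [:: i] [:: j] s).
- by ring.
- by ring.
- by rewrite IHe IHf.
- by rewrite IHe IHf; ring.
Qed.

Lemma mgf_derivs_move e i s1 s2 xi : tilt_dom xi ->
  mgf_eval (mgf_derivs e (s1 ++ i :: s2)) xi =
  mgf_eval (mgf_derivs e (i :: s1 ++ s2)) xi.
Proof.
elim: s1 e => //= j s1 IH e xiD; rewrite IH//=.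
by apply: mgf_derivs_congr => // xi' _; exact: mgf_deriv_comm.
Qed.

Lemma mgf_derivs_perm e s1 s2 xi : tilt_dom xi -> perm_eq s1 s2 ->
  mgf_eval (mgf_derivs e s1) xi = mgf_eval (mgf_derivs e s2) xi.
Proof.
move=> xiD; elim: s1 e s2 => [|i s1 IH] e s2.
  by rewrite perm_sym => /perm_nilP ->.
move=> p; have : i \in s2 by rewrite -(perm_mem p) inE eqxx.
move=> is2; move: p; case/splitPr: is2 => t1 t2 p.
rewrite mgf_derivs_move//=; apply: IH.
by move: p; rewrite perm_sym -cat1s perm_catCA /= perm_cons perm_sym.
Qed.

Definition cumulant s : R := mgf_eval (mgf_derivs LogM s) 0.

Lemma energy_cumulantE s : energy_cumulant P s = cumulant s.
Proof.
(* Stated on the whole domain: the next derivative needs the identity near the point, not just at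
   it. *)
have H xi : tilt_dom xi -> foldr (@partial R N) (log_energy_mgf P) s xi =
    mgf_eval (foldr mgf_deriv LogM s) xi.
  elim: s xi => [|i s IH] xi xiD /=.
    rewrite /log_energy_mgf /energy_mgf; congr ln; apply: eq_Rintegral => v _.
    by rewrite /energy big_nil mul1r.
  have d := is_derive_mgf_eval (foldr mgf_deriv LogM s) i xiD.
  rewrite /partial.
  have : is_derive xi (delta_mx ord0 i) (foldr (@partial R N) (log_energy_mgf P) s)
     (mgf_eval (mgf_deriv i (foldr mgf_deriv LogM s)) xi).
    apply/is_derive_line; move/is_derive_line: d; apply: near_eq_is_derive.
    by apply: filterS (tilt_dom_line i xiD) => h hD; rewrite IH.
  by case.
rewrite /energy_cumulant H; last exact: tilt_dom0.
(* [foldr] differentiates along the last label first and [mgf_derivs] along the first one; the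
   reversal is harmless by commutation. *)
have -> : foldr mgf_deriv LogM s = mgf_derivs LogM (rev s).
  by rewrite /mgf_derivs foldl_rev.
by apply: mgf_derivs_perm; [exact: tilt_dom0|rewrite perm_rev].
Qed.

Lemma cumulant_perm s1 s2 : perm_eq s1 s2 -> cumulant s1 = cumulant s2.
Proof. by apply: mgf_derivs_perm; exact: tilt_dom0. Qed.

Lemma mgf_derivs_add e f s xi : mgf_eval (mgf_derivs (Add e f) s) xi =
  mgf_eval (mgf_derivs e s) xi + mgf_eval (mgf_derivs f s) xi.
Proof. by elim: s e f => //= i s IH e f; rewrite IH. Qed.

Lemma mgf_derivs_mul e f s xi : mgf_eval (mgf_derivs (Mul e f) s) xi =
  \sum_(p <- splits s) mgf_eval (mgf_derivs e p.1) xi * mgf_eval (mgf_derivs f p.2) xi.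
Proof.
elim: s e f => [|i s IH] e f; first by rewrite big_seq1.
by rewrite big_splits_cons /= mgf_derivs_add !IH.
Qed.

Lemma mgf_derivs_mom s t : mgf_derivs (Mom t) s = Mom (catrev s t).
Proof. by elim: s t => //= i s IH t; rewrite IH. Qed.

(** Leibniz's rule applied to the identity d_z M = (d_z log M) M, where M is the moment generating
    function. *)
Lemma cumulant_moment : moment_cumulant cumulant (energy_moment P).
Proof.
split=> [|z s]; first exact: energy_moment_nil.
have -> : energy_moment P (z :: s) = mgf_eval (mgf_derivs (Mom [:: z]) s) 0.
  rewrite mgf_derivs_mom /= energy_mgf0 -!energy_mgf0; apply: energy_mgf_perm.
  by rewrite catrevE perm_sym perm_catC /= perm_cons perm_rev.
transitivity (mgf_eval (mgf_derivs (Mul (mgf_deriv z LogM) (Mom [::])) s) 0).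
  apply: mgf_derivs_congr; last exact: tilt_dom0.
  move=> xi xiD /=; rewrite mulrAC mulVf ?mul1r//.
  by rewrite gt_eqF// energy_mgf_gt0.
rewrite mgf_derivs_mul; apply: eq_bigr => p _; congr (_ * _).
rewrite mgf_derivs_mom /= -energy_mgf0; apply: energy_mgf_perm.
by rewrite catrevE cats0 perm_rev.
Qed.

Lemma mgf_derivs_cst c i s xi : mgf_eval (mgf_derivs (Cst c) (i :: s)) xi = 0.
Proof. by elim: s c i => //= j s IH c i; exact: IH. Qed.

(** The hypothesis is d_i d_j log M = 0 on the whole domain, so every further derivative vanishes
    too. *)
Lemma cumulant_eq0 s i j :
  (forall xi, tilt_dom xi -> energy_mgf P [:: i; j] xi * energy_mgf P [::] xi =
     energy_mgf P [:: i] xi * energy_mgf P [:: j] xi) ->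
  cumulant (i :: j :: s) = 0.
Proof.
move=> H; rewrite /cumulant /=.
rewrite (@mgf_derivs_congr _ _ (Cst 0)); last exact: tilt_dom0.
  by case: s => //= k s; exact: mgf_derivs_cst.
move=> xi xiD /=; have M0 : energy_mgf P [::] xi != 0.
  by rewrite gt_eqF// energy_mgf_gt0.
have /(canRL (mulfK M0)) := H xi xiD.
rewrite (@energy_mgf_perm [:: i; j] [:: j; i]) => [->|].
  by move: M0; set M := energy_mgf P [::] xi => M0; field.
by rewrite (perm_catC [:: i] [:: j]).
Qed.

(** When the total energy is the constant [c], the sum over j of d_j log M equals [c]; one more
    derivative, here along [i], removes it. *)
Lemma cumulant_sum0 (c : R) i s :
  (forall xi, tilt_dom xi ->
     \sum_(j < N) energy_mgf P [:: j] xi = c * energy_mgf P [::] xi) ->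
  \sum_(j < N) cumulant (j :: i :: s) = 0.
Proof.
move=> H.
have E : \sum_(j < N) cumulant (j :: i :: s) =
  mgf_eval (mgf_derivs (\big[Add/Cst 0]_(j < N) mgf_deriv j LogM) (i :: s)) 0.
  rewrite (big_morph (fun e => mgf_eval (mgf_derivs e (i :: s)) 0)
    (id1 := 0) (op1 := +%R)) //.
    by move=> e f; rewrite mgf_derivs_add.
  exact: mgf_derivs_cst.
rewrite E (@mgf_derivs_congr _ _ (Cst c)); first exact: mgf_derivs_cst.
  move=> xi xiD; rewrite (big_morph (fun e => mgf_eval e xi) (id1 := 0) (op1 := +%R))//=.
  rewrite -mulr_sumr H// mulrCA mulVf ?mulr1//.
  by rewrite gt_eqF// energy_mgf_gt0.
exact: tilt_dom0.
Qed.

End EnergyMoments.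

(** * Product measures *)

Section ProductMoments.
Context {R : realType}.
Variable mu : probability R R.
Implicit Types (N : nat).

Lemma integral_product_probability N (f : 'I_N -> R -> R) :
  (forall i x, 0 <= f i x) -> (forall i, measurable_fun setT (f i)) ->
  (\int[product_probability mu N]_v (\prod_(i < N) f i (tnth v i))%:E =
   \prod_(i < N) \int[mu]_x (f i x)%:E)%E.
Proof.
elim: N f => [|N IH] f f0 mf.
  rewrite big_ord0 /=; under eq_integral do rewrite big_ord0.
  by rewrite integral_cst//= diracT mule1.
have mF : measurable_fun setT (fun v : N.+1.-tuple R => (\prod_(i < N.+1) f i (tnth v i))%:E).
  apply/measurable_EFinP; apply: measurable_prod => i _.
  by apply: measurableT_comp => //; exact: measurable_tnth.
rewrite /= ge0_integral_distribution//; last first.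
  by move=> v; rewrite lee_fin prodr_ge0.
have E (x : R * N.-tuple R) :
    \prod_(i < N.+1) f i (tnth (tuple_cons x) i) =
    f ord0 x.1 * \prod_(i < N) f (lift ord0 i) (tnth x.2 i).
  rewrite big_ord_recl /tuple_cons /=; congr (_ * _).
  by apply: eq_bigr => i _; rewrite tnthS.
rewrite fubini_tonelli1; last 2 first.
- by apply: measurableT_comp => //; exact: measurable_tuple_cons.
- by move=> x; rewrite lee_fin prodr_ge0.
rewrite /fubini_F big_ord_recl -IH => [||i]; [|by []|by []].
have mG : measurable_fun setT
    (fun y : N.-tuple R => (\prod_(i < N) f (lift ord0 i) (tnth y i))%:E).
  apply/measurable_EFinP; apply: measurable_prod => i _.
  by apply: measurableT_comp => //; exact: measurable_tnth.
have G0 : (0 <= \int[product_probability mu N]_y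
     (\prod_(i < N) f (lift ord0 i) (tnth y i))%:E)%E.
  by apply: integral_ge0 => y _; rewrite lee_fin prodr_ge0.
rewrite -ge0_integralZr//; last 2 first.
- exact/measurable_EFinP.
- by move=> x _; rewrite lee_fin.
apply: eq_integral => x _.
rewrite -ge0_integralZl//; last 2 first.
- by move=> y _; rewrite lee_fin prodr_ge0.
- by rewrite lee_fin.
by apply: eq_integral => y _; rewrite /= E EFinM.
Qed.

Lemma Rintegral_product_probability N (f : 'I_N -> R -> R) :
  (forall i x, 0 <= f i x) ->
  (forall i, mu.-integrable setT (EFin \o f i)) ->
  (product_probability mu N).-integrable setT
    (EFin \o (fun v => \prod_(i < N) f i (tnth v i))) /\
  \int[product_probability mu N]_v (\prod_(i < N) f i (tnth v i)) =
   \prod_(i < N) \int[mu]_x f i x.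
Proof.
move=> f0 intf.
have mf i : measurable_fun setT (f i).
  by have /measurable_int/measurable_EFinP := intf i.
have E := integral_product_probability f0 mf.
have Ef i : (\int[mu]_x (f i x)%:E)%E = (\int[mu]_x f i x)%:E.
  by rewrite fineK//; exact: (integrable_fin_num measurableT (intf i)).
split; last first.
  rewrite /Rintegral E; under eq_bigr do rewrite Ef.
  by rewrite prodEFin.
apply/integrableP; split.
  apply/measurable_EFinP; apply: measurable_prod => i _.
  by apply: measurableT_comp => //; exact: measurable_tnth.
under eq_integral => v _ do rewrite /= ger0_norm ?prodr_ge0//.
rewrite E; under eq_bigr do rewrite Ef.
by rewrite prodEFin ltry.
Qed.

Definition site_mgf (a : nat) (x : R) : R := \int[mu]_v ((v ^+ 2) ^+ a * expR (x * v ^+ 2)).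
Definition site_moment (a : nat) : R := \int[mu]_v (v ^+ 2) ^+ a.

Variable eps : R.
Hypothesis eps0 : 0 < eps.
Hypothesis intmu : mu.-integrable setT (EFin \o (fun v => expR (eps * v ^+ 2))).

Lemma site_integrable a x : x < eps ->
  mu.-integrable setT (EFin \o (fun v => (v ^+ 2) ^+ a * expR (x * v ^+ 2))).
Proof.
move=> xe; have e1 : 0 < eps - x by rewrite subr_gt0.
have := integrableZl measurableT (a`!%:R / (eps - x) ^+ a) intmu.
apply: le_integrable => //.
  apply/measurable_EFinP; apply: measurable_funM.
    by apply: measurable_funX; exact: exprn_measurable.
  apply: measurableT_comp => //.
  by apply: measurable_funM => //; exact: exprn_measurable.
move=> v _ /=; rewrite lee_fin.
have v0 : 0 <= (v ^+ 2) ^+ a by rewrite exprn_ge0// sqr_ge0.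
have c0 : 0 <= a`!%:R / (eps - x) ^+ a by rewrite divr_ge0// exprn_ge0// ltW.
rewrite !ger0_norm ?mulr_ge0 ?expR_ge0//.
have := expr_le_expR a (sqr_ge0 v) e1.
move=> /(ler_wpM2r (expR_ge0 (x * v ^+ 2))) /le_trans; apply.
  by rewrite -[X in X <= _]mulrA -expRD -mulrDl subrK.
by rewrite invr_ge0 exprn_ge0// ltW.
Qed.

Lemma site_moment_integrable a : mu.-integrable setT (EFin \o (fun v => (v ^+ 2) ^+ a)).
Proof.
have := site_integrable a eps0; apply: eq_integrable => // v _ /=.
by rewrite mul0r expR0 mulr1.
Qed.

Lemma energy_count N (s : seq 'I_N) (v : N.-tuple R) :
  energy s v = \prod_(i < N) ((tnth v i) ^+ 2) ^+ count_mem i s.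
Proof.
rewrite /energy; elim: s => [|j s IH].
  by rewrite big_nil big1// => i _; rewrite expr0.
rewrite big_cons IH /=; under [RHS]eq_bigr do rewrite exprD.
rewrite big_split /=; congr (_ * _).
rewrite (bigD1 j)//= eqxx expr1 big1 ?mulr1// => i ij.
by rewrite eq_sym (negbTE ij) expr0.
Qed.

Lemma product_integrable N : (product_probability mu N).-integrable setT
  (EFin \o (fun v => expR (eps * total_energy v))).
Proof.
have [+ _] := @Rintegral_product_probability N (fun _ v => expR (eps * v ^+ 2))
  (fun _ _ => expR_ge0 _) (fun _ => intmu).
apply: eq_integrable => // v _ /=.
by rewrite /total_energy mulr_sumr expR_sum.
Qed.

Lemma product_energy_mgf N (s : seq 'I_N) (xi : 'rV[R]_N) : tilt_dom eps xi ->
  energy_mgf (product_probability mu N) s xi =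
  \prod_(i < N) site_mgf (count_mem i s) (xi ord0 i).
Proof.
move=> xiD.
have f0 (i : 'I_N) (x : R) :
    0 <= (x ^+ 2) ^+ count_mem i s * expR (xi ord0 i * x ^+ 2).
  by rewrite mulr_ge0 ?expR_ge0// exprn_ge0// sqr_ge0.
have [_ <-] := Rintegral_product_probability f0
  (fun i => site_integrable (count_mem i s) (xiD i)).
apply: eq_Rintegral => v _.
by rewrite energy_count /tilt expR_sum -big_split.
Qed.

Lemma product_energy_moment N (s : seq 'I_N) :
  energy_moment (product_probability mu N) s =
  \prod_(i < N) site_moment (count_mem i s).
Proof.
rewrite -energy_mgf0 product_energy_mgf; last exact: tilt_dom0.
apply: eq_bigr => i _; apply: eq_Rintegral => v _.
by rewrite mxE mul0r expR0 mulr1.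
Qed.

(** The generating function is a product over sites, so its logarithm has no term that involves two
    of them. *)
Lemma product_mixed_cumulant N (s : seq 'I_N) (i j : 'I_N) :
  i \in s -> j \in s -> i != j -> cumulant (product_probability mu N) s = 0.
Proof.
move=> si sj ij.
have p : perm_eq s (i :: j :: rem j (rem i s)).
  have jr : j \in rem i s by rewrite rem_mem// eq_sym.
  apply: (perm_trans (perm_to_rem si)); rewrite perm_cons.
  exact: perm_to_rem.
rewrite (cumulant_perm eps0 (product_integrable N) p).
apply: (cumulant_eq0 eps0 (product_integrable N)) => xi xiD.
rewrite !product_energy_mgf// -!big_split; apply: eq_bigr => k _ /=.
rewrite !addn0; have [<-|ik] := eqVneq i k; last by rewrite add0n mulrC.
by rewrite eq_sym (negbTE ij) addn0.
Qed.

Lemma site_moment_ge0 a : 0 <= site_moment a.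
Proof. by apply: Rintegral_ge0 => v _; rewrite exprn_ge0// sqr_ge0. Qed.

Lemma site_moment0 : site_moment 0 = 1.
Proof.
rewrite /site_moment; under eq_Rintegral do rewrite expr0.
by rewrite Rintegral_cst//= mul1r [X in fine X]probability_setT.
Qed.

End ProductMoments.

(** * The Kac process *)

Section Sphere.
Context {R : realType} {N : nat}.
Implicit Types (P : probability (N.-tuple R) R) (v : N.-tuple R).

Lemma Rintegral_sum d (T : measurableType d) (mu : {measure set T -> \bar R})
    (D : set T) (I : Type) (s : seq I) (Q : pred I) (f : I -> T -> R) :
  measurable D -> (forall i, mu.-integrable D (EFin \o f i)) ->
  \int[mu]_(x in D) (\sum_(i <- s | Q i) f i x) =
  \sum_(i <- s | Q i) \int[mu]_(x in D) f i x.
Proof.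
move=> mD intf; rewrite /Rintegral.
under eq_integral do rewrite -sumEFin.
rewrite (@integral_sum _ _ _ mu D mD I (fun i x => (f i x)%:E))//.
rewrite (eq_bigr (fun i => (\int[mu]_(x in D) f i x)%:E)).
  by rewrite sumEFin.
by move=> i _; rewrite fineK//; exact: (integrable_fin_num mD (intf i)).
Qed.

Lemma kac_sphereE v : kac_sphere R N v = (total_energy v = N%:R) :> Prop.
Proof. by []. Qed.

Lemma measurable_kac_sphere : measurable (kac_sphere R N).
Proof.
have -> : kac_sphere R N = setT `&` total_energy @^-1` [set N%:R].
  by rewrite setTI.
by apply: measurable_total_energy => //; exact: measurable_set1.
Qed.

Lemma coord_le v (i : 'I_N) : kac_sphere R N v -> `|tnth v i| <= N%:R.
Proof.
rewrite kac_sphereE => vS; have N1 : 1 <= N%:R :> R.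
  by rewrite ler1n; case: N i {vS} v => // -[].
rewrite -(@ler_pXn2r _ 2)// ?nnegrE//.
rewrite -normrX ger0_norm ?sqr_ge0//.
apply: (@le_trans _ _ N%:R); last by rewrite expr2 ler_peMl.
rewrite -vS /total_energy (bigD1 i)//= lerDl sumr_ge0// => j _; exact: sqr_ge0.
Qed.

Variable P : probability (N.-tuple R) R.
Hypothesis PS : P (kac_sphere R N) = 1%E.

Lemma kac_sphereC0 : P (~` kac_sphere R N) = 0%E.
Proof.
rewrite probability_setC ?PS ?subee//; exact: measurable_kac_sphere.
Qed.

Lemma sphere_integrable (phi : N.-tuple R -> R) (M : R) :
  measurable_fun setT phi -> (forall v, kac_sphere R N v -> `|phi v| <= M) ->
  P.-integrable setT (EFin \o phi).
Proof.
move=> mphi bphi; have mS := measurable_kac_sphere.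
apply/(negligible_integrable (measurableC mS)) => //.
- exact/measurable_EFinP.
- exact: kac_sphereC0.
rewrite setTD setCK; apply: measurable_bounded_integrable => //.
- by apply: (@le_lt_trans _ _ 1%E); [exact: probability_le1|exact: ltry].
- exact: measurable_funTS.
- exists M; split; first exact: num_real.
  by move=> x Mx v vS; apply: le_trans (bphi v vS) _; exact: ltW.
Qed.

Lemma sphere_Rintegral (phi : N.-tuple R -> R) :
  P.-integrable setT (EFin \o phi) ->
  \int[P]_(v in kac_sphere R N) phi v = \int[P]_v phi v.
Proof.
move=> intphi; have mS := measurable_kac_sphere.
rewrite /Rintegral [in RHS](negligible_integral (measurableC mS))//.
- by rewrite setTD setCK.
- exact: kac_sphereC0.
Qed.

Lemma eq_sphere_Rintegral (phi psi : N.-tuple R -> R) :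
  P.-integrable setT (EFin \o phi) -> P.-integrable setT (EFin \o psi) ->
  (forall v, kac_sphere R N v -> phi v = psi v) ->
  \int[P]_v phi v = \int[P]_v psi v.
Proof.
move=> i1 i2 H; rewrite -sphere_Rintegral// -[RHS]sphere_Rintegral//.
by apply: eq_Rintegral => v; rewrite inE => /H.
Qed.

Lemma sphere_exp_integrable (eps : R) :
  P.-integrable setT (EFin \o (fun v => expR (eps * total_energy v))).
Proof.
apply: (@sphere_integrable _ (expR (eps * N%:R))).
  apply: measurableT_comp => //; apply: measurable_funM => //.
  exact: measurable_total_energy.
by move=> v; rewrite kac_sphereE => ->; rewrite ger0_norm ?expR_ge0.
Qed.

Lemma sphere_energy_integrable s : P.-integrable setT (EFin \o (energy s)).
Proof.
apply: (@sphere_integrable _ (N%:R ^+ size s)); first exact: measurable_energy.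
move=> v; rewrite kac_sphereE => vS.
by rewrite ger0_norm ?energy_ge0// -vS energy_le.
Qed.

(** The energy equals N almost surely, which a tilt does not change. The rate 1 is arbitrary: on the
    sphere every exponential of the energy is bounded. *)
Lemma sphere_sum_rule xi : tilt_dom 1 xi ->
  \sum_(j < N) energy_mgf P [:: j] xi = N%:R * energy_mgf P [::] xi.
Proof.
move=> xiD; have e1 := sphere_exp_integrable 1.
have it s := energy_tilt_integrable ltr01 e1 s xiD.
rewrite -(RintegralZl N%:R measurableT (it [::])).
rewrite -Rintegral_sum//.
apply: eq_sphere_Rintegral.
- have -> : EFin \o (fun v => \sum_(j < N) (energy [:: j] v * tilt xi v)) =
     (fun v => (\sum_(j < N) (energy [:: j] v * tilt xi v)%:E)%E).
    by apply/funext => v; rewrite /= sumEFin.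
  apply: integrable_sum => // i _; exact: it.
- exact: (integrableZl measurableT N%:R (it [::])).
- move=> v; rewrite kac_sphereE => vS; rewrite -mulr_suml; congr (_ * _).
    rewrite -vS; apply: eq_bigr => j _.
    by rewrite /energy big_cons big_nil mulr1.
  by rewrite /energy big_nil mul1r.
Qed.

Lemma sphere_cumulant_sum0 i s : \sum_(j < N) cumulant P (j :: i :: s) = 0.
Proof.
exact: (cumulant_sum0 ltr01 (sphere_exp_integrable 1) (c := N%:R) i s sphere_sum_rule).
Qed.

End Sphere.

Lemma normM_le_sqr (R : realType) (a b M : R) :
  a ^+ 2 <= M -> b ^+ 2 <= M -> `|a * b| <= M.
Proof.
move=> aM bM; rewrite ler_norml.
have := sqr_ge0 (a + b); have := sqr_ge0 (a - b).
by rewrite sqrrB sqrrD; lra.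
Qed.

(** * Action of the Kac generator on monomials *)

Section Monomials.
Context {R : realType} {N D : nat}.
Implicit Types (v : N.-tuple R) (f g : {ffun 'I_D -> 'I_N}) (s : 'S_N).

(** Words of length [D] index the monomials of that degree. Rotations preserve the degree but create
    odd powers, hence coordinates instead of energies; the generator then acts on a
    finite-dimensional space. *)
Definition monomial f v : R := \prod_(k < D) tnth v (f k).

Definition rot_coef (i j : 'I_N) (theta : R) (k l : 'I_N) : R :=
  if k == i then cos theta * (l == i)%:R + sin theta * (l == j)%:R
  else if k == j then - sin theta * (l == i)%:R + cos theta * (l == j)%:R
  else (l == k)%:R.

Lemma sum_delta (k : 'I_N) v : \sum_l (l == k)%:R * tnth v l = tnth v k.
Proof.
rewrite (bigD1 k)//= eqxx mul1r big1 ?addr0// => l /negbTE ->.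
by rewrite mul0r.
Qed.

Lemma rotation_coef i j theta v k :
  tnth (rotation i j theta v) k = \sum_l rot_coef i j theta k l * tnth v l.
Proof.
rewrite tnth_mktuple /rot_coef; case: ifP => _; [|case: ifP => _].
- under eq_bigr do rewrite mulrDl -!mulrA.
  by rewrite big_split /= -!mulr_sumr !sum_delta.
- under eq_bigr do rewrite mulrDl -!mulrA.
  by rewrite big_split /= -!mulr_sumr !sum_delta.
- by rewrite sum_delta.
Qed.

Lemma monomial_rotation i j theta f v : monomial f (rotation i j theta v) =
  \sum_(g : {ffun 'I_D -> 'I_N}) (\prod_(k < D) rot_coef i j theta (f k) (g k)) * monomial g v.
Proof.
rewrite /monomial; under eq_bigr do rewrite rotation_coef.
rewrite bigA_distr_bigA /=; apply: eq_bigr => g _.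
by rewrite big_split.
Qed.

Lemma continuous_rot_coef i j k l : continuous (fun theta => rot_coef i j theta k l).
Proof.
rewrite /rot_coef; case: (k == i) => x; [|move: x; case: (k == j) => x].
- apply: cvgD; apply: cvgM; try exact: cvg_cst.
    exact: continuous_cos.
  exact: continuous_sin.
- apply: cvgD; apply: cvgM; try exact: cvg_cst.
    by apply: cvgN; exact: continuous_sin.
  exact: continuous_cos.
- exact: cvg_cst.
Qed.

Lemma continuous_prod_fun (T : topologicalType) (I : Type) (s : seq I) (h : I -> T -> R) :
  (forall i, continuous (h i)) -> continuous (fun x => \prod_(i <- s) h i x).
Proof.
move=> ch; elim: s => [|i s IH].
  rewrite (_ : (fun _ => _) = cst 1); first exact: cst_continuous.
  by apply/funext => x; rewrite big_nil.
rewrite (_ : (fun _ => _) = (fun x => h i x * \prod_(j <- s) h j x)).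
  by move=> x; apply: cvgM; [exact: ch|exact: IH].
by apply/funext => x; rewrite big_cons.
Qed.

Definition circle_coef i j f g : R :=
  \int[@lebesgue_measure R]_(theta in `[- pi, pi])
     ((\prod_(k < D) rot_coef i j theta (f k) (g k)) / (2 * pi)).

Lemma monomial_circle i j f v :
  \int[@lebesgue_measure R]_(theta in `[- pi, pi])
     (monomial f (rotation i j theta v) / (2 * pi)) =
  \sum_g circle_coef i j f g * monomial g v.
Proof.
have cont (g : {ffun 'I_D -> 'I_N}) (a : R) : continuous (fun theta =>
    (\prod_(k < D) rot_coef i j theta (f k) (g k)) / (2 * pi) * a).
  move=> x; apply: cvgM; last exact: cvg_cst.
  apply: cvgM; last exact: cvg_cst.
  by apply: continuous_prod_fun => k; exact: continuous_rot_coef.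
transitivity (\int[@lebesgue_measure R]_(theta in `[- pi, pi])
   (\sum_(g : {ffun 'I_D -> 'I_N}) (\prod_(k < D) rot_coef i j theta (f k) (g k)) / (2 * pi) * monomial g v)).
  apply: eq_Rintegral => theta _; rewrite monomial_rotation mulr_suml.
  by apply: eq_bigr => g _; rewrite mulrAC.
rewrite Rintegral_sum//; last by move=> g; apply: circ_integrable.
apply: eq_bigr => g _; rewrite RintegralZr//.
apply: circ_integrable => x; have := cont g 1 x.
rewrite (_ : (fun _ => _ * 1) = (fun theta => (\prod_(k < D) rot_coef i j theta (f k) (g k)) / (2 * pi)))//.
by apply/funext => y; rewrite mulr1.
Qed.

Definition generator_coef f g : R :=
  N%:R * ((N%:R * (N%:R - 1))^-1 *
     (\sum_(p : 'I_N * 'I_N | p.1 != p.2) circle_coef p.1 p.2 f g) - (g == f)%:R).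

Lemma kac_generator_monomial f v :
  kac_generator (monomial f) v = \sum_g generator_coef f g * monomial g v.
Proof.
rewrite /kac_generator /kac_average /generator_coef.
under eq_bigr do rewrite monomial_circle.
rewrite exchange_big /=.
under [in RHS]eq_bigr do rewrite -mulrA mulrBl.
rewrite -mulr_sumr sumrB; congr (_ * (_ - _)).
  rewrite mulr_sumr; apply: eq_bigr => g _.
  by rewrite -mulr_suml mulrA.
rewrite (bigD1 f)//= eqxx mul1r big1 ?addr0// => g /negbTE ->.
by rewrite mul0r.
Qed.

Definition relabel s f : {ffun 'I_D -> 'I_N} := [ffun k => s (f k)].

Lemma relabel_inj s : injective (relabel s).
Proof.
move=> f g /ffunP E; apply/ffunP => k.
by have := E k; rewrite !ffunE => /perm_inj.
Qed.

(** The generator sums over all ordered pairs of distinct sites, a set that relabelling permutes. *)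
Lemma generator_coef_relabel s f g :
  generator_coef (relabel s f) (relabel s g) = generator_coef f g.
Proof.
rewrite /generator_coef (inj_eq (@relabel_inj s)); congr (_ * (_ * _ - _)).
pose h (p : 'I_N * 'I_N) := (s p.1, s p.2).
have hb : bijective h.
  exists (fun p => ((s^-1)%g p.1, (s^-1)%g p.2)) => -[a b];
  by rewrite /h /= ?permK ?permKV.
rewrite (reindex h) /=; last exact: onW_bij.
apply: eq_big => [p|p _]; first by rewrite (inj_eq perm_inj).
apply: eq_Rintegral => theta _; congr (_ / _).
by apply: eq_bigr => k _; rewrite !ffunE /rot_coef !(inj_eq perm_inj).
Qed.

Lemma monomial_le f v : kac_sphere R N v -> `|monomial f v| <= N%:R ^+ D.
Proof.
move=> vS; rewrite normr_prod -[D in X in _ <= X]card_ord -prodr_const.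
by apply: ler_prod => k _; rewrite normr_ge0 coord_le.
Qed.

Lemma measurable_monomial f : measurable_fun setT (monomial f).
Proof. by apply: measurable_prod => k _; exact: measurable_tnth. Qed.

Lemma continuous_monomial f : continuous_on_sphere (monomial f).
Proof.
apply: continuous_subspaceT; rewrite /comp /monomial.
apply: continuous_prod_fun => k x.
have -> : (fun y : 'rV[R]_N => tnth (tuple_of_row y) (f k)) = (fun y => y ord0 (f k)).
  by apply/funext => y; rewrite tnth_mktuple.
exact: coord_continuous.
Qed.

End Monomials.

(** * Moments of the Kac process and propagation of symmetry *)

Section KacMoments.
Context {R : realType} {N : nat}.
Variable F : R -> probability (N.-tuple R) R.
Hypothesis kacF : kac_law F.

Lemma kac_monomial_integrable D (f : {ffun 'I_D -> 'I_N}) t : 0 <= t ->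
  (F t).-integrable setT (EFin \o monomial f).
Proof.
move=> t0; apply: (@sphere_integrable _ _ _ (kacF.1 t t0) _ (N%:R ^+ D)).
  exact: measurable_monomial.
exact: monomial_le.
Qed.

Definition monomial_moment D (f : {ffun 'I_D -> 'I_N}) t :=
  \int[F t]_v monomial f v.

Lemma deriv_nonneg_ext (u u' du : R -> R) : (forall t, 0 <= t -> u t = u' t) ->
  deriv_nonneg u du -> deriv_nonneg u' du.
Proof.
move=> E [d c]; split=> [t t0|].
  have dt := d t t0; apply: near_eq_is_derive dt.
  have : \forall x \near t, 0 < x by exact: lt_nbhsr.
  by apply: filterS => x x0; rewrite E// ltW.
rewrite -E//; apply: cvg_trans c; apply: near_eq_cvg; near=> x.
by rewrite E.
Unshelve. all: by end_near. Qed.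

Lemma deriv_monomial_moment D (f : {ffun 'I_D -> 'I_N}) :
  deriv_nonneg (monomial_moment f)
    (fun t => \sum_g generator_coef f g * monomial_moment g t).
Proof.
have := has_derivative_on_nonnegP (kacF.2 _ (@continuous_monomial R N D f)).
move=> H.
have {}H : deriv_nonneg (monomial_moment f)
    (fun t => \int[F t]_(v in kac_sphere R N) kac_generator (monomial f) v).
  apply: deriv_nonneg_ext H => t t0; rewrite sphere_Rintegral ?kacF.1//.
  exact: kac_monomial_integrable.
apply: deriv_nonneg_eq H _ => t /ltW t0.
under eq_Rintegral do rewrite kac_generator_monomial.
have it g := integrableZl measurableT (generator_coef f g) (kac_monomial_integrable g t0).
rewrite sphere_Rintegral ?kacF.1//; last first.
  have -> : EFin \o (fun v : N.-tuple R => \sum_g generator_coef f g * monomial g v) =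
     (fun v => (\sum_g (generator_coef f g * monomial g v)%:E)%E).
    by apply/funext => v; rewrite /= sumEFin.
  by apply: integrable_sum => // g _; exact: it.
rewrite Rintegral_sum//; apply: eq_bigr => g _.
by rewrite RintegralZl//; exact: kac_monomial_integrable.
Qed.

Lemma measurable_permute (s : 'S_N) :
  measurable_fun setT (fun v : N.-tuple R => [tuple tnth v (s i) | i < N]).
Proof.
apply/measurable_fun_tnthP => i /=.
rewrite (_ : _ \o _ = fun v : N.-tuple R => tnth v (s i)); last first.
  by apply/funext => v /=; rewrite tnth_mktuple.
exact: measurable_tnth.
Qed.

Hypothesis sym0 : symmetric_measure (F 0).

Lemma monomial_moment_sym0 D (s : 'S_N) (f : {ffun 'I_D -> 'I_N}) :
  monomial_moment (relabel s f) 0 = monomial_moment f 0.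
Proof.
pose T (v : N.-tuple R) := [tuple tnth v (s i) | i < N].
pose mT := isMeasurableFun.Build _ _ _ _ T (measurable_permute s).
pose X : {mfun N.-tuple R >-> N.-tuple R} := HB.pack T mT.
have E : \int[F 0]_v monomial (relabel s f) v = \int[F 0]_v (monomial f \o X) v.
  apply: eq_Rintegral => v _ /=; apply: eq_bigr => k _.
  by rewrite /X /= ffunE tnth_mktuple.
rewrite /monomial_moment E /Rintegral.
have <- : (\int[distribution (F 0) X]_v (EFin \o monomial f) v =
    \int[F 0]_v (monomial f (X v))%:E)%E.
  rewrite integral_distribution//.
    by apply/measurable_EFinP; exact: measurable_monomial.
  have -> : (EFin \o monomial f) \o X = EFin \o monomial (relabel s f).
    apply/funext => v /=; congr EFin; apply: eq_bigr => k _.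
    by rewrite ffunE tnth_mktuple.
  exact: kac_monomial_integrable.
congr fine; apply: eq_measure_integral => A mA _.
exact: sym0.
Qed.

(** A moment minus its relabelled version solves the same homogeneous linear system with zero
    initial value; Gronwall's inequality for the sum of squares gives uniqueness. *)
Lemma monomial_moment_sym D (s : 'S_N) (f : {ffun 'I_D -> 'I_N}) t : 0 <= t ->
  monomial_moment (relabel s f) t = monomial_moment f t.
Proof.
move=> t0.
pose w (g : {ffun 'I_D -> 'I_N}) t := monomial_moment g t - monomial_moment (relabel s g) t.
have dw g : deriv_nonneg (w g) (fun t => \sum_h generator_coef g h * w h t).
  have := deriv_nonnegD (deriv_monomial_moment g)
    (deriv_nonnegN (deriv_monomial_moment (relabel s g))).
  move/deriv_nonneg_eq; apply => u _.
  rewrite [X in _ - X](reindex (relabel s)) /=; last first.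
    by apply: onW_bij; apply: injF_bij; exact: relabel_inj.
  rewrite -sumrB; apply: eq_bigr => h _.
  by rewrite generator_coef_relabel mulrBr.
pose U t := \sum_g w g t * w g t.
have dU : deriv_nonneg U
    (fun t => \sum_g (w g t * (\sum_h generator_coef g h * w h t) +
                      w g t * (\sum_h generator_coef g h * w h t))).
  by apply: deriv_nonneg_sum => g; exact: deriv_nonnegM.
(* A crude rate: each product [w g u * w h u] is at most [U u], and differentiating a square gives
   the factor 2. *)
pose K := \sum_g \sum_h 2 * `|@generator_coef R N D g h|.
have wU g u : w g u ^+ 2 <= U u.
  rewrite /U (bigD1 g)//= expr2 lerDl sumr_ge0// => h _.
  by rewrite -expr2 sqr_ge0.
have HU : U t <= expR (K * t) * U 0.
  apply: (gronwall_le dU t0) => u _; rewrite /K mulr_suml; apply: ler_sum => g _.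
  rewrite -mulrDr -big_split mulr_suml mulr_sumr; apply: ler_sum => h _ /=.
  apply: le_trans (ler_norm _) _.
  have := wU g u; have := wU h u.
  set a := w g u; set b := w h u; set c := generator_coef g h => b2 a2.
  have -> : a * (c * b + c * b) = 2 * (c * (a * b)) by ring.
  rewrite 2!normrM (@ger0_norm _ 2)// mulrA ler_wpM2l ?mulr_ge0//.
  exact: normM_le_sqr.
have U0 : U 0 = 0.
  rewrite /U big1// => g _; rewrite /w monomial_moment_sym0 subrr mul0r//.
move: HU; rewrite U0 mulr0 => Ut.
have := le_trans (wU f t) Ut.
have := sqr_ge0 (w f t) => h1 h2.
have /eqP : w f t ^+ 2 == 0 by rewrite eq_le h1 h2.
by move/eqP; rewrite sqrf_eq0 subr_eq0 => /eqP.
Qed.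

(** Doubling the word squares each coordinate. *)
Lemma energy_monomial (s : seq 'I_N) :
  energy s =1 monomial (D := size (s ++ s)) (R := R) [ffun k => tnth (in_tuple (s ++ s)) k].
Proof.
move=> v; rewrite /monomial.
under [RHS]eq_bigr do rewrite ffunE.
rewrite -(big_tnth _ _ (s ++ s) xpredT (fun i => tnth v i)) big_cat /energy.
by under eq_bigr do rewrite expr2; rewrite big_split.
Qed.

Lemma energy_moment_sym (s : 'S_N) (l : seq 'I_N) t : 0 <= t ->
  energy_moment (F t) (map s l) = energy_moment (F t) l.
Proof.
move=> t0; rewrite /energy_moment.
under [RHS]eq_Rintegral do rewrite energy_monomial.
rewrite -/(monomial_moment _ t) -(monomial_moment_sym s)//.
apply: eq_Rintegral => v _.
rewrite /monomial; under [RHS]eq_bigr do rewrite !ffunE.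
rewrite -(big_tnth _ _ (l ++ l) xpredT (fun i => tnth v (s i))) big_cat /energy.
by under eq_bigr do rewrite expr2; rewrite big_split !big_map.
Qed.

End KacMoments.

(** * Evolution of the moments at one site *)

Section OneSite.
Context {R : realType} {N : nat}.
Variables (i0 i1 : 'I_N).
Hypothesis i01 : i0 != i1.

Lemma site_rotation_mean n (i j : 'I_N) (v : N.-tuple R) : i != j ->
  \int[@lebesgue_measure R]_(theta in `[- pi, pi])
    (tnth (rotation i j theta v) i0 ^+ n.*2 / (2 * pi)) =
  if i == i0 then wallis n * (tnth v i0 ^+ 2 + tnth v j ^+ 2) ^+ n
  else if j == i0 then wallis n * (tnth v i0 ^+ 2 + tnth v i ^+ 2) ^+ n
  else (tnth v i0 ^+ 2) ^+ n.
Proof.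
move=> ij; have pi0 : 2 * pi != 0 :> R by rewrite mulf_neq0// gt_eqF// pi_gt0.
have mean a b : \int[@lebesgue_measure R]_(theta in `[- pi, pi])
    (circ a b theta ^+ n.*2 / (2 * pi)) = wallis n * (a ^+ 2 + b ^+ 2) ^+ n.
  rewrite RintegralZr//; last first.
    by apply: circ_integrable => x; exact: continuous_circX.
  rewrite circle_mean; move: pi0; set q := 2 * pi => q0.
  by rewrite -mulrA mulrAC divff// mul1r.
have [ii0|ii0] := eqVneq i i0.
  rewrite -mean; apply: eq_Rintegral => theta _.
  by rewrite tnth_mktuple ii0 eqxx.
have [ji0|ji0] := eqVneq j i0.
  (* As the second index of the pair, the site sees its partner with the opposite sign, which
     squares forget. *)
  rewrite -[tnth v i ^+ 2]sqrrN -mean; apply: eq_Rintegral => theta _.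
  rewrite tnth_mktuple ji0 eq_sym (negbTE ii0) eqxx /circ.
  by rewrite mulrN mulNr addrC.
under eq_Rintegral do rewrite tnth_mktuple eq_sym (negbTE ii0) eq_sym (negbTE ji0).
rewrite Rintegral_cst//= [fine _](_ : _ = 2 * pi); last first.
  by rewrite [X in fine X]lebesgue_circle.
by rewrite mulfVK// -mul2n exprM.
Qed.

(** Of the N(N - 1) ordered pairs, N - 1 contain [i0] first and N - 1 second. The other (N - 1)(N -
    2) leave its energy unchanged and contribute N - 2 after normalisation, which turns the loss
    rate N into 2. *)
Lemma kac_generator_site n (v : N.-tuple R) :
  kac_generator (fun v => tnth v i0 ^+ n.*2) v =
  2 / (N%:R - 1) * \sum_(j < N | j != i0) wallis n * (tnth v i0 ^+ 2 + tnth v j ^+ 2) ^+ n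
  - 2 * (tnth v i0 ^+ 2) ^+ n.
Proof.
have N2 : (2 <= N)%N.
  have := cardC1 i0; rewrite card_ord.
  have : (0 < #|predC1 i0|)%N by apply/card_gt0P; exists i1; rewrite !inE eq_sym.
  by move=> h e; move: h; rewrite e; case: N => // -[].
pose A j := wallis n * (tnth v i0 ^+ 2 + tnth v j ^+ 2) ^+ n.
pose q := (tnth v i0 ^+ 2) ^+ n.
have cq : #|[pred j : 'I_N | j != i0]| = N.-1 by rewrite cardC1 card_ord.
have S : \sum_(p : 'I_N * 'I_N | p.1 != p.2)
    \int[@lebesgue_measure R]_(theta in `[- pi, pi])
      (tnth (rotation p.1 p.2 theta v) i0 ^+ n.*2 / (2 * pi)) =
    2 * \sum_(j < N | j != i0) A j + (N%:R - 1) * (N%:R - 2) * q.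
  rewrite (eq_bigr _ (fun p pp => site_rotation_mean n v pp)).
  pose G i j := if i == i0 then A j else if j == i0 then A i else q.
  rewrite -(pair_big_dep xpredT (fun i j : 'I_N => i != j) G) /=.
  rewrite (bigD1 i0)//= [X in X + _](_ : _ = \sum_(j < N | j != i0) A j); last first.
    by apply: eq_big => [j|j _]; [rewrite eq_sym|rewrite /G eqxx].
  rewrite [X in _ + X](_ : _ = \sum_(i < N | i != i0) (A i + (N%:R - 2) * q)); last first.
    apply: eq_bigr => i ii0; rewrite (bigD1 i0)//= {1}/G (negbTE ii0) eqxx.
    congr (_ + _); transitivity (\sum_(j < N | (i != j) && (j != i0)) q).
      by apply: eq_bigr => j /andP[_ /negbTE ji0]; rewrite /G (negbTE ii0) ji0.
    rewrite sumr_const -[_ *+ _]mulr_natl; congr (_ * _).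
    have -> : #|[pred j | (i != j) && (j != i0)]| = N.-2.
      have := cardC (pred2 i i0); rewrite card2 ii0 card_ord /= => E.
      have E' := addKn 2 #|[predC pred2 i i0]|.
      rewrite E subn2 in E'.
      rewrite E'; apply: eq_card => j; rewrite !inE negb_or.
      by rewrite [i == j]eq_sym.
    by rewrite -subn2 natrB.
  rewrite big_split /= sumr_const cq -[_ *+ N.-1]mulr_natl -subn1 natrB; last by lia.
  by ring.
rewrite /kac_generator /kac_average S.
have N0 : (N%:R : R) != 0 by rewrite pnatr_eq0; lia.
have N1 : (N%:R - 1 : R) != 0 by rewrite subr_eq0 -[1]/(1%:R) eqr_nat; lia.
rewrite -[n.*2]mul2n exprM -/q.
move: N0 N1; set M := N%:R => N0 N1; rewrite /A.
set Z := \sum_(j < N | _) _; field.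
by rewrite N0 N1.
Qed.

Variable F : R -> probability (N.-tuple R) R.
Hypothesis kacF : kac_law F.
Hypothesis sym0 : symmetric_measure (F 0).

Definition pair_seq k l := nseq k i0 ++ nseq l i1.

Lemma energy_nseq k (i : 'I_N) (v : N.-tuple R) : energy (nseq k i) v = (tnth v i ^+ 2) ^+ k.
Proof. by rewrite /energy big_nseq -Monoid.iteropE /= ; elim: k => //= k ->; rewrite exprS. Qed.

(** By symmetry every partner [j] has the same joint moments with [i0] as the fixed site [i1]. *)
Lemma site_sum_moment n (j : 'I_N) t : 0 <= t -> j != i0 ->
  (F t).-integrable setT (EFin \o (fun v => (tnth v i0 ^+ 2 + tnth v j ^+ 2) ^+ n)) /\
  \int[F t]_v (tnth v i0 ^+ 2 + tnth v j ^+ 2) ^+ n =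
  \sum_(k < n.+1) energy_moment (F t) (pair_seq (n - k) k) *+ 'C(n, k).
Proof.
move=> t0 ji0.
have E (v : N.-tuple R) : (tnth v i0 ^+ 2 + tnth v j ^+ 2) ^+ n =
    \sum_(k < n.+1) 'C(n, k)%:R * energy (nseq (n - k) i0 ++ nseq k j) v.
  rewrite exprDn; apply: eq_bigr => k _.
  by rewrite energy_cat !energy_nseq mulr_natl.
have it s := sphere_energy_integrable (kacF.1 t t0) s.
have it2 (k : 'I_n.+1) := integrableZl measurableT ('C(n, k)%:R : R)
   (it (nseq (n - k) i0 ++ nseq k j)).
split.
  have -> : EFin \o (fun v : N.-tuple R => (tnth v i0 ^+ 2 + tnth v j ^+ 2) ^+ n) =
    (fun v => (\sum_(k < n.+1) ('C(n, k)%:R * energy (nseq (n - k) i0 ++ nseq k j) v)%:E)%E).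
    by apply/funext => v; rewrite /= E sumEFin.
  by apply: integrable_sum => // k _; exact: it2.
under eq_Rintegral do rewrite E.
rewrite Rintegral_sum//; apply: eq_bigr => k _.
rewrite RintegralZl// mulr_natl; congr (_ *+ _).
have := energy_moment_sym kacF sym0 (tperm i1 j) (pair_seq (n - k) k) t0.
by move=> <-; rewrite /pair_seq map_cat !map_nseq tpermL tpermD// eq_sym.
Qed.

(** The N - 1 identical partners cancel the normalisation 1 / (N - 1): no explicit N remains, as in
    the limit equation. *)
Lemma deriv_site_moment n :
  deriv_nonneg (fun t => energy_moment (F t) (nseq n i0))
    (fun t => 2 * wallis n *
      (\sum_(k < n.+1) energy_moment (F t) (pair_seq (n - k) k) *+ 'C(n, k))
      - 2 * energy_moment (F t) (nseq n i0)).
Proof.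
pose f : {ffun 'I_(n.*2) -> 'I_N} := [ffun=> i0].
have fE : monomial (R := R) f = (fun v => tnth v i0 ^+ n.*2).
  apply/funext => v; rewrite /monomial; under eq_bigr do rewrite ffunE.
  by rewrite prodr_const card_ord.
have eE (v : N.-tuple R) : tnth v i0 ^+ n.*2 = energy (nseq n i0) v.
  by rewrite energy_nseq -mul2n exprM.
have := kacF.2 _ (@continuous_monomial R N _ f); rewrite fE => /has_derivative_on_nonnegP H.
have {}H := deriv_nonneg_ext _ H.
have {}H : deriv_nonneg (fun t => energy_moment (F t) (nseq n i0))
   (fun t => \int[F t]_(v in kac_sphere R N) kac_generator (fun v => tnth v i0 ^+ n.*2) v).
  apply: H => t t0; under eq_Rintegral do rewrite eE.
  rewrite sphere_Rintegral ?kacF.1//; exact: sphere_energy_integrable (kacF.1 t t0) _.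
apply: deriv_nonneg_eq H _ => t /ltW t0.
have N1 : (N%:R - 1 : R) != 0.
  rewrite subr_eq0 -[1]/(1%:R) eqr_nat; apply: contra i01 => /eqP E.
  by apply/eqP/val_inj; move: (ltn_ord i0) (ltn_ord i1); rewrite {2 4}E /=; lia.
under eq_Rintegral do rewrite kac_generator_site.
have it s := sphere_energy_integrable (kacF.1 t t0) s.
pose g (j : 'I_N) v : R := if j != i0 then (tnth v i0 ^+ 2 + tnth v j ^+ 2) ^+ n else 0.
have ig j : (F t).-integrable setT (EFin \o g j).
  have [ji0|ji0] := boolP (j != i0).
    have [+ _] := site_sum_moment n t0 ji0; apply: eq_integrable => // v _.
    by rewrite /= /g ji0.
  have := @integrable0 _ _ _ (F t) setT; apply: eq_integrable => // v _.
  by rewrite /= /g (negbTE ji0).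
have E (v : N.-tuple R) : 2 / (N%:R - 1) *
    (\sum_(j < N | j != i0) wallis n * (tnth v i0 ^+ 2 + tnth v j ^+ 2) ^+ n) -
    2 * (tnth v i0 ^+ 2) ^+ n =
    \sum_(j < N) (2 / (N%:R - 1) * wallis n) * g j v + (- 2) * energy (nseq n i0) v.
  rewrite energy_nseq mulNr; congr (_ - _).
  rewrite mulr_sumr big_mkcond /=; apply: eq_bigr => j _.
  by rewrite /g; case: ifP => _; rewrite ?mulrA ?mulr0.
under eq_Rintegral do rewrite E.
have ig2 (j : 'I_N) := integrableZl measurableT (2 / (N%:R - 1) * wallis n : R) (ig j).
have ig3 := integrableZl measurableT (- 2 : R) (it (nseq n i0)).
have ig4 : (F t).-integrable setT
    (EFin \o (fun v => \sum_(j < N) (2 / (N%:R - 1) * wallis n) * g j v)).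
  have -> : EFin \o (fun v : N.-tuple R => \sum_(j < N) (2 / (N%:R - 1) * wallis n) * g j v) =
    (fun v => (\sum_(j < N) ((2 / (N%:R - 1) * wallis n) * g j v)%:E)%E).
    by apply/funext => v; rewrite /= sumEFin.
  by apply: integrable_sum => // j _; exact: ig2.
rewrite sphere_Rintegral ?kacF.1//; last first.
  have := integrableD measurableT ig4 ig3.
  by apply: eq_integrable.
rewrite RintegralD// Rintegral_sum// RintegralZl// mulNr; congr (_ - _).
transitivity (\sum_(j < N | j != i0) 2 / (N%:R - 1) * wallis n *
   \sum_(k < n.+1) energy_moment (F t) (pair_seq (n - k) k) *+ 'C(n, k)).
  rewrite [RHS]big_mkcond; apply: eq_bigr => j _.
  rewrite RintegralZl//; case: ifPn => ji0.
    have [_ <-] := site_sum_moment n t0 ji0.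
    by congr (_ * _); apply: eq_Rintegral => v _; rewrite /g ji0.
  rewrite (_ : Rintegral _ _ _ = 0) ?mulr0//.
  rewrite -[RHS](mul0r (fine (F t setT))) -(Rintegral_cst (F t) measurableT 0).
  by apply: eq_Rintegral => v _; rewrite /g (negbTE ji0).
rewrite sumr_const cardC1 card_ord -[_ *+ N.-1]mulr_natl -subn1 natrB; last first.
  by case: N i0 => // -[].
move: N1; set M := N%:R - 1 => N1; set Z := \sum_(k < n.+1) _; field.
exact: N1.
Qed.

End OneSite.

Lemma deriv_nonneg_time (R : realType) (u du : R -> R) (t0 : R) : 0 <= t0 ->
  deriv_nonneg u du -> deriv_nonneg (fun t => u (t0 + t)) (fun t => du (t0 + t)).
Proof.
move=> t00 [d c].
have dd (t : R) : 0 < t0 + t -> is_derive t 1 (fun t => u (t0 + t)) (du (t0 + t)).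
  move=> tt; have dt := d _ tt.
  have ds : is_derive t 1 (fun t : R => t0 + t) 1.
    rewrite (_ : (fun t : R => _) = cst t0 \+ id)//.
    by apply: is_derive_eq; rewrite add0r.
  have := @is_derive1_comp _ u (fun t => t0 + t) t _ _ dt ds.
  by rewrite mulr1.
split=> [t t_gt0|]; first by apply: dd; rewrite ltr_wpDl.
move: t00; rewrite le_eqVlt => /predU1P[<-|t00].
  rewrite add0r; under [X in X @ _ --> _]eq_fun do rewrite add0r.
  exact: c.
have [dr _] : is_derive (0 : R) 1 (fun t => u (t0 + t)) (du (t0 + 0)).
  by apply: dd; rewrite addr0.
apply: cvg_at_right_filter.
by move/derivable1_diffP/differentiable_continuous: dr.
Qed.

(** * Cumulants of the Kac process *)

Section KacCumulants.
Context {R : realType}.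

(** The recursion can be solved for the cumulant of the whole list, so cumulants inherit every
    identity between moments. *)
Lemma cumulant_unique (I : eqType) (kappa kappa' E E' : seq I -> R) :
  moment_cumulant kappa E -> moment_cumulant kappa' E' -> E =1 E' ->
  forall s, (0 < size s)%N -> kappa s = kappa' s.
Proof.
move=> H H' EE s; have [m] := ubnP (size s).
elim: m s => // m IH [|z s]//=; rewrite ltnS => sm _.
rewrite (cumulant_rec z s H) (cumulant_rec z s H') EE; congr (_ - _).
rewrite big_seq [RHS]big_seq; apply: eq_bigr => -[a b] /psplits_size[/= ab al].
by rewrite EE IH//= (leq_trans _ sm).
Qed.

Context {N : nat}.
Variable F : R -> probability (N.-tuple R) R.
Hypothesis kacF : kac_law F.
Hypothesis sym0 : symmetric_measure (F 0).
Variable t : R.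
Hypothesis t0 : 0 <= t.

Lemma kac_exp_integrable (eps : R) :
  (F t).-integrable setT (EFin \o (fun v => expR (eps * total_energy v))).
Proof. exact: sphere_exp_integrable (kacF.1 t t0) eps. Qed.

Lemma kac_cumulant_moment : moment_cumulant (cumulant (F t)) (energy_moment (F t)).
Proof. exact: cumulant_moment ltr01 (kac_exp_integrable 1). Qed.

Lemma kac_cumulant_perm l1 l2 : perm_eq l1 l2 ->
  cumulant (F t) l1 = cumulant (F t) l2.
Proof. exact: cumulant_perm ltr01 (kac_exp_integrable 1) _ _. Qed.

Lemma kac_cumulant_sym (s : 'S_N) l : (0 < size l)%N ->
  cumulant (F t) (map s l) = cumulant (F t) l.
Proof.
apply: (cumulant_unique (moment_cumulant_map s kac_cumulant_moment) kac_cumulant_moment).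
by move=> l' /=; exact: energy_moment_sym.
Qed.

Lemma kac_energy_moment1 i : energy_moment (F t) [:: i] = 1.
Proof.
have N0 : (N%:R : R) != 0 by rewrite pnatr_eq0; case: N i => // -[].
have := sphere_sum_rule (kacF.1 t t0) (@tilt_dom0 R N 1 ltr01).
rewrite !energy_mgf0 energy_moment_nil mulr1.
under eq_bigr do rewrite energy_mgf0.
rewrite (eq_bigr (fun=> energy_moment (F t) [:: i])) => [|j _]; last first.
  by rewrite -(energy_moment_sym kacF sym0 (tperm i j) [:: i] t0) /= tpermL.
by rewrite sumr_const card_ord => E; apply: (mulfI N0); rewrite mulr1 mulr_natl.
Qed.

(** The energy sum rule, split according to whether the summed site belongs to [L]. Outside, all
    labels are distinct; inside, exactly one is repeated. By symmetry all terms of one kind are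
    equal. *)
Lemma kac_cumulant_distinct i j l : uniq (j :: i :: l) ->
  (N%:R - (size l).+1%:R) * cumulant (F t) (j :: i :: l) +
  (size l).+1%:R * cumulant (F t) (i :: i :: l) = 0.
Proof.
set L := i :: l => /= /andP[jL uL].
have := sphere_cumulant_sum0 (kacF.1 t t0) i l; rewrite -/L => <-.
rewrite [RHS](bigID (mem L)) /= addrC; congr (_ + _).
- have cL : #|[pred x | x \notin L]| = (N - (size l).+1)%N.
    have := cardC (mem L); rewrite card_ord (card_uniqP _)//= => E.
    by rewrite -[X in _ = (X - _)%N]E addKn; apply: eq_card => x; rewrite !inE.
  have sN : ((size l).+1 <= N)%N.
    have := max_card (mem L); rewrite card_ord (card_uniqP _)//.
  rewrite (eq_bigr (fun=> cumulant (F t) (j :: L))); last first.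
    move=> k kL; rewrite -(kac_cumulant_sym (tperm j k) (l := k :: L))//.
    rewrite map_cons tpermR; congr (cumulant _ (_ :: _)).
    rewrite -[RHS]map_id; apply/eq_in_map => x xL; apply: tpermD.
      by apply: contraNneq jL => ->.
    by apply: contraNneq kL => ->.
  by rewrite sumr_const cL -[RHS]mulr_natl natrB.
- have cL : #|[pred x | x \in L]| = (size l).+1 by apply/card_uniqP.
  rewrite (eq_bigr (fun=> cumulant (F t) (i :: L))); last first.
    move=> k kL; rewrite -(kac_cumulant_sym (tperm i k) (l := k :: L))//=.
    have pL : perm_eq (map (tperm i k) L) L.
      apply: uniq_perm => //; first by rewrite map_inj_uniq//; exact: perm_inj.
      move=> x; rewrite -{1}[x](tpermK i k) mem_map; last exact: perm_inj.
      by case: tpermP => // ->; rewrite kL /L inE eqxx.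
    by rewrite tpermR; apply: kac_cumulant_perm => //; rewrite perm_cons; exact: pL.
  by rewrite sumr_const cL mulr_natl.
Qed.

End KacCumulants.

(** * Classifiers and lists of labels *)

Section Classifiers.
Context {N n : nat}.
Implicit Types (r : n.-tuple 'I_n.+1).

Lemma count_classifier_labels r (x : 'I_N) :
  count_mem x (classifier_labels N r) = nth ord0 r x.
Proof.
rewrite /classifier_labels count_flatten sumnE 2!big_map big_enum /=.
under eq_bigr do rewrite count_nseq.
rewrite (bigD1 x)//= eqxx mul1n big1 ?addn0// => i /negbTE ix.
by rewrite ix mul0n.
Qed.

Lemma mem_classifier_labels r (x : 'I_N) :
  (x \in classifier_labels N r) = (nth ord0 r x != ord0).
Proof.
by rewrite -has_pred1 has_count count_classifier_labels lt0n.
Qed.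

Lemma classifier_labels_perm r (s : seq 'I_N) :
  (forall x : 'I_N, count_mem x s = nth ord0 r x) -> perm_eq (classifier_labels N r) s.
Proof.
by move=> H; apply/allP => x _ /=; rewrite count_classifier_labels H.
Qed.

Lemma classifier_sorted r (i j : nat) : r \in classifiers n -> (i < j < n)%N ->
  (nth ord0 r j <= nth ord0 r i)%N.
Proof.
rewrite inE => /andP[rs _] /andP[ij jn].
have tr : transitive geq by move=> a b c; rewrite /geq => h1 h2; exact: leq_trans h2 h1.
have := sorted_ltn_nth tr 0%N rs; move=> /(_ i j); rewrite !inE !size_map !size_tuple.
move=> /(_ (ltn_trans ij jn) jn ij); rewrite !(nth_map ord0) ?size_tuple//.
exact: ltn_trans ij jn.
Qed.

Lemma classifier_len_gt0 r : r \in classifiers n -> (0 < n)%N ->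
  (0 < classifier_len r)%N.
Proof.
rewrite inE => /andP[_ /eqP rs] n0; rewrite lt0n; apply/negP => /eqP/card0_eq H.
move: n0; rewrite -{1}rs big1// => k _.
by have := H k; rewrite !inE => /negbFE/eqP ->.
Qed.

Lemma classifier_len_ge2 r (i j : 'I_n) : i != j ->
  tnth r i != ord0 -> tnth r j != ord0 -> (1 < classifier_len r)%N.
Proof.
by move=> ij ri rj; apply/card_gt1P; exists i, j; rewrite !inE.
Qed.

(** By monotonicity a nonzero entry after the first forces the first to be nonzero: a cumulant lives
    at site 0 alone or mixes two sites. These are the two cases of the final estimate. *)
Lemma classifier_dichotomy r (i0 : 'I_N) : val i0 = 0%N -> r \in classifiers n ->
  (0 < n <= N)%N ->
  perm_eq (classifier_labels N r) (nseq n i0) \/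
  ((1 < classifier_len r)%N /\
   exists i j, [/\ i \in classifier_labels N r, j \in classifier_labels N r & i != j]).
Proof.
move=> i00 rc /andP[n0 nN].
have [H|] := boolP [forall k : 'I_n, (0 < k)%N ==> (tnth r k == ord0)].
  left; apply: classifier_labels_perm => x.
  have rk (k : nat) : (0 < k)%N -> (nth ord0 r k : nat) = 0%N.
    move=> k0; have [kn|kn] := ltnP k n; last by rewrite nth_default ?size_tuple.
    have := forallP H (Ordinal kn); rewrite /= k0 /= => /eqP.
    by rewrite (tnth_nth ord0) /= => ->.
  rewrite count_nseq /=; have [<-|xi] := eqVneq i0 x; last first.
    rewrite mul0n rk// lt0n; apply: contra xi => /eqP x0.
    by apply/eqP/val_inj; rewrite /= i00 x0.
  move: rc; rewrite inE => /andP[_ /eqP E].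
  rewrite mul1n i00 -[LHS]E (bigD1 (Ordinal n0))//= big1 ?addn0 ?(tnth_nth ord0)// => k kk.
  rewrite (tnth_nth ord0) rk// lt0n; apply: contra kk => /eqP k0.
  exact/eqP/val_inj.
rewrite negb_forall => /existsP[k]; rewrite negb_imply => /andP[k0 rk]; right.
have r0 : nth ord0 r 0 != ord0.
  have := @classifier_sorted r 0 k rc; rewrite k0 ltn_ord => /(_ isT).
  move: rk; rewrite (tnth_nth ord0) -!(inj_eq val_inj) /= -!lt0n => h1 h2.
  exact: leq_trans h1 h2.
split.
  apply: (@classifier_len_ge2 r (Ordinal n0) k) => //.
    by rewrite -(inj_eq val_inj) /= eq_sym -lt0n.
  by rewrite (tnth_nth ord0).
exists i0, (widen_ord nN k); rewrite !mem_classifier_labels /= i00; split=> //.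
  by move: rk; rewrite (tnth_nth ord0).
by rewrite -(inj_eq val_inj) /= i00 eq_sym -lt0n.
Qed.

Variable s : seq 'I_N.
Hypothesis sn : size s = n.

Definition label_count (k : nat) : nat := count (fun i : 'I_N => val i == k) s.

(** Inverse of [classifier_labels] up to order, used to find a given list of labels in the norm. A
    count is at most [n], so [inord] loses nothing. *)
Definition classifier_of : n.-tuple 'I_n.+1 := [tuple inord (label_count k) | k < n].

Lemma label_countP (x : 'I_N) : count_mem x s = label_count x.
Proof. by apply: eq_count => i /=; rewrite -(inj_eq val_inj). Qed.

Lemma tnth_classifier_of k : tnth classifier_of k = label_count k :> nat.
Proof.
by rewrite tnth_mktuple inordK// ltnS -[in leqRHS]sn count_size.
Qed.

Hypothesis sl : forall x, x \in s -> (x < n)%N.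

Lemma nth_classifier_of (k : nat) : nth ord0 classifier_of k = label_count k :> nat.
Proof.
have [kn|kn] := ltnP k n.
  by have := tnth_classifier_of (Ordinal kn); rewrite (tnth_nth ord0).
rewrite nth_default ?size_tuple// /label_count; apply/esym/eqP.
rewrite -leqn0 leqNgt -has_count; apply/hasP => -[x /sl xn /= /eqP xk].
by move: xn; rewrite xk ltnNge kn.
Qed.

Lemma classifier_of_labels : perm_eq (classifier_labels N classifier_of) s.
Proof.
by apply: classifier_labels_perm => x; rewrite nth_classifier_of label_countP.
Qed.

Lemma classifier_of_in : (forall k, label_count k.+1 <= label_count k)%N ->
  classifier_of \in classifiers n.
Proof.
move=> dec; rewrite inE; apply/andP; split.
  apply/(sortedP 0%N) => i; rewrite size_map size_tuple => i1.
  rewrite !(nth_map ord0) ?size_tuple//; last exact: ltnW.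
  by rewrite /geq /= !nth_classifier_of.
under eq_bigr do rewrite tnth_classifier_of /label_count -sum1_count big_mkcond /=.
rewrite exchange_big /= big_seq.
rewrite (eq_bigr (fun=> 1%N)) -?big_seq ?sum1_size ?sn// => x /sl xn.
rewrite (bigD1 (Ordinal xn))//= eqxx big1 ?addn0// => k kx.
case: eqP => // xk; case/negP: kx; apply/eqP/val_inj; by rewrite /= xk.
Qed.

End Classifiers.

(** With x = n and y = N this reads (n - 1) / (N - n + 1) <= n^2 / (N - 1), up to the extreme case N
    = n. *)
Lemma distinct_ratio_le (R : realType) (x y : R) : 2 <= x -> x <= y ->
  (x - 1) * (y - 1) <= x ^+ 2 * (y - (x - 1)).
Proof.
move=> x2 xy; rewrite -subr_ge0.
have -> : x ^+ 2 * (y - (x - 1)) - (x - 1) * (y - 1) =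
  (2 * x - 1) + (y - x) * (x * (x - 1) + 1) by ring.
have xx : 0 <= x * (x - 1) by apply: mulr_ge0; lra.
by apply: addr_ge0; [lra|apply: mulr_ge0; lra].
Qed.

(** * From the norm to all cumulants that mix two sites *)

Section KacBounds.
Context {R : realType} {M : nat}.
Local Notation N := M.+2.
Variable F : R -> probability (N.-tuple R) R.
Hypothesis kacF : kac_law F.
Hypothesis sym0 : symmetric_measure (F 0).
Variables (t alpha Bd : R) (n : nat).
Hypothesis t0 : 0 <= t.
Hypothesis alpha01 : 0 < alpha < 1.
Hypothesis Bd0 : 0 <= Bd.
Hypothesis n0 : (0 < n)%N.
Hypothesis nN : (n <= N)%N.
Hypothesis norm_le :
  cumulant_norm N alpha (@classifier_cumulant R N n (F t)) <= Bd.

Local Notation eps := ((N%:R - 1) `^ (- alpha) : R).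

Lemma N1_ge1 : 1 <= N%:R - 1 :> R.
Proof. by rewrite lerBrDr -[1 + 1]/(2%:R) ler_nat. Qed.

Lemma decay_ge0 : 0 <= eps.
Proof. exact: powR_ge0. Qed.

Lemma decay_le1 : eps <= 1.
Proof.
apply: (@le_trans _ _ ((N%:R - 1) `^ 0)); last by rewrite powRr0.
apply: ler_powR; first exact: N1_ge1.
by rewrite oppr_le0; case/andP: alpha01 => /ltW.
Qed.

(** The energy sum rule gains a full factor 1 / (N - 1), at least as good as the decay rate since
    alpha <= 1. *)
Lemma inv_le_decay : (N%:R - 1)^-1 <= eps.
Proof.
rewrite -powR_inv1; last by rewrite (le_trans ler01 N1_ge1).
apply: ler_powR; first exact: N1_ge1.
by rewrite lerN2; case/andP: alpha01 => _ /ltW.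
Qed.

Lemma norm_term_le (r : n.-tuple 'I_n.+1) : r \in classifiers' n ->
  `|classifier_cumulant (F t) r| * (N%:R - 1) `^ (alpha * ((classifier_len r)%:R - 1))
  <= Bd.
Proof.
move=> rc; apply: le_trans norm_le; rewrite /cumulant_norm.
exact: (@le_bigmax_cond _ _ _ _ _ (fun r => r \in classifiers' n)
  (fun r => `|classifier_cumulant (F t) r| *
     (N%:R - 1) `^ (alpha * ((classifier_len r)%:R - 1))) rc).
Qed.

Lemma classifier_cumulant_le (r : n.-tuple 'I_n.+1) : r \in classifiers' n ->
  `|classifier_cumulant (F t) r| <= Bd.
Proof.
move=> rc; apply: le_trans (norm_term_le rc); rewrite ler_peMr//.
apply: (@le_trans _ _ ((N%:R - 1) `^ 0)); first by rewrite powRr0.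
apply: ler_powR; first exact: N1_ge1.
move: rc; rewrite !inE => /andP[_ rc]; case/andP: alpha01 => a0 _.
rewrite mulr_ge0// ?(ltW a0)// subr_ge0 ler1n.
by apply: classifier_len_gt0 => //; rewrite inE.
Qed.

Lemma classifier_cumulant_decay (r : n.-tuple 'I_n.+1) : r \in classifiers' n ->
  (1 < classifier_len r)%N -> `|classifier_cumulant (F t) r| <= eps * Bd.
Proof.
move=> rc rl; rewrite powRN ler_pdivlMl; last first.
  by rewrite powR_gt0// (lt_le_trans ltr01 N1_ge1).
apply: le_trans (norm_term_le rc); rewrite mulrC ler_wpM2l//.
apply: ler_powR; first exact: N1_ge1.
case/andP: alpha01 => a0 _; rewrite ler_peMr ?(ltW a0)// lerBrDr -[1 + 1]/(2%:R).
by rewrite ler_nat.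
Qed.

Lemma classifier_cumulantE (r : n.-tuple 'I_n.+1) s :
  perm_eq (classifier_labels N r) s ->
  classifier_cumulant (F t) r = cumulant (F t) s.
Proof.
move=> p; rewrite /classifier_cumulant.
rewrite (energy_cumulantE ltr01 (kac_exp_integrable kacF t0 1)).
exact: (kac_cumulant_perm kacF t0).
Qed.

Lemma tnth_all_ones k : tnth (all_ones n) k = 1%N :> nat.
Proof. by rewrite tnth_mktuple inordK// ltnS. Qed.

Lemma cumulant_distinct_le : (1 < n)%N ->
  `|cumulant (F t) [seq inord k | k <- iota 0 n]| <= n%:R ^+ 2 * eps * Bd.
Proof.
(* The site singled out is the last one: without it the labels still fill an initial segment, as a
   classifier requires. *)
move=> n1; pose l : seq 'I_N := [seq inord k | k <- iota 1 n.-2].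
pose i : 'I_N := inord 0; pose j : 'I_N := inord n.-1.
have lP (x : 'I_N) : x \in l -> (0 < x < n.-1)%N.
  move=> /mapP[k]; rewrite mem_iota => /andP[k0 k2] ->.
  by rewrite inordK; [lia|move: nN; lia].
have iE : i = 0%N :> nat by rewrite inordK.
have jE : j = n.-1 :> nat by rewrite inordK; move: nN; lia.
have ul : uniq l.
  rewrite map_inj_in_uniq ?iota_uniq// => a b; rewrite !mem_iota => ab bb.
  move/(congr1 (@nat_of_ord N)); rewrite !inordK//; move: nN; lia.
have uL : uniq (j :: i :: l).
  rewrite /= ul andbT inE negb_or; apply/andP; split; first (apply/andP; split).
  - by rewrite -(inj_eq val_inj) /= jE iE; lia.
  - by apply/negP => /lP; rewrite jE; lia.
  - by apply/negP => /lP; rewrite iE.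
have p : perm_eq [seq inord k | k <- iota 0 n] (j :: i :: l).
  have -> : iota 0 n = 0%N :: rcons (iota 1 n.-2) n.-1.
    have E : n = (1 + n.-2 + 1)%N by lia.
    rewrite {1}E !iotaD /= -cats1; congr (_ :: _ ++ [:: _]); lia.
  rewrite /= map_rcons; apply: (@perm_trans _ (i :: j :: l)).
    by rewrite perm_cons perm_rcons.
  by rewrite (perm_catCA [:: i] [:: j] l).
have sl : size l = n.-2 by rewrite size_map size_iota.
have D := kac_cumulant_distinct kacF sym0 t0 uL.
rewrite (kac_cumulant_perm kacF t0 p).
(* The repeated list has classifier (2, 1, ..., 1, 0), which the norm does control. *)
pose s := i :: i :: l.
have sn : size s = n by rewrite /= sl; lia.
have sb x : x \in s -> (x < n)%N.
  by rewrite !inE => /or3P[/eqP->|/eqP->|/lP]; rewrite ?iE//; lia.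
have cE k : label_count s k = (2 * (k == 0%N) + (0 < k < n.-1))%N.
  rewrite /label_count /= iE [0%N == k]eq_sym addnA addnn -mul2n; congr (_ + _)%N.
  have [kin|kin] := boolP (0 < k < n.-1)%N.
    have kN : (k < N)%N by move: nN; lia.
    rewrite (eq_count (a2 := pred1 (inord k))) => [|x]; last first.
      by rewrite /= -(inj_eq val_inj) /= inordK.
    rewrite count_uniq_mem// (_ : _ \in _ = true)//.
    by apply/mapP; exists k => //; rewrite mem_iota; lia.
  apply/eqP; rewrite -leqn0 leqNgt -has_count; apply/hasP => -[x /lP h /eqP xk].
  by move: kin; rewrite -xk h.
have rc : classifier_of s \in classifiers' n.
  rewrite in_setD1; apply/andP; split; last first.
    by apply: (classifier_of_in sn sb) => k; rewrite !cE; case: k => [|k] /=; lia.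
  apply/eqP => /(congr1 (fun r : n.-tuple 'I_n.+1 => nat_of_ord (tnth r (Ordinal n0)))).
  by rewrite tnth_all_ones (tnth_classifier_of sn) cE.
have := classifier_cumulant_le rc.
rewrite (classifier_cumulantE (classifier_of_labels sn sb)) -/s => sB.
rewrite sl (_ : n.-2.+1 = n.-1) in D; last by lia.
have nb : n%:R <= N%:R :> R by rewrite ler_nat.
have n2 : 2 <= n%:R :> R by rewrite ler_nat.
have nE : n.-1%:R = n%:R - 1 :> R by rewrite -subn1 natrB.
move: D; rewrite nE => D.
have Dpos : 0 < N%:R - (n%:R - 1) :> R by lra.
have E : cumulant (F t) (j :: i :: l) =
  - ((n%:R - 1) / (N%:R - (n%:R - 1)) * cumulant (F t) s).
  apply: (mulfI (lt0r_neq0 Dpos)); rewrite mulrN mulrA mulrCA divff ?gt_eqF// mulr1.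
  by apply/eqP; rewrite -addr_eq0; apply/eqP.
rewrite E normrN normrM; apply: ler_pM => //.
have n1R : 0 <= n%:R - 1 :> R by rewrite subr_ge0 ler1n.
rewrite ger0_norm; last by rewrite divr_ge0 ?n1R// ltW.
apply: (@le_trans _ _ (n%:R ^+ 2 * (N%:R - 1)^-1)); last first.
  by rewrite ler_wpM2l ?exprn_ge0 ?inv_le_decay.
have N1pos := lt_le_trans ltr01 N1_ge1.
rewrite ler_pdivrMr// mulrAC ler_pdivlMr//.
exact: distinct_ratio_le.
Qed.

Local Notation i0 := (ord0 : 'I_N).
Local Notation i1 := (inord 1 : 'I_N).

Lemma i01 : i0 != i1.
Proof. by rewrite -(inj_eq val_inj) /= inordK. Qed.

Lemma pair_cumulant_le k l : (0 < k)%N -> (0 < l)%N -> (k + l = n)%N ->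
  `|cumulant (F t) (pair_seq i0 i1 k l)| <= n%:R ^+ 2 * eps * Bd.
Proof.
(* Exchanging the two sites makes the counts nonincreasing, as in a classifier. *)
wlog lk : k l / (l <= k)%N => [H k0 l0 kl|k0 l0 kl].
  have [lk|kl'] := leqP l k; first exact: H.
  have := H _ _ (ltnW kl') l0 k0; rewrite addnC => /(_ kl).
  have p : perm_eq (pair_seq i0 i1 l k)
      (map (tperm i0 i1) (pair_seq i0 i1 k l)).
    by rewrite /pair_seq map_cat !map_nseq tpermL tpermR perm_catC.
  rewrite (kac_cumulant_perm kacF t0 p) (kac_cumulant_sym kacF sym0)//.
  by rewrite size_cat !size_nseq kl.
(* For [n = 2] the pair is the all-distinct cumulant, which the norm omits. *)
have [n2|n2] := eqVneq n 2.
  have := cumulant_distinct_le; rewrite {1 2}n2 => /(_ isT).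
  have [-> ->] : k = 1%N /\ l = 1%N by lia.
  by have -> : [seq inord k | k <- iota 0 2] = pair_seq i0 i1 1 1
    by rewrite /pair_seq /= (_ : inord 0 = ord0)//; apply/val_inj; rewrite /= inordK.
pose s := pair_seq i0 i1 k l.
have sn : size s = n by rewrite size_cat !size_nseq.
have sb x : x \in s -> (x < n)%N.
  by rewrite mem_cat !mem_nseq => /orP[] /andP[_ /eqP ->] //=; rewrite inordK//; lia.
have cE m : label_count s m = ((m == 0%N) * k + (m == 1%N) * l)%N.
  by rewrite /label_count count_cat !count_nseq /= inordK// ![_ == m]eq_sym.
have rc0 : classifier_of s \in classifiers n.
  by apply: (classifier_of_in sn sb) => m; rewrite !cE; case: m => [|[|m]] /=; lia.
have n1 : (1 < n)%N by lia.
have rc : classifier_of s \in classifiers' n.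
  rewrite in_setD1 rc0 andbT.
  apply/eqP => /(congr1 (fun r : n.-tuple 'I_n.+1 => nat_of_ord (tnth r (Ordinal n0)))).
  by rewrite tnth_all_ones (tnth_classifier_of sn) cE /=; lia.
have len : (1 < classifier_len (classifier_of s : n.-tuple 'I_n.+1))%N.
  apply: (@classifier_len_ge2 _ _ (Ordinal n0) (Ordinal n1)) => //.
    by rewrite -(inj_eq val_inj) /= (tnth_classifier_of sn) cE /=; lia.
  by rewrite -(inj_eq val_inj) /= (tnth_classifier_of sn) cE /=; lia.
have := classifier_cumulant_decay rc len.
rewrite (classifier_cumulantE (classifier_of_labels sn sb)) -/s => /le_trans; apply.
rewrite ler_wpM2r// ler_peMl ?decay_ge0// exprn_ege1//.
by rewrite ler1n.
Qed.

(** Order 1 is set apart because its only classifier is [all_ones]; that cumulant is the mean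
    energy. *)
Lemma single_cumulant_le : (1 < n)%N -> `|cumulant (F t) (nseq n i0)| <= Bd.
Proof.
move=> n1; pose s := nseq n i0.
have sn : size s = n by rewrite size_nseq.
have sb x : x \in s -> (x < n)%N by rewrite mem_nseq => /andP[_ /eqP ->].
have cE m : label_count s m = ((m == 0%N) * n)%N.
  by rewrite /label_count count_nseq /= eq_sym.
have rc : classifier_of s \in classifiers' n.
  rewrite in_setD1 (classifier_of_in sn sb) ?andbT; last first.
    by move=> m; rewrite !cE; case: m => [|m] /=; lia.
  apply/eqP => /(congr1 (fun r : n.-tuple 'I_n.+1 => nat_of_ord (tnth r (Ordinal n0)))).
  by rewrite tnth_all_ones (tnth_classifier_of sn) cE /=; lia.
have := classifier_cumulant_le rc.
by rewrite (classifier_cumulantE (classifier_of_labels sn sb)).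
Qed.

Lemma mixed_classifier_cumulant_le (r : n.-tuple 'I_n.+1) :
  r \in classifiers n -> (1 < classifier_len r)%N ->
  `|classifier_cumulant (F t) r| <= n%:R ^+ 2 * eps * Bd.
Proof.
move=> rc rl; have [ra|ra] := eqVneq r (all_ones n); last first.
  apply: le_trans (classifier_cumulant_decay _ rl) _.
    by rewrite in_setD1 ra rc.
  by rewrite ler_wpM2r// ler_peMl ?decay_ge0// exprn_ege1// ler1n.
have n1 : (1 < n)%N.
  apply: leq_trans rl _; rewrite /classifier_len.
  by apply: leq_trans (max_card _) _; rewrite card_ord.
rewrite (@classifier_cumulantE r [seq inord k | k <- iota 0 n]).
  exact: cumulant_distinct_le.
apply: classifier_labels_perm => x; rewrite ra.
have us : uniq ([seq inord k | k <- iota 0 n] : seq 'I_N).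
  rewrite map_inj_in_uniq ?iota_uniq// => a b; rewrite !mem_iota => ab bb.
  move/(congr1 (@nat_of_ord N)); rewrite !inordK//; move: nN; lia.
rewrite count_uniq_mem//; have [xn|xn] := ltnP x n.
  have := tnth_all_ones (Ordinal xn); rewrite (tnth_nth ord0) /= => ->.
  rewrite (_ : _ \in _ = true)//; apply/mapP; exists (x : nat).
    by rewrite mem_iota.
  by apply/val_inj; rewrite /= inordK.
rewrite nth_default ?size_tuple//= (_ : _ \in _ = false)//.
apply/mapP => -[k]; rewrite mem_iota => /andP[_ kn] xk.
by move: xn; rewrite xk inordK; move: nN kn; lia.
Qed.

End KacBounds.

(** * The Boltzmann--Kac equation *)

Section BoltzmannKac.
Context {R : realType}.
Implicit Types (mu : probability R R) (K : R) (n : nat).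

Definition trunc K (v : R) : R := Num.min (v ^+ 2) K.

Lemma trunc_ge0 K v : 0 <= K -> 0 <= trunc K v.
Proof. by move=> K0; rewrite /trunc le_min sqr_ge0. Qed.

Lemma trunc_le K v : trunc K v <= v ^+ 2.
Proof. by rewrite /trunc ge_min lexx. Qed.

Lemma trunc_leK K v : trunc K v <= K.
Proof. by rewrite /trunc ge_min lexx orbT. Qed.

(** One outgoing energy is at most the total incoming energy, and truncating all three keeps the
    inequality. Hence truncated moments satisfy inequalities closed among themselves. *)
Lemma trunc_circ K (v w theta : R) : 0 <= K ->
  trunc K (circ v w theta) <= trunc K v + trunc K w.
Proof.
move=> K0.
have : circ v w theta ^+ 2 <= v ^+ 2 + w ^+ 2.
  have -> : v ^+ 2 + w ^+ 2 = circ v w theta ^+ 2 + circ w (- v) theta ^+ 2.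
    transitivity ((cos theta ^+ 2 + sin theta ^+ 2) * (v ^+ 2 + w ^+ 2)).
      by rewrite cos2Dsin2 mul1r.
    by rewrite /circ; ring.
  by rewrite lerDl sqr_ge0.
move=> cvw; have v0 := trunc_ge0 v K0; have w0 := trunc_ge0 w K0.
rewrite {1}/trunc ge_min; apply/orP.
have [vK|Kv] := leP (v ^+ 2) K; last first.
  have vE : trunc K v = K by rewrite /trunc min_r ?ltW.
  by right; rewrite vE lerDl.
have [wK|Kw] := leP (w ^+ 2) K; last first.
  have wE : trunc K w = K by rewrite /trunc min_r ?ltW.
  by right; rewrite wE lerDr.
have vE : trunc K v = v ^+ 2 by rewrite /trunc min_l.
have wE : trunc K w = w ^+ 2 by rewrite /trunc min_l.
by left; rewrite vE wE.
Qed.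

(** The truncation acts only where v^2 > K, and there a further factor v^2 / K exceeds 1. *)
Lemma trunc_approx K v n : 0 < K ->
  `|trunc K v ^+ n - (v ^+ 2) ^+ n| <= (v ^+ 2) ^+ n.+1 / K.
Proof.
move=> K0; have v0 := sqr_ge0 v; rewrite /trunc; have [vK|Kv] := leP (v ^+ 2) K.
  by rewrite subrr normr0; apply: divr_ge0; [exact: exprn_ge0|exact: ltW].
have le1 : K ^+ n <= (v ^+ 2) ^+ n by rewrite lerXn2r ?nnegrE// ltW.
rewrite distrC ger0_norm ?subr_ge0// [_ ^+ n.+1]exprS ler_pdivlMr//.
apply: (@le_trans _ _ ((v ^+ 2) ^+ n * K)).
  by apply: ler_wpM2r; [exact: ltW|rewrite gerBl exprn_ge0// ltW].
rewrite [leRHS]mulrC; apply: ler_wpM2l; [exact: exprn_ge0|exact: ltW].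
Qed.

Lemma continuous_trunc K : continuous (trunc K).
Proof.
move=> x; apply: (@continuous_min _ _ (fun v : R => v ^+ 2) (cst K)).
  exact: exprn_continuous.
exact: cst_continuous.
Qed.

Lemma continuous_truncX K n : continuous (fun v => trunc K v ^+ n).
Proof.
move=> x; apply: (@continuous_comp _ _ _ (trunc K) (fun y => y ^+ n)).
  exact: continuous_trunc.
exact: exprn_continuous.
Qed.

Lemma truncX_test_function K n : 0 <= K ->
  test_function (fun v => K ^+ n - trunc K v ^+ n).
Proof.
move=> K0; split.
  by move=> x; apply: cvgB; [exact: cvg_cst|exact: continuous_truncX].
(* Beyond K + 1 one has v^2 >= (K + 1)^2 >= K, so no square root is needed to enclose the
   support. *)
apply: (@subclosed_compact _ _ [set` `[- (K + 1), K + 1]]).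
- exact: closed_closure.
- exact: segment_compact.
- have cI : closed [set` `[- (K + 1), K + 1]] by exact: interval_closed.
  rewrite [X in _ `<=` X](closure_id _).1//.
  apply: closure_subset => v /= v0; rewrite in_itv /= -ler_norml leNgt.
  apply: contra v0 => vK; rewrite /trunc min_r ?subrr//.
  rewrite -[v ^+ 2]real_normK ?num_real//.
  apply: (@le_trans _ _ ((K + 1) ^+ 2)).
    by have := sqr_ge0 K; rewrite sqrrD; lra.
  by rewrite lerXn2r ?nnegrE ?normr_ge0 ?addr_ge0// ltW.
Qed.

Definition trunc_moment mu n K : R := \int[mu]_v trunc K v ^+ n.

Lemma bounded_integrable d (T : measurableType d) (P : probability T R) (f : T -> R) (B : R) :
  measurable_fun setT f -> (forall x, `|f x| <= B) -> P.-integrable setT (EFin \o f).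
Proof.
move=> mf fB; apply: measurable_bounded_integrable => //.
  by apply: (@le_lt_trans _ _ 1%E); [exact: probability_le1|exact: ltry].
exists B; split; first exact: num_real.
by move=> x Bx v _; apply: le_trans (fB v) _; exact: ltW.
Qed.

Lemma truncX_le K v n : 0 <= K -> `|trunc K v ^+ n| <= K ^+ n.
Proof.
move=> K0; rewrite ger0_norm ?exprn_ge0 ?trunc_ge0//.
by rewrite lerXn2r ?nnegrE ?trunc_ge0 ?trunc_leK.
Qed.

Lemma truncX_integrable mu n K : 0 <= K ->
  mu.-integrable setT (EFin \o (fun v => trunc K v ^+ n)).
Proof.
move=> K0; apply: (@bounded_integrable _ _ _ _ (K ^+ n)).
  by apply: continuous_measurable_fun; exact: continuous_truncX.
by move=> v; exact: truncX_le.
Qed.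

Lemma Rintegral_prodm mu (a b : R -> R) :
  (forall x, 0 <= a x) -> (forall x, 0 <= b x) ->
  mu.-integrable setT (EFin \o a) -> mu.-integrable setT (EFin \o b) ->
  (mu \x mu)%E.-integrable setT (EFin \o (fun p : R * R => a p.1 * b p.2)) /\
  \int[(mu \x mu)%E]_p (a p.1 * b p.2) = (\int[mu]_x a x) * (\int[mu]_x b x).
Proof.
move=> a0 b0 ia ib.
have ma : measurable_fun setT a by have /measurable_int/measurable_EFinP := ia.
have mb : measurable_fun setT b by have /measurable_int/measurable_EFinP := ib.
have mab : measurable_fun setT (fun p : R * R => (a p.1 * b p.2)%:E).
  apply/measurable_EFinP; apply: measurable_funM.
    by apply: measurableT_comp => //; exact: measurable_fst.
  by apply: measurableT_comp => //; exact: measurable_snd.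
have Ea : (\int[mu]_x (a x)%:E)%E = (\int[mu]_x a x)%:E.
  by rewrite fineK//; exact: (integrable_fin_num measurableT ia).
have Eb : (\int[mu]_x (b x)%:E)%E = (\int[mu]_x b x)%:E.
  by rewrite fineK//; exact: (integrable_fin_num measurableT ib).
have E : (\int[mu \x mu]_p (a p.1 * b p.2)%:E)%E =
    ((\int[mu]_x a x) * (\int[mu]_x b x))%:E.
  rewrite fubini_tonelli1//; last by move=> p; rewrite lee_fin mulr_ge0.
  rewrite /fubini_F EFinM -Ea -ge0_integralZr//; last 3 first.
  - exact/measurable_EFinP.
  - by move=> x _; rewrite lee_fin a0.
  - by rewrite lee_fin Rintegral_ge0.
  apply: eq_integral => x _; rewrite -Eb -ge0_integralZl//.
  - exact/measurable_EFinP.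
  - by move=> y _; rewrite lee_fin.
  - by rewrite lee_fin.
split; last by rewrite /Rintegral E.
apply/integrableP; split => //.
under eq_integral => p _ do rewrite /= ger0_norm ?mulr_ge0//.
by rewrite E ltry.
Qed.

Lemma Rintegral_prodm_expD mu (a : R -> R) n : (forall x, 0 <= a x) ->
  (forall k, mu.-integrable setT (EFin \o (fun x => a x ^+ k))) ->
  (mu \x mu)%E.-integrable setT (EFin \o (fun p : R * R => (a p.1 + a p.2) ^+ n)) /\
  \int[(mu \x mu)%E]_p (a p.1 + a p.2) ^+ n =
  \sum_(k < n.+1) (\int[mu]_x a x ^+ (n - k)) * (\int[mu]_x a x ^+ k) *+ 'C(n, k).
Proof.
move=> a0 ia.
have ab k l := Rintegral_prodm (fun x => exprn_ge0 k (a0 x)) (fun x => exprn_ge0 l (a0 x))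
  (ia k) (ia l).
have E (p : R * R) : (a p.1 + a p.2) ^+ n =
    \sum_(k < n.+1) 'C(n, k)%:R * (a p.1 ^+ (n - k) * a p.2 ^+ k).
  by rewrite exprDn; apply: eq_bigr => k _; rewrite mulr_natl.
have iab (k : 'I_n.+1) := integrableZl measurableT ('C(n, k)%:R : R) (ab (n - k)%N k).1.
split.
  have -> : EFin \o (fun p : R * R => (a p.1 + a p.2) ^+ n) =
    (fun p => (\sum_(k < n.+1) ('C(n, k)%:R * (a p.1 ^+ (n - k) * a p.2 ^+ k))%:E)%E).
    by apply/funext => p; rewrite /= E sumEFin.
  by apply: integrable_sum => // k _; exact: iab.
under eq_Rintegral do rewrite E.
rewrite Rintegral_sum//; apply: eq_bigr => k _.
rewrite RintegralZl//; last exact: (ab _ _).1.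
by rewrite (ab _ _).2 mulr_natl.
Qed.

(** The sign of [p.2] is that of the collision in [bk_gain]: cos v - sin w. *)
Definition circle_avg (psi : R -> R) (p : R * R) : R :=
  \int[@lebesgue_measure R]_(theta in `[- pi, pi])
     (psi (circ p.1 (- p.2) theta) / (2 * pi)).

Lemma circle_avg_integrable (psi : R -> R) (v w : R) : continuous psi ->
  (@lebesgue_measure R).-integrable `[- pi, pi]
    (EFin \o (fun theta => psi (circ v w theta) / (2 * pi))).
Proof.
move=> cpsi; apply: circ_integrable => x; apply: cvgM; last exact: cvg_cst.
apply: (@continuous_comp _ _ _ (circ v w) psi); first exact: continuous_circ.
exact: cpsi.
Qed.

Lemma circle_avg_cst (c : R) :
  \int[@lebesgue_measure R]_(theta in `[- pi, pi]) (c / (2 * pi)) = c.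
Proof.
rewrite Rintegral_cst//= [fine _](_ : _ = 2 * pi); last first.
  by rewrite [X in fine X]lebesgue_circle.
by rewrite mulfVK// mulf_neq0// gt_eqF// pi_gt0.
Qed.

Lemma circle_avg_le (psi : R -> R) (p : R * R) (c : R) : continuous psi ->
  (forall theta, psi (circ p.1 (- p.2) theta) <= c) -> circle_avg psi p <= c.
Proof.
move=> cpsi H; rewrite -[leRHS](circle_avg_cst c); apply: le_Rintegral => //.
- exact: circle_avg_integrable.
- by apply: (@circ_integrable _ (cst _)); exact: cst_continuous.
- move=> theta _; rewrite ler_wpM2r// invr_ge0 mulr_ge0// pi_ge0//.
Qed.

(** Tonelli's theorem brings the angular integral inside, where it can be evaluated or bounded for
    each pair of velocities. *)
Lemma bk_gain_swap (psi : R -> R) mu (B : R) : continuous psi ->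
  (forall v, 0 <= psi v <= B) ->
  (mu \x mu)%E.-integrable setT (EFin \o (circle_avg psi)) /\
  bk_gain psi mu = \int[(mu \x mu)%E]_p circle_avg psi p.
Proof.
move=> cpsi psiB.
have tpi : 0 < 2 * pi :> R by rewrite mulr_gt0// pi_gt0.
have mpsi : measurable_fun setT psi by exact: continuous_measurable_fun.
have psi0 v : 0 <= psi v by case/andP: (psiB v).
pose g (x : R * (R * R)) : R := circ x.2.1 (- x.2.2) x.1.
have mg : measurable_fun setT g.
  apply: measurable_funD; apply: measurable_funM.
  - by apply: measurableT_comp; [apply: continuous_measurable_fun; exact: continuous_cos|exact: measurable_fst].
  - by apply: measurableT_comp; [exact: measurable_fst|exact: measurable_snd].
  - by apply: measurableT_comp; [apply: continuous_measurable_fun; exact: continuous_sin|exact: measurable_fst].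
  - apply: measurableT_comp => //.
    by apply: measurableT_comp; [exact: measurable_snd|exact: measurable_snd].
(* The indicator carries the range of the angle, so that Tonelli applies on the whole line. *)
pose H (x : R * (R * R)) : \bar R :=
  (\1_(`[- pi, pi]%classic : set R) x.1 * (psi (g x) / (2 * pi)))%:E.
have mH : measurable_fun setT H.
  apply/measurable_EFinP; apply: measurable_funM.
    apply: measurableT_comp; last exact: measurable_fst.
    exact: measurable_indic.
  by apply: measurable_funM => //; exact: measurableT_comp.
have H0 x : (0 <= H x)%E.
  by rewrite lee_fin mulr_ge0// divr_ge0// ltW.
have avgE p : (\int[@lebesgue_measure R]_theta H (theta, p))%E = (circle_avg psi p)%:E.
  rewrite /circle_avg fineK; last first.
    exact: (integrable_fin_num _ (circle_avg_integrable _ _ cpsi)).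
  rewrite [RHS]integral_mkcond epatch_indic; apply: eq_integral => theta _.
  by rewrite /H /g /= -EFinM mulrC.
have thetaE theta : (\int[(mu \x mu)%E]_p (psi (g (theta, p)))%:E)%E =
    (\int[mu]_v \int[mu]_w psi (cos theta * v - sin theta * w))%:E.
  have m2 : measurable_fun setT (fun p : R * R => (psi (g (theta, p)))%:E).
    apply/measurable_EFinP; apply: measurableT_comp => //.
    exact: (measurableT_comp mg (pair1_measurable theta)).
  rewrite fubini_tonelli1//; last by move=> p; rewrite lee_fin.
  rewrite /fubini_F.
  have E v : (\int[mu]_w (psi (g (theta, (v, w))))%:E)%E =
      (\int[mu]_w psi (cos theta * v - sin theta * w))%:E.
    rewrite fineK; first by apply: eq_integral => w _; rewrite /g /circ /= mulrN.
    apply: (integrable_fin_num measurableT).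
    apply: (@bounded_integrable _ _ _ _ B).
      apply: continuous_measurable_fun => w; apply: (@continuous_comp _ _ _ (fun w : R => cos theta * v - sin theta * w) psi).
        apply: cvgB; first exact: cvg_cst.
        by apply: mulrl_continuous.
      exact: cpsi.
    by move=> w; have /andP[p0 pB] := psiB (cos theta * v - sin theta * w); rewrite ger0_norm.
  under eq_integral do rewrite E.
  rewrite fineK//; apply: (integrable_fin_num measurableT).
  apply: (@bounded_integrable _ _ _ _ B).
    apply/measurable_EFinP.
    have := measurable_fun_fubini_tonelli_F (m2 := mu) _ m2.
    move=> /(_ (fun p => psi0 _)); rewrite /fubini_F.
    by under eq_fun do rewrite E.
  move=> v; rewrite ger0_norm; last by apply: Rintegral_ge0 => w _.
  have cw : continuous (fun w : R => psi (cos theta * v - sin theta * w)).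
    move=> w; apply: (@continuous_comp _ _ _ (fun w : R => cos theta * v - sin theta * w) psi).
      by apply: cvgB; [exact: cvg_cst|apply: mulrl_continuous].
    exact: cpsi.
  have -> : B = \int[mu]_(w in setT) B.
    by rewrite Rintegral_cst//= [X in fine X]probability_setT mulr1.
  apply: le_Rintegral => //.
  - apply: (@bounded_integrable _ _ _ _ B); first exact: continuous_measurable_fun.
    by move=> w; have /andP[p0 pB] := psiB (cos theta * v - sin theta * w); rewrite ger0_norm.
  - exact: finite_measure_integrable_cst.
  - by move=> w _; case/andP: (psiB (cos theta * v - sin theta * w)).
pose nu : probability (R * R)%type R := (mu \x mu)%E.
have swap := fubini_tonelli (m1 := @lebesgue_measure R) (m2 := nu) H mH H0.
have mavg : measurable_fun setT (circle_avg psi).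
  apply/measurable_EFinP.
  have := measurable_fun_fubini_tonelli_G (m1 := @lebesgue_measure R) _ mH H0.
  by rewrite /fubini_G; under eq_fun do rewrite avgE.
split.
  apply: (@bounded_integrable _ _ _ _ B) => // p.
  rewrite ger0_norm; last first.
    by apply: Rintegral_ge0 => theta _; rewrite divr_ge0// ltW.
  apply: circle_avg_le => // theta.
  by case/andP: (psiB (circ p.1 (- p.2) theta)).
rewrite /bk_gain {1}/Rintegral [RHS]/Rintegral; congr fine.
under [RHS]eq_integral do rewrite -avgE.
rewrite -swap integral_mkcond epatch_indic; apply: eq_integral => theta _ /=.
pose c : R := \1_(`[- pi, pi]%classic : set R) theta / (2 * pi).
have c0 : 0 <= c by rewrite divr_ge0// ltW.
transitivity (c%:E * \int[(mu \x mu)%E]_p (psi (g (theta, p)))%:E)%E.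
  by rewrite thetaE -!EFinM; congr EFin; rewrite /c; ring.
rewrite -ge0_integralZl//.
- by apply: eq_integral => p _; rewrite /H /= -EFinM; congr EFin; rewrite /c; ring.
- apply/measurable_EFinP; apply: measurableT_comp => //.
  exact: (measurableT_comp mg (pair1_measurable theta)).
- by move=> p _; rewrite lee_fin.
Qed.

End BoltzmannKac.

Section BoltzmannKacMoments.
Context {R : realType}.
Implicit Types (mu : probability R R) (K : R) (n : nat).

Lemma trunc_moment_ge0 mu n K : 0 <= K -> 0 <= trunc_moment mu n K.
Proof. by move=> K0; apply: Rintegral_ge0 => v _; rewrite exprn_ge0// trunc_ge0. Qed.

Lemma Rintegral_cst_probability d (T : measurableType d) (P : probability T R) (c : R) :
  \int[P]_x c = c.
Proof. by rewrite Rintegral_cst//= [X in fine X]probability_setT mulr1. Qed.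

Lemma trunc_moment0 mu K : trunc_moment mu 0 K = 1.
Proof.
rewrite /trunc_moment; under eq_Rintegral do rewrite expr0.
exact: Rintegral_cst_probability.
Qed.

Lemma truncX_range K n v : 0 <= K -> 0 <= trunc K v ^+ n <= K ^+ n.
Proof.
move=> K0; rewrite exprn_ge0 ?trunc_ge0//=.
by rewrite lerXn2r ?nnegrE ?trunc_ge0 ?trunc_leK.
Qed.

Lemma cst_integrable d (T : measurableType d) (P : probability T R) (c : R) :
  P.-integrable setT (EFin \o cst c).
Proof. exact: finite_measure_integrable_cst. Qed.

(** The gain of a constant is that constant, hence gain and loss of [K ^+ n] cancel. The equation
    thereby passes from the test function to [trunc K v ^+ n] itself. *)
Lemma bk_gain_compl mu n K : 0 <= K ->
  bk_gain (fun v => K ^+ n - trunc K v ^+ n) mu =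
  K ^+ n - bk_gain (fun v => trunc K v ^+ n) mu.
Proof.
move=> K0; have cX := @continuous_truncX R K n.
have cC : continuous (fun v => K ^+ n - trunc K v ^+ n).
  by move=> x; apply: cvgB; [exact: cvg_cst|exact: cX].
have [i1 ->] := bk_gain_swap mu cX (fun v => truncX_range n v K0).
have rC v : 0 <= K ^+ n - trunc K v ^+ n <= K ^+ n.
  by have /andP[h1 h2] := truncX_range n v K0; rewrite subr_ge0 h2 gerBl h1.
have [i2 ->] := bk_gain_swap mu cC rC.
pose nu : probability (R * R)%type R := (mu \x mu)%E.
rewrite -[X in _ = X - _](Rintegral_cst_probability nu (K ^+ n)).
rewrite -(RintegralB measurableT (cst_integrable nu (K ^+ n)) i1).
apply: eq_Rintegral => p _; rewrite /circle_avg.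
rewrite -[X in _ = X - _]circle_avg_cst -RintegralB//.
- by apply: eq_Rintegral => theta _; rewrite mulrBl.
- by apply: (@circ_integrable _ (cst _)); exact: cst_continuous.
- exact: (circle_avg_integrable p.1 (- p.2) cX).
Qed.

Variable mu : R -> probability R R.
Hypothesis bk : boltzmann_kac_solution mu.

Lemma deriv_trunc_moment n K : 0 <= K ->
  deriv_nonneg (fun T => trunc_moment (mu T) n K)
    (fun T => - 2 * trunc_moment (mu T) n K
              + 2 * bk_gain (fun v => trunc K v ^+ n) (mu T)).
Proof.
move=> K0; have := has_derivative_on_nonnegP (bk.1 _ (truncX_test_function n K0)).
have E T : \int[mu T]_v (K ^+ n - trunc K v ^+ n) = K ^+ n - trunc_moment (mu T) n K.
  rewrite (RintegralB measurableT (cst_integrable _ (K ^+ n)) (truncX_integrable _ n K0)).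
  by rewrite Rintegral_cst_probability.
move=> /deriv_nonnegN /(deriv_nonneg_shift (K ^+ n)) H.
have {}H := deriv_nonneg_ext _ H.
have {}H := H (fun T => trunc_moment (mu T) n K).
apply: deriv_nonneg_eq (H _) _ => [t _|t _]; first by rewrite E; ring.
by rewrite E bk_gain_compl//; ring.
Qed.

Lemma bk_gain_le mu0 n K : 0 <= K ->
  bk_gain (fun v => trunc K v ^+ n) mu0 <=
  \sum_(k < n.+1) trunc_moment mu0 (n - k) K * trunc_moment mu0 k K *+ 'C(n, k).
Proof.
move=> K0; have cX := @continuous_truncX R K n.
have [i1 ->] := bk_gain_swap mu0 cX (fun v => truncX_range n v K0).
have [i2 <-] := Rintegral_prodm_expD n (fun v => trunc_ge0 v K0)
  (fun k => truncX_integrable mu0 k K0).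
apply: le_Rintegral => // p _; apply: circle_avg_le => // theta.
rewrite lerXn2r ?nnegrE ?addr_ge0 ?trunc_ge0//.
have := trunc_circ p.1 (- p.2) theta K0.
by rewrite [trunc K (- p.2)]/trunc sqrrN.
Qed.

Lemma big_ord_ends n (f : nat -> R) : (0 < n)%N ->
  \sum_(k < n.+1) f k = f 0%N + f n + \sum_(1 <= k < n) f k.
Proof.
move=> n0; rewrite big_ord_recr /= -(big_mkord xpredT f).
by rewrite big_ltn//; ring.
Qed.

(** With q = n! (b e^(2t))^n as a supersolution: each of the n - 1 inner binomial terms is at most q
    because 'C(n, k) k! (n - k)! = n!, and q' = 2 n q absorbs them, so that (A - q)' <= 2 (A - q).
    The bound is uniform in [K]; its dependence on [b] and [T] is harmless. *)
Lemma trunc_moment_le (b : R) : 0 <= b ->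
  (forall n K, 0 < K -> trunc_moment (mu 0) n K <= b ^+ n) ->
  forall n K T, 0 < K -> 0 <= T ->
    trunc_moment (mu T) n K <= n`!%:R * (b * expR (2 * T)) ^+ n.
Proof.
move=> b0 H0 n; have [m] := ubnP n.
elim: m n => // m IH n nm K T K0 T0.
have [->|n0] := posnP n; first by rewrite trunc_moment0 fact0 expr0 mulr1.
pose q (t : R) := n`!%:R * (b * expR (2 * t)) ^+ n.
have qE : q = (fun t => (n`!%:R * b ^+ n) * expR ((2 * n%:R) * t)).
  apply/funext => t; rewrite /q exprMn mulrA -expRM_natl; congr (_ * expR _).
  by ring.
have dq := deriv_nonneg_exp (n`!%:R * b ^+ n) (2 * n%:R).
have dA := deriv_trunc_moment n (ltW K0).
have dw := deriv_nonnegD dA (deriv_nonnegN dq).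
have G := gronwall_le (lam := 2) dw T0.
have {}G := G _.
suff : forall t, 0 < t < T ->
    - 2 * trunc_moment (mu t) n K + 2 * bk_gain (fun v => trunc K v ^+ n) (mu t) +
    - (2 * n%:R * (n`!%:R * b ^+ n * expR (2 * n%:R * t))) <=
    2 * (trunc_moment (mu t) n K + - (n`!%:R * b ^+ n * expR (2 * n%:R * t))).
  move=> /G; rewrite mulr0 expR0 mulr1.
  have : trunc_moment (mu 0) n K - n`!%:R * b ^+ n <= 0.
    rewrite subr_le0; apply: le_trans (H0 _ _ K0) _.
    by rewrite ler_peMl ?exprn_ge0// ler1n fact_gt0.
  move=> w0 G'; have : expR (2 * T) * (trunc_moment (mu 0) n K - n`!%:R * b ^+ n) <= 0.
    by rewrite mulr_ge0_le0// expR_ge0.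
  move=> /(le_trans G'); rewrite subr_le0 => /le_trans; apply.
  by have := congr1 (fun f => f T) qE; rewrite /q => ->.
move=> t /andP[t0 _].
have tE := congr1 (fun f => f t) qE; rewrite /= in tE; rewrite -tE.
have A0 k : 0 <= trunc_moment (mu t) k K by apply: trunc_moment_ge0; exact: ltW.
set A := trunc_moment (mu t) n K.
have GL : bk_gain (fun v => trunc K v ^+ n) (mu t) <= 2 * A + n.-1%:R * q t.
  apply: le_trans (bk_gain_le _ _ (ltW K0)) _.
  rewrite (big_ord_ends (fun k => trunc_moment (mu t) (n - k) K * trunc_moment (mu t) k K *+ 'C(n, k)))//.
  rewrite subn0 subnn bin0 binn !trunc_moment0 mulr1 mul1r -/A !mulr1n.
  have -> : A + A = 2 * A by ring.
  rewrite lerD2l; apply: (@le_trans _ _ (\sum_(1 <= k < n) q t)); last first.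
    by rewrite sumr_const_nat subn1 mulr_natl.
  rewrite big_nat [leRHS]big_nat; apply: ler_sum => k /andP[k1 kn].
  have h1 : trunc_moment (mu t) (n - k) K <= (n - k)`!%:R * (b * expR (2 * t)) ^+ (n - k).
    by apply: IH => //; [lia|exact: ltW].
  have h2 : trunc_moment (mu t) k K <= k`!%:R * (b * expR (2 * t)) ^+ k.
    by apply: IH => //; [lia|exact: ltW].
  have := ler_pM (A0 _) (A0 _) h1 h2.
  rewrite mulrACA -exprD subnK; last exact: ltnW.
  move=> h; rewrite -mulr_natl; have := ler_wpM2l (ler0n R 'C(n, k)) h.
  move=> /le_trans; apply; rewrite mulrA -!natrM /q.
  by rewrite [((n - k)`! * _)%N]mulnC bin_fact// ltnW.
have nE : n%:R = n.-1%:R + 1 :> R by rewrite natr1 prednK.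
rewrite -!mulrA -/(q t) nE.
move: GL; set G1 := bk_gain _ _; set Q := q t; set N1 := n.-1%:R => GL.
have -> : 2 * ((N1 + 1) * Q) = 2 * (N1 * Q) + 2 * Q by ring.
by lra.
Qed.

End BoltzmannKacMoments.

(** * Exponential moments from truncated moments *)

Section ExponentialMoment.
Context {R : realType}.
Variable mu : probability R R.
Variable q : R.
Hypothesis q0 : 0 < q.
Hypothesis Hq : forall n K, 0 < K -> trunc_moment mu n K <= n`!%:R * q ^+ n.

(** Series and truncation level grow together, so one monotone limit reaches the exponential. At the
    rate 1 / (2q) the k-th term has integral at most 2^(-k); the level [J.+1] is positive, as [Hq]
    demands. *)
Definition trunc_exp (J : nat) (v : R) : R :=
  \sum_(k < J) ((2 * q)^-1 ^+ k / k`!%:R) * trunc J.+1%:R v ^+ k.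

Lemma trunc_exp_ge0 J v : 0 <= trunc_exp J v.
Proof.
apply: sumr_ge0 => k _; rewrite mulr_ge0 ?exprn_ge0 ?trunc_ge0//.
by rewrite divr_ge0 ?exprn_ge0// invr_ge0 mulr_ge0// ltW.
Qed.

Lemma trunc_exp_mono v : {homo trunc_exp ^~ v : n m / (n <= m)%N >-> n <= m}.
Proof.
apply: homo_leq => [x|y x z|J]; [exact: lexx|exact: le_trans|].
rewrite /trunc_exp big_ord_recr /= ler_wpDr//.
  rewrite mulr_ge0 ?exprn_ge0 ?trunc_ge0//.
  by rewrite divr_ge0 ?exprn_ge0// invr_ge0 mulr_ge0// ltW.
apply: ler_sum => k _; apply: ler_wpM2l.
  by rewrite divr_ge0 ?exprn_ge0// invr_ge0 mulr_ge0// ltW.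
rewrite lerXn2r ?nnegrE ?trunc_ge0//.
by rewrite /trunc le_min !ge_min lexx ler_nat leqnSn orbT.
Qed.

Lemma measurable_trunc_exp J : measurable_fun setT (trunc_exp J).
Proof.
apply: measurable_sum => k; apply: measurable_funM => //.
by apply: continuous_measurable_fun; exact: continuous_truncX.
Qed.

Lemma trunc_exp_cvg v : trunc_exp J v @[J --> \oo] --> expR ((2 * q)^-1 * v ^+ 2).
Proof.
have := @is_cvg_series_exp_coeff R ((2 * q)^-1 * v ^+ 2).
rewrite /expR => /cvgP H.
have {}H : series (exp_coeff ((2 * q)^-1 * v ^+ 2)) n @[n --> \oo] -->
    limn (series (exp_coeff ((2 * q)^-1 * v ^+ 2))).
  exact: is_cvg_series_exp_coeff.
apply: cvg_trans H; apply: near_eq_cvg.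
near=> J; rewrite /series /= big_mkord /trunc_exp; apply: eq_bigr => k _.
rewrite /exp_coeff /= (_ : trunc _ v = v ^+ 2); last first.
  rewrite /trunc min_l//; apply: (@le_trans _ _ J%:R); last by rewrite ler_nat.
  near: J; exact: nbhs_infty_ger.
by rewrite exprMn mulrAC.
Unshelve. all: by end_near. Qed.

Lemma Rintegral_trunc_exp J :
  (\int[mu]_v (trunc_exp J v)%:E <= (2 : R)%:E)%E.
Proof.
have K0 : 0 < J.+1%:R :> R by rewrite ltr0n.
have i1 (k : 'I_J) := integrableZl measurableT ((2 * q)^-1 ^+ k / k`!%:R : R)
  (truncX_integrable mu k (ltW K0)).
have E : (\int[mu]_v (trunc_exp J v)%:E)%E =
    (\sum_(k < J) (2 * q)^-1 ^+ k / k`!%:R * trunc_moment mu k J.+1%:R)%:E.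
  have iS : mu.-integrable setT (EFin \o trunc_exp J).
    have -> : EFin \o trunc_exp J = (fun v => (\sum_(k < J)
        ((2 * q)^-1 ^+ k / k`!%:R * trunc J.+1%:R v ^+ k)%:E)%E).
      by apply/funext => v; rewrite /= sumEFin.
    by apply: integrable_sum => // k _; exact: i1.
  rewrite -[LHS]fineK; last exact: (integrable_fin_num measurableT iS).
  congr EFin; rewrite -/(Rintegral mu setT (trunc_exp J)) Rintegral_sum//.
  by apply: eq_bigr => k _; rewrite RintegralZl//; exact: truncX_integrable.
rewrite E lee_fin; apply: (@le_trans _ _ (\sum_(k < J) (2^-1 : R) ^+ k)).
  apply: ler_sum => k _; have := Hq k K0; set A := trunc_moment _ _ _ => HA.
  have f0 : 0 < k`!%:R :> R by rewrite ltr0n fact_gt0.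
  apply: (@le_trans _ _ ((2 * q)^-1 ^+ k / k`!%:R * (k`!%:R * q ^+ k))).
    by apply: ler_wpM2l => //; rewrite divr_ge0 ?exprn_ge0 ?invr_ge0 ?mulr_ge0// ltW.
  rewrite mulrA mulfVK ?gt_eqF// -exprMn invfM -mulrA mulVf ?gt_eqF// mulr1//.
have : forall n, \sum_(k < n) (2^-1 : R) ^+ k = 2 - 2 * 2^-1 ^+ n.
  elim=> [|n IH]; first by rewrite big_ord0 expr0; ring.
  by rewrite big_ord_recr /= IH exprS; field.
by move=> ->; rewrite gerBl mulr_ge0// exprn_ge0.
Qed.

Lemma exp_moment_integrable :
  mu.-integrable setT (EFin \o (fun v => expR ((2 * q)^-1 * v ^+ 2))).
Proof.
apply/integrableP; split.
  apply/measurable_EFinP; apply: measurableT_comp => //.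
  by apply: measurable_funM => //; exact: exprn_measurable.
have lE v : limn (fun J => (trunc_exp J v)%:E) = (expR ((2 * q)^-1 * v ^+ 2))%:E.
  by apply/cvg_lim => //; apply: cvg_EFin; [exact: nearW|exact: trunc_exp_cvg].
have mc := @monotone_convergence _ _ _ mu setT measurableT (fun J v => (trunc_exp J v)%:E).
have {}mc := mc _ _ _.
under eq_integral => v _ do rewrite /= ger0_norm ?expR_ge0// -lE.
rewrite mc; first last.
- by move=> v _ n m nm; rewrite lee_fin; exact: trunc_exp_mono.
- by move=> n v _; rewrite lee_fin trunc_exp_ge0.
- by move=> n; apply/measurable_EFinP; exact: measurable_trunc_exp.
apply: (@le_lt_trans _ _ (2 : R)%:E); last exact: ltry.
apply: lime_le.
  apply: ereal_nondecreasing_is_cvgn => n m nm; apply: ge0_le_integral => //.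
  - by move=> v _; rewrite lee_fin trunc_exp_ge0.
  - by apply/measurable_EFinP; exact: measurable_trunc_exp.
  - by apply/measurable_EFinP; exact: measurable_trunc_exp.
  - by move=> v _; rewrite lee_fin; exact: trunc_exp_mono.
by apply: nearW => J; exact: Rintegral_trunc_exp.
Qed.

End ExponentialMoment.

(** * Removal of the truncation *)

Section TruncationLimit.
Context {R : realType}.
Variable mu : probability R R.
Hypothesis im : forall n, mu.-integrable setT (EFin \o (fun v => (v ^+ 2) ^+ n)).
Implicit Types (K : R).

(** Stands for the limit [K] to infinity while keeping every estimate at finite [K]. *)
Lemma le_of_div_le (x C s : R) : 0 <= s -> (forall K, 0 < K -> x <= C + s / K) -> x <= C.
Proof.
move=> s0 H; rewrite leNgt; apply/negP => Cx.
have d0 : 0 < x - C by rewrite subr_gt0.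
have s1 : 0 < s + 1 by rewrite ltr_wpDl.
(* At [K = (s + 1) / (x - C)] the error [s / K] is strictly below [x - C]. *)
have := H _ (divr_gt0 s1 d0).
have -> : s / ((s + 1) / (x - C)) = (x - C) - (x - C) / (s + 1).
  by field; rewrite !gt_eqF.
by have := divr_gt0 d0 s1; lra.
Qed.

Lemma trunc_moment_approx n K : 0 < K ->
  `|trunc_moment mu n K - site_moment mu n| <= site_moment mu n.+1 / K.
Proof.
move=> K0; have it := truncX_integrable mu n (ltW K0).
have ii := integrableZr measurableT (K^-1 : R) (im n.+1).
rewrite /trunc_moment /site_moment -(RintegralB measurableT it (im n)).
rewrite -(RintegralZr _ measurableT (im n.+1)).
apply: le_trans (le_normr_Rintegral measurableT _) _.
  by have := integrableB measurableT it (im n).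
apply: le_Rintegral => //.
  by apply: integrable_norm; have := integrableB measurableT it (im n).
by move=> v _; exact: trunc_approx.
Qed.

Lemma site_moment_le n C : (forall K, 0 < K -> trunc_moment mu n K <= C) ->
  site_moment mu n <= C.
Proof.
move=> H; apply: (@le_of_div_le _ _ (site_moment mu n.+1)); first exact: site_moment_ge0.
move=> K K0; have := trunc_moment_approx n K0; have := H K K0.
by rewrite distrC => h1 /(le_trans (ler_norm _)); lra.
Qed.

Lemma site_circle_avg n (p : R * R) :
  circle_avg (fun v => (v ^+ 2) ^+ n) p = wallis n * (p.1 ^+ 2 + p.2 ^+ 2) ^+ n.
Proof.
rewrite /circle_avg RintegralZr//; last first.
  apply: circ_integrable => x.
  have -> : (fun x => (circ p.1 (- p.2) x ^+ 2) ^+ n) = (fun x => circ p.1 (- p.2) x ^+ (2 * n)).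
    by apply/funext => y; rewrite exprM.
  exact: continuous_circX.
under eq_Rintegral do rewrite -exprM mul2n.
rewrite circle_mean sqrrN.
have pi0 : 2 * pi != 0 :> R by rewrite mulf_neq0// gt_eqF// pi_gt0.
by move: pi0; set c := 2 * pi => c0; rewrite -mulrA mulrAC divff// mul1r.
Qed.

Lemma continuous_sqX n : continuous (fun v : R => (v ^+ 2) ^+ n).
Proof.
have -> : (fun v : R => (v ^+ 2) ^+ n) = (fun v => v ^+ (2 * n)).
  by apply/funext => y; rewrite exprM.
exact: exprn_continuous.
Qed.

(** For each angle the error is the next power of the energy over [K]; its circle mean is again
    explicit, which produces the binomial sum of order n + 1. *)
Lemma bk_gain_approx n K : 0 < K ->
  `|bk_gain (fun v => trunc K v ^+ n) mu -
    wallis n * \sum_(k < n.+1) site_moment mu (n - k) * site_moment mu k *+ 'C(n, k)|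
  <= (\sum_(k < n.+2) site_moment mu (n.+1 - k) * site_moment mu k *+ 'C(n.+1, k)) / K.
Proof.
move=> K0; have cX := @continuous_truncX R K n.
have [i1 ->] := bk_gain_swap mu cX (fun v => truncX_range n v (ltW K0)).
have [i2 <-] := Rintegral_prodm_expD n (@sqr_ge0 R) im.
have [i3 <-] := Rintegral_prodm_expD n.+1 (@sqr_ge0 R) im.
pose nu : probability (R * R)%type R := (mu \x mu)%E.
have i2' := integrableZl measurableT (wallis n : R) i2.
rewrite -(RintegralZl (wallis n) measurableT i2).
rewrite -(RintegralZr K^-1 measurableT i3).
have i4 := integrableB measurableT i1 i2'.
rewrite -(RintegralB (mu := nu) measurableT i1 i2').
apply: le_trans (le_normr_Rintegral (mu := nu) measurableT i4) _.
apply: (le_Rintegral (mu := nu) measurableT).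
- by have := integrable_norm (mu := nu) i4.
- exact: (integrableZr (mu := nu) measurableT K^-1 i3).
move=> p _; rewrite -site_circle_avg /circle_avg.
have j1 := circle_avg_integrable p.1 (- p.2) cX.
have j2 := circle_avg_integrable p.1 (- p.2) (@continuous_sqX n).
have mC : measurable ([set` `[- pi, pi]] : set (measurableTypeR R)) by [].
have j3 := integrableB mC j1 j2.
rewrite -(RintegralB mC j1 j2).
apply: le_trans (le_normr_Rintegral mC j3) _.
apply: (@le_trans _ _ (wallis n.+1 * (p.1 ^+ 2 + p.2 ^+ 2) ^+ n.+1 * K^-1)); last first.
  rewrite ler_wpM2r ?invr_ge0 ?(ltW K0)//.
  by rewrite ler_piMl ?wallis_le1// exprn_ge0// addr_ge0 ?sqr_ge0.
rewrite -site_circle_avg /circle_avg.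
have j4 := circle_avg_integrable p.1 (- p.2) (@continuous_sqX n.+1).
rewrite -(RintegralZr K^-1 mC j4).
apply: le_Rintegral => //.
- exact: (integrable_norm j3).
- exact: (integrableZr mC K^-1 j4).
move=> theta _; rewrite -mulrBl normrM [`|(2 * pi)^-1|]ger0_norm ?invr_ge0 ?mulr_ge0 ?pi_ge0//.
rewrite [leRHS]mulrAC ler_wpM2r ?invr_ge0 ?mulr_ge0 ?pi_ge0//.
exact: trunc_approx.
Qed.

End TruncationLimit.

(** * Comparison of the two evolutions *)

Lemma sum_binomial_inner_le (R : realType) (a : R) n : (0 < n)%N -> 0 <= a ->
  \sum_(1 <= k < n) a *+ 'C(n, k) <= 2 ^+ n * a.
Proof.
move=> n0 a0; rewrite -[2]/(1 + 1) exprDn mulr_suml.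
under [leRHS]eq_bigr do rewrite !expr1n mulr1 mulr_natl.
rewrite (big_ord_ends (fun k => a *+ 'C(n, k)) n0) lerDr.
by rewrite bin0 binn addr_ge0.
Qed.

Section MomentComparison.
Context {R : realType}.
Variable mu : R -> probability R R.
Hypothesis bk : boltzmann_kac_solution mu.
Variable b : R.
Hypothesis b0 : 0 < b.
Hypothesis H0 : forall n K, 0 < K -> trunc_moment (mu 0) n K <= b ^+ n.

Lemma bk_exp_integrable T : 0 <= T -> exists2 eps : R, 0 < eps &
  (mu T).-integrable setT (EFin \o (fun v => expR (eps * v ^+ 2))).
Proof.
move=> T0; have q0 : 0 < b * expR (2 * T) by rewrite mulr_gt0 ?expR_gt0.
exists (2 * (b * expR (2 * T)))^-1; first by rewrite invr_gt0 mulr_gt0.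
apply: exp_moment_integrable => // n K K0.
exact: (trunc_moment_le bk (ltW b0) H0).
Qed.

Lemma bk_moment_integrable T n : 0 <= T ->
  (mu T).-integrable setT (EFin \o (fun v => (v ^+ 2) ^+ n)).
Proof.
by move=> /bk_exp_integrable[eps e0 ie]; exact: site_moment_integrable e0 ie n.
Qed.

Lemma bk_site_moment_le t T n : 0 <= t <= T ->
  site_moment (mu t) n <= n`!%:R * (b * expR (2 * T)) ^+ n.
Proof.
move=> /andP[t0 tT]; apply: (site_moment_le (fun k => bk_moment_integrable k t0)).
move=> K K0; apply: le_trans (trunc_moment_le bk (ltW b0) H0 n K0 t0) _.
rewrite ler_wpM2l// lerXn2r ?nnegrE ?mulr_ge0 ?expR_ge0 ?(ltW b0)//.
by rewrite ler_pM2l// ler_expR ler_pM2l.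
Qed.

(** Abstract data of the Kac process after t_0: [m n] is the n-th energy moment at one site,
    [pr k l] the joint one at two sites. *)
Variable m : nat -> R -> R.
Variable pr : nat -> nat -> R -> R.
Variables (n0 : nat) (L eps : R).
Hypothesis L1 : 1 <= L.
Hypothesis eps01 : 0 <= eps <= 1.
Hypothesis dm : forall n, deriv_nonneg (m n) (fun t =>
  2 * wallis n * (\sum_(k < n.+1) pr (n - k) k t *+ 'C(n, k)) - 2 * m n t).
Hypothesis prn0 : forall n t, 0 <= t -> pr n 0 t = m n t.
Hypothesis pr0n : forall n t, 0 <= t -> pr 0 n t = m n t.
Hypothesis m_le : forall n t, 0 <= t -> (n <= n0)%N -> `|m n t| <= L ^+ (n ^ 2).
Hypothesis pr_le : forall n k t, 0 <= t -> (0 < k < n)%N -> (n <= n0)%N ->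
  `|pr (n - k) k t - m (n - k) t * m k t| <= eps * L ^+ (n ^ 2).
Hypothesis m_init : forall n, m n 0 = site_moment (mu 0) n.
Hypothesis m_0 : forall t, 0 <= t -> m 0 t = 1.
Hypothesis m_1 : forall t, 0 <= t -> m 1 t = site_moment (mu t) 1.

(** One step of the induction on n loses a factor at most 16^n, and the margin lemmas below recover
    it from D^(n^2). *)
Let D : R := 16 * L.
Let D1 : 1 <= D.
Proof. by have := L1; rewrite /D; lra. Qed.
Let L0 : 0 <= L := le_trans ler01 L1.
Let D0 : 0 <= D := le_trans ler01 D1.
Let LD : L <= D.
Proof. by have := L1; rewrite /D; lra. Qed.

Lemma pow_margin_L n : (0 < n)%N -> L ^+ (n ^ 2) * 16 ^+ n <= D ^+ (n ^ 2).
Proof.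
move=> n1; rewrite /D exprMn mulrC ler_wpM2r ?exprn_ge0//.
by rewrite ler_weXn2l ?ler1n// -mulnn leq_pmulr.
Qed.

(** With a = n - k the exponents leave 2ak >= a + k = n, hence a spare D^n >= 16^n. *)
Lemma pow_margin_D n k : (0 < k < n)%N ->
  D ^+ ((n - k) ^ 2) * D ^+ (k ^ 2) * 16 ^+ n <= D ^+ (n ^ 2).
Proof.
move=> /andP[k0 kn]; apply: (@le_trans _ _ (D ^+ ((n - k) ^ 2) * D ^+ (k ^ 2) * D ^+ n)).
  by rewrite ler_wpM2l ?mulr_ge0 ?exprn_ge0// lerXn2r ?nnegrE//; have := L1; rewrite /D; lra.
rewrite -!exprD ler_weXn2l//.
have [a [E a0]] : exists a, n = (a + k)%N /\ (0 < a)%N by exists (n - k)%N; lia.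
rewrite E addnK sqrnD.
have [[a' ->] [k' ->]] : (exists a', a = a'.+1) /\ (exists k', k = k'.+1).
  by split; [exists a.-1|exists k.-1]; lia.
by rewrite mulSn mulnS; lia.
Qed.

Lemma moment_comparison n T : (n <= n0)%N -> 0 <= T ->
  `|m n T - site_moment (mu T) n| <= eps * D ^+ (n ^ 2).
Proof.
case/andP: eps01 => e0 e1.
elim/ltn_ind: n T => n IH T nn0 T0.
have [->|n1] := posnP n.
  by rewrite m_0// site_moment0 subrr normr0 mulr_ge0 ?exprn_ge0.
have [->|n2] := eqVneq n 1%N.
  by rewrite m_1// subrr normr0 mulr_ge0 ?exprn_ge0.
have {n1}n2 : (2 <= n)%N by lia.
have nn : (0 < n)%N by lia.
have idx k : (1 <= k < n)%N -> [/\ (n - k < n)%N, (k < n)%N, (n - k <= n0)%N & (k <= n0)%N].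
  move=> /andP[k0 kn]; split=> //; first by rewrite ltn_subrL k0.
    exact: leq_trans (leq_subr _ _) nn0.
  exact: ltnW (leq_trans kn nn0).
pose q := b * expR (2 * T).
(* [M1] and [M2] depend on [b] and [T], but occur only divided by [K]. *)
pose M1 : R := n.+1`!%:R * q ^+ n.+1.
pose M2 : R := \sum_(k < n.+2)
  ((n.+1 - k)`!%:R * q ^+ (n.+1 - k)) * (k`!%:R * q ^+ k) *+ 'C(n.+1, k).
have s0 t k : 0 <= site_moment (mu t) k by exact: site_moment_ge0.
have q0 : 0 <= q by rewrite mulr_ge0 ?expR_ge0// ltW.
pose Z := D ^+ (n ^ 2) / 16 ^+ n.
have p16 : 0 < 16 ^+ n :> R by rewrite exprn_gt0.
have Z0 : 0 <= Z by rewrite divr_ge0 ?exprn_ge0.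
(* Two truncation errors at the times 0 and [T] give 2 [M1]; the forcing gives 2 (3/2 [M1] + 2
   [M2]). *)
apply: (@le_of_div_le _ _ _ (5 * M1 + 4 * M2)).
  rewrite addr_ge0// mulr_ge0//; first by rewrite mulr_ge0 ?exprn_ge0.
  by apply: sumr_ge0 => k _; rewrite mulrn_wge0// !mulr_ge0 ?exprn_ge0.
move=> K K0.
have A_s t : 0 <= t <= T -> `|trunc_moment (mu t) n K - site_moment (mu t) n| <= M1 / K.
  move=> tT; have t0 : 0 <= t by case/andP: tT.
  apply: le_trans (trunc_moment_approx (fun k => bk_moment_integrable k t0) n K0) _.
  by rewrite ler_wpM2r ?invr_ge0 ?(ltW K0)//; exact: bk_site_moment_le.
have G_s t : 0 <= t <= T -> `|bk_gain (fun v => trunc K v ^+ n) (mu t) - wallis n *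
    \sum_(k < n.+1) site_moment (mu t) (n - k) * site_moment (mu t) k *+ 'C(n, k)| <= M2 / K.
  move=> tT; have t0 : 0 <= t by case/andP: tT.
  apply: le_trans (bk_gain_approx (fun k => bk_moment_integrable k t0) n K0) _.
  rewrite ler_wpM2r ?invr_ge0 ?(ltW K0)//; apply: ler_sum => k _.
  by rewrite lerMn2r; apply/orP; right; apply: ler_pM => //; exact: bk_site_moment_le.
(* The 4 is made of 1 for the factorisation error, 1 for the first factor difference and 2 for the
   second, whose cofactor is a moment of [mu t]. *)
have term t k : 0 <= t -> (1 <= k < n)%N ->
    `|pr (n - k) k t - site_moment (mu t) (n - k) * site_moment (mu t) k| <= 4 * eps * Z.
  move=> t0 kn; have [an kn' an0 kn0] := idx k kn.
  have h1 : `|pr (n - k) k t - m (n - k) t * m k t| <= eps * Z.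
    apply: le_trans (pr_le t0 kn nn0) _.
    by rewrite ler_wpM2l// /Z ler_pdivlMr// pow_margin_L.
  have dk : `|m k t - site_moment (mu t) k| <= eps * D ^+ (k ^ 2) by exact: IH.
  have da : `|m (n - k) t - site_moment (mu t) (n - k)| <= eps * D ^+ ((n - k) ^ 2).
    exact: IH.
  have ma : `|m (n - k) t| <= D ^+ ((n - k) ^ 2).
    by apply: le_trans (m_le t0 _) _; rewrite // lerXn2r ?nnegrE.
  have mk : `|m k t| <= D ^+ (k ^ 2).
    by apply: le_trans (m_le t0 _) _; rewrite // lerXn2r ?nnegrE.
  have sk : `|site_moment (mu t) k| <= 2 * D ^+ (k ^ 2).
    rewrite -[site_moment (mu t) k](subKr (m k t)); apply: le_trans (ler_normB _ _) _.
    rewrite mulr_natl mulr2n lerD//; apply: le_trans dk _.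
    by rewrite ler_piMl// exprn_ge0.
  have X : D ^+ ((n - k) ^ 2) * D ^+ (k ^ 2) <= Z.
    by rewrite /Z ler_pdivlMr// pow_margin_D.
  have -> : pr (n - k) k t - site_moment (mu t) (n - k) * site_moment (mu t) k =
    (pr (n - k) k t - m (n - k) t * m k t)
    + (m (n - k) t * (m k t - site_moment (mu t) k)
       + site_moment (mu t) k * (m (n - k) t - site_moment (mu t) (n - k))) by ring.
  apply: le_trans (ler_normD _ _) _.
  have -> : 4 * eps * Z = eps * Z + (eps * Z + 2 * (eps * Z)) by ring.
  rewrite lerD//; apply: le_trans (ler_normD _ _) _; rewrite !normrM; apply: lerD.
    apply: le_trans (ler_pM _ _ ma dk) _ => //.
    by rewrite mulrCA ler_wpM2l.
  apply: le_trans (ler_pM _ _ sk da) _ => //.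
  rewrite -mulrA ler_wpM2l// mulrCA ler_wpM2l//.
  by rewrite mulrC.
have w38 := wallis2_le (R := R) n2; have w0 := wallis_ge0 (R := R) n.
(* The truncated moment is the one whose derivative is known. *)
pose u t := m n t - trunc_moment (mu t) n K.
have du := deriv_nonnegD (dm n) (deriv_nonnegN (deriv_trunc_moment bk n (ltW K0))).
(* The extreme terms k = 0 and k = n of the binomial sum are both [m n] and feed back 4 [wallis n]
   into the loss rate 2. *)
pose lam : R := 2 - 4 * wallis n.
have lam0 : 1 / 2 <= lam by rewrite /lam; lra.
have lamp : 0 < lam by lra.
(* The bound [wallis n <= 3 / 8] gives 3/4 for 2 [wallis n] and 3/2 for 4 [wallis n]. *)
pose e := 3 / 4 * (2 ^+ n * (4 * eps * Z)) + (3 / 2 * M1 + 2 * M2) / K.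
have M10 : 0 <= M1 by rewrite mulr_ge0 ?exprn_ge0.
have M20 : 0 <= M2.
  by apply: sumr_ge0 => k _; rewrite mulrn_wge0// !mulr_ge0 ?exprn_ge0.
have e_ge0 : 0 <= e.
  rewrite /e addr_ge0// ?divr_ge0 ?(ltW K0)//; last by lra.
  by rewrite !mulr_ge0 ?exprn_ge0.
have force t : 0 < t < T ->
    `|(2 * wallis n * (\sum_(k < n.+1) pr (n - k) k t *+ 'C(n, k)) - 2 * m n t +
      - (- 2 * trunc_moment (mu t) n K + 2 * bk_gain (fun v => trunc K v ^+ n) (mu t)))
      + lam * u t| <= e.
  move=> /andP[t0 tT]; have tT' : 0 <= t <= T by rewrite !ltW.
  have := A_s t tT'; have := G_s t tT'.
  rewrite (big_ord_ends (fun k => pr (n - k) k t *+ 'C(n, k)))//.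
  rewrite (big_ord_ends (fun k => site_moment (mu t) (n - k) * site_moment (mu t) k *+ 'C(n, k)))//.
  rewrite subn0 subnn bin0 binn prn0 ?pr0n ?(ltW t0)// !site_moment0 mulr1 mul1r !mulr1n.
  set S1 := \sum_(1 <= k < n) pr (n - k) k t *+ 'C(n, k).
  set S2 := \sum_(1 <= k < n) site_moment _ _ * _ *+ _.
  have Sd : `|S1 - S2| <= 2 ^+ n * (4 * eps * Z).
    rewrite /S1 /S2 -sumrB; apply: le_trans (ler_norm_sum _ _ _) _.
    apply: (@le_trans _ _ (\sum_(1 <= k < n) (4 * eps * Z) *+ 'C(n, k))).
      rewrite big_nat [leRHS]big_nat; apply: ler_sum => k kn.
      by rewrite -mulrnBl normrMn lerMn2r term ?orbT// ltW.
    have Z4 : 0 <= 4 * eps * Z by apply: mulr_ge0 => //; exact: mulr_ge0.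
    exact: sum_binomial_inner_le.
  set G := bk_gain _ _; set A := trunc_moment _ _ _; set s := site_moment _ n.
  move=> hG hA; rewrite /u -/A /lam.
  have -> : 2 * wallis n * (m n t + m n t + S1) - 2 * m n t + - (-2 * A + 2 * G) +
      (2 - 4 * wallis n) * (m n t - A) =
      2 * wallis n * (S1 - S2) + (4 * wallis n * (A - s) - 2 * (G - wallis n * (s + s + S2))).
    by ring.
  apply: le_trans (ler_normD _ _) _; rewrite /e; apply: lerD.
    rewrite normrM ger0_norm; last by rewrite mulr_ge0.
    by apply: ler_pM; rewrite ?mulr_ge0//; lra.
  apply: le_trans (ler_normB _ _) _; rewrite [leRHS]mulrDl; apply: lerD.
    rewrite normrM ger0_norm; last by rewrite mulr_ge0.
    rewrite -mulrA; apply: ler_pM; rewrite ?mulr_ge0//; lra.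
  by rewrite normrM ger0_norm// -mulrA ler_wpM2l.
have := gronwall_forced du T0 lamp e_ge0 force.
have z0T : 0 <= (0 : R) <= T by rewrite lexx T0.
have zTT : 0 <= T <= T by rewrite lexx T0.
have := A_s 0 z0T; have := A_s T zTT; rewrite m_init.
set A0 := trunc_moment (mu 0) n K; set AT := trunc_moment (mu T) n K.
set sT := site_moment (mu T) n; set s_0 := site_moment (mu 0) n.
move=> hT h0 hu.
have elam : e / lam <= 2 * e.
  by rewrite ler_pdivrMr// -[leLHS]mulr1 mulrAC [leRHS]mulrC ler_wpM2l//; lra.
have -> : m n T - sT = (m n T - AT) + (AT - sT) by ring.
apply: le_trans (ler_normD _ _) _.
(* The total loss 6 * 2^n is at most 8^n * 2^n = 16^n, the denominator of [Z]. *)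
have main : 2 * (3 / 4 * (2 ^+ n * (4 * eps * Z))) <= eps * D ^+ (n ^ 2).
  have -> : 2 * (3 / 4 * (2 ^+ n * (4 * eps * Z))) = eps * (6 * 2 ^+ n * Z) by field.
  rewrite ler_wpM2l// /Z mulrA ler_pdivrMr// [leRHS]mulrC ler_wpM2r ?exprn_ge0//.
  have -> : 16 ^+ n = 8 ^+ n * 2 ^+ n :> R by rewrite -exprMn; congr (_ ^+ _); ring.
  rewrite ler_wpM2r ?exprn_ge0//.
  apply: (@le_trans _ _ (8 ^+ 1)); first by rewrite expr1; lra.
  by rewrite ler_weXn2l ?ler1n.
rewrite distrC in h0.
have h0' : `|s_0 - A0| <= M1 / K by exact: h0.
have -> : eps * D ^+ (n ^ 2) + (5 * M1 + 4 * M2) / K =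
  eps * D ^+ (n ^ 2) + (M1 / K + 2 * ((3 / 2 * M1 + 2 * M2) / K)) + M1 / K.
  by field; rewrite gt_eqF.
apply: lerD => //; apply: le_trans hu _.
apply: le_trans (lerD h0' elam) _.
rewrite /e [2 * (_ + _)]mulrDr addrCA; exact: lerD.
Qed.

End MomentComparison.

(** * First marginal of a law on the sphere *)

Section FirstMarginal.
Context {R : realType} {M : nat}.
Local Notation N := M.+1.
Implicit Types (P : probability (N.-tuple R) R) (mu : probability R R).

Definition first_coordinate (v : N.-tuple R) : R := tnth v ord0.

Lemma measurable_first_coordinate : measurable_fun setT first_coordinate.
Proof. exact: measurable_tnth. Qed.

HB.instance Definition _ := isMeasurableFun.Build _ _ _ _
  first_coordinate measurable_first_coordinate.

Lemma nth0_first_coordinate (v : N.-tuple R) : nth 0 v 0 = first_coordinate v.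
Proof. by rewrite /first_coordinate (tnth_nth 0). Qed.

Lemma exists_first_marginal P : exists mu, first_marginal P mu.
Proof.
exists (distribution P first_coordinate) => A mA; rewrite /distribution /= /pushforward.
by congr (P _); apply/seteqP; split=> v /=; rewrite nth0_first_coordinate.
Qed.

Lemma first_marginal_Rintegral P mu (f : R -> R) : first_marginal P mu ->
  measurable_fun setT f -> (forall v, 0 <= f v) ->
  \int[mu]_v f v = \int[P]_v f (first_coordinate v).
Proof.
move=> Pmu mf f0; rewrite /Rintegral; congr fine.
rewrite (@eq_measure_integral _ _ _ _ (distribution P first_coordinate)); last first.
  move=> A mA _; rewrite [LHS]Pmu// /distribution /= /pushforward.
  by congr (P _); apply/seteqP; split=> v /=; rewrite nth0_first_coordinate.
by rewrite ge0_integral_distribution//; exact/measurable_EFinP.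
Qed.

Lemma first_marginal_site_moment P mu n : first_marginal P mu ->
  site_moment mu n = energy_moment P (nseq n ord0).
Proof.
move=> Pmu; rewrite /site_moment (first_marginal_Rintegral Pmu); last first.
- by move=> v; rewrite exprn_ge0// sqr_ge0.
- by apply: measurable_funX; exact: measurable_funX.
by rewrite /energy_moment; apply: eq_Rintegral => v _; rewrite energy_nseq.
Qed.

Lemma first_marginal_trunc_le P mu n K : P (kac_sphere R N) = 1%E ->
  first_marginal P mu -> 0 < K -> trunc_moment mu n K <= N%:R ^+ n.
Proof.
move=> PS Pmu K0; have t0 v := trunc_ge0 v (ltW K0).
rewrite /trunc_moment (first_marginal_Rintegral Pmu); last first.
- by move=> v; rewrite exprn_ge0.
- by apply: continuous_measurable_fun; exact: continuous_truncX.
rewrite -[leRHS](Rintegral_cst_probability P).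
have mt : measurable_fun setT (fun v : N.-tuple R => trunc K (first_coordinate v) ^+ n).
  apply: (@measurableT_comp _ _ _ _ _ _ (fun x => trunc K x ^+ n)) => //.
  by apply: continuous_measurable_fun; exact: continuous_truncX.
have bt v : kac_sphere R N v -> trunc K (first_coordinate v) ^+ n <= N%:R ^+ n.
  rewrite kac_sphereE => vS; rewrite lerXn2r ?nnegrE//.
  apply: le_trans (trunc_le _ _) _.
  have := energy_le [:: ord0] v; rewrite vS expr1.
  by rewrite -[[:: ord0]]/(nseq 1 ord0) energy_nseq expr1.
have it : P.-integrable setT (EFin \o (fun v => trunc K (first_coordinate v) ^+ n)).
  apply: (sphere_integrable PS mt) => v vS.
  by rewrite ger0_norm ?exprn_ge0//; exact: bt.
have ic : P.-integrable setT (EFin \o (fun _ : N.-tuple R => N%:R ^+ n : R)).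
  by apply: (sphere_integrable PS (M := `|N%:R ^+ n|)) => // v _; exact: lexx.
rewrite -(sphere_Rintegral PS it) -(sphere_Rintegral PS ic).
have mS := measurable_kac_sphere (R := R) (N := N).
by apply: le_Rintegral => //; [move: it|move: ic]; apply: integrableS.
Qed.

End FirstMarginal.

(** Here 16 = 2^4: each of the four factors n, n, 2 and n! is at most 2^(n^2). *)
Lemma cumulant_margin n : (0 < n)%N -> (n ^ 2 * (2 * n`!) <= 16 ^ (n ^ 2))%N.
Proof.
move=> n0; have nn2 : (n <= n ^ 2)%N by rewrite -mulnn leq_pmulr.
have n2 : (n <= 2 ^ (n ^ 2))%N.
  by apply: leq_trans (ltnW (ltn_expl n (ltnSn 1))) _; rewrite leq_exp2l.
have fact_le m : (m`! <= n ^ m)%N || (n < m)%N.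
  elim: m => [|m IH]; first by rewrite expn0.
  case: (ltnP n m.+1) => [|mn]; first by rewrite orbT.
  rewrite orbF factS expnS leq_mul//.
  by case/orP: IH => // nm; move: (ltn_trans nm mn); rewrite ltnn.
have n3 : (n`! <= 2 ^ (n ^ 2))%N.
  have := fact_le n; rewrite ltnn orbF => /leq_trans; apply.
  rewrite -mulnn expnM leq_exp2r//; exact: ltnW (ltn_expl n (ltnSn 1)).
have n4 : (2 <= 2 ^ (n ^ 2))%N.
  by rewrite -{1}[2%N]expn1 leq_exp2l// expn_gt0 n0.
have -> : (16 ^ (n ^ 2) = (2 ^ (n ^ 2) * 2 ^ (n ^ 2)) * (2 ^ (n ^ 2) * 2 ^ (n ^ 2)))%N.
  by rewrite -!expnMn.
by apply: leq_mul; [rewrite -[(n ^ 2)%N]mulnn; exact: leq_mul|exact: leq_mul].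
Qed.

(** * Factorisation of the two-site moments *)

Section PairMoments.
Context {R : realType} {M : nat}.
Local Notation N := M.+2.
Variable F : R -> probability (N.-tuple R) R.
Hypothesis kacF : kac_law F.
Hypothesis sym0 : symmetric_measure (F 0).
Variables (t alpha c1 : R) (n0 : nat).
Hypothesis t0 : 0 <= t.
Hypothesis alpha01 : 0 < alpha < 1.
Hypothesis c1_ge1 : 1 <= c1.
Hypothesis n0N : (n0 <= N)%N.

Local Notation eps := ((N%:R - 1) `^ (- alpha) : R).
Local Notation bound n := (2 * c1 ^+ (n ^ 2) * n`!%:R).
Local Notation K := (16 * c1).
Local Notation i0 := (ord0 : 'I_N).
Local Notation i1 := (inord 1 : 'I_N).

Hypothesis norm_le : forall n, (0 < n <= n0)%N ->
  cumulant_norm N alpha (@classifier_cumulant R N n (F t)) <= bound n.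

Lemma K_ge1 : 1 <= K.
Proof. by have := c1_ge1; lra. Qed.

Lemma bound_ge0 n : 0 <= bound n.
Proof. by rewrite mulr_ge0// mulr_ge0// exprn_ge0// (le_trans ler01). Qed.

Lemma bound_margin n : (0 < n)%N -> n%:R ^+ 2 * bound n <= K ^+ (n ^ 2).
Proof.
move=> n1; have -> : n%:R ^+ 2 * bound n = (n ^ 2 * (2 * n`!))%:R * c1 ^+ (n ^ 2).
  by rewrite natrM natrX natrM; ring.
rewrite exprMn ler_wpM2r ?exprn_ge0 ?(le_trans ler01)//.
by rewrite -natrX ler_nat cumulant_margin.
Qed.

Lemma same_site_cumulant_le i n : (0 < n <= n0)%N ->
  `|cumulant (F t) (nseq n i)| <= K ^+ (n ^ 2).
Proof.
move=> nn; have /andP[n1 nn0] := nn.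
have -> : cumulant (F t) (nseq n i) = cumulant (F t) (nseq n i0).
  rewrite -(kac_cumulant_sym kacF sym0 t0 (tperm i0 i) (l := nseq n i0)) ?size_nseq//.
  by rewrite map_nseq tpermL.
have [->|n1'] := eqVneq n 1%N.
  rewrite /= (cumulant_rec _ _ (kac_cumulant_moment kacF t0)) big_nil subr0.
  by rewrite (kac_energy_moment1 kacF sym0 t0) normr1 expr1 K_ge1.
apply: le_trans (bound_margin n1).
have := single_cumulant_le kacF t0 alpha01 (bound_ge0 n) n1 (leq_trans nn0 n0N) (norm_le nn).
move=> /(_ _) /le_trans; apply; first by lia.
by rewrite ler_peMl ?bound_ge0// exprn_ege1// ler1n.
Qed.

Let lab (b : bool) : 'I_N := if b then i1 else i0.

Lemma label_nseq (s : seq bool) : [\/ s = nseq (size s) false, s = nseq (size s) true |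
  (0 < count negb s)%N /\ (0 < count id s)%N].
Proof.
have [a|/hasPn h] := boolP (has id s).
  have [b|/hasPn h] := boolP (has negb s); first by constructor 3; rewrite -!has_count.
  constructor 2; apply/all_pred1P/allP => x /h /=; by case: x.
by constructor 1; apply/all_pred1P/allP => x /h /=; case: x.
Qed.

Lemma label_perm (s : seq bool) :
  perm_eq (map lab s) (pair_seq i0 i1 (count negb s) (count id s)).
Proof.
elim: s => [|[] s IH]//=; last by rewrite add0n /pair_seq /= perm_cons.
by rewrite add0n /pair_seq /= perm_sym -cat1s perm_catCA perm_cons perm_sym.
Qed.

Lemma label_mixed_le (s : seq bool) : (0 < size s <= n0)%N ->
  (0 < count negb s)%N -> (0 < count id s)%N ->
  `|cumulant (F t) (map lab s)| <= eps * K ^+ (size s ^ 2).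
Proof.
move=> sn c0 c1'; have /andP[s1 sn0] := sn.
rewrite (kac_cumulant_perm kacF t0 (label_perm s)).
have sz : (count negb s + count id s)%N = size s.
  by rewrite addnC -(count_predC id s); congr (_ + _)%N; apply: eq_count.
apply: le_trans (pair_cumulant_le kacF sym0 t0 alpha01 (bound_ge0 (size s)) s1
  (leq_trans sn0 n0N) (norm_le sn) c0 c1' sz) _.
by rewrite mulrAC [leRHS]mulrC ler_wpM2r ?powR_ge0// bound_margin.
Qed.

Lemma label_cumulant_le (s : seq bool) : (0 < size s <= n0)%N ->
  `|cumulant (F t) (map lab s)| <= K ^+ (size s ^ 2).
Proof.
move=> sn; case: (label_nseq s) => [->|->|[h1 h2]].
- by rewrite map_nseq size_nseq; exact: same_site_cumulant_le.
- by rewrite map_nseq size_nseq; exact: same_site_cumulant_le.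
apply: le_trans (label_mixed_le sn h1 h2) _.
rewrite ler_piMl ?decay_le1// exprn_ge0//; exact: le_trans ler01 K_ge1.
Qed.

Variable nu : probability R R.
Hypothesis Fnu : first_marginal (F t) nu.

Lemma marginal_exp_integrable : exists2 e : R, 0 < e &
  nu.-integrable setT (EFin \o (fun v => expR (e * v ^+ 2))).
Proof.
have q0 : 0 < N%:R :> R by rewrite ltr0n.
exists (2 * N%:R)^-1; first by rewrite invr_gt0 mulr_gt0.
apply: exp_moment_integrable => // n k k0.
apply: le_trans (first_marginal_trunc_le n (kacF.1 t t0) Fnu k0) _.
by rewrite ler_peMl ?exprn_ge0// ler1n fact_gt0.
Qed.

(** On a single site the two measures have the same moments, since [nu] is the marginal of [F t] at
    the same time; the recursion transfers this to cumulants. *)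
Lemma same_site_product_cumulant i n : (0 < n)%N ->
  cumulant (product_probability nu N) (nseq n i) = cumulant (F t) (nseq n i).
Proof.
move=> n1; have [e e0 ie] := marginal_exp_integrable.
have mQ := cumulant_moment e0 (product_integrable ie N).
have mP := kac_cumulant_moment kacF t0.
have mapE (k : nat) : [seq i | _ <- nseq k tt] = nseq k i by rewrite map_nseq.
have E u : [seq i | _ <- u] = nseq (@size unit u) i by elim: u => //= a u ->.
have := cumulant_unique (moment_cumulant_map (fun _ : unit => i) mQ)
  (moment_cumulant_map (fun _ : unit => i) mP) _ (s := nseq n tt).
rewrite /= mapE size_nseq; apply => // u /=; rewrite E.
rewrite (product_energy_moment e0 ie) (bigD1 i)//= big1 ?mulr1; last first.
  move=> j /negbTE ji; rewrite count_nseq /= eq_sym ji mul0n site_moment0//.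
rewrite count_nseq /= eqxx mul1n (first_marginal_site_moment _ Fnu).
by rewrite -(energy_moment_sym kacF sym0 (tperm i0 i) _ t0) map_nseq tpermL.
Qed.

Lemma site_moment_bound n : (n <= n0)%N ->
  `|energy_moment (F t) (nseq n i0)| <= (2 * K) ^+ (n ^ 2).
Proof.
move=> nn0; have mP := moment_cumulant_map lab (kac_cumulant_moment kacF t0).
have := moment_bound K_ge1 ler01 mP label_cumulant_le (s := nseq n false).
by rewrite size_nseq /= map_nseq; exact.
Qed.

(** The cumulants of [F t] and of the product of [nu] differ only when mixed, and then by O(eps).
    The Lipschitz estimate carries this to moments, and those of the product factorise exactly. *)
Lemma pair_moment_close n k : (0 < k < n)%N -> (n <= n0)%N ->
  `|energy_moment (F t) (pair_seq i0 i1 (n - k) k) -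
    energy_moment (F t) (nseq (n - k) i0) * energy_moment (F t) (nseq k i0)|
  <= eps * (2 * K) ^+ (n ^ 2).
Proof.
move=> /andP[k0 kn] nn0; have [e e0 ie] := marginal_exp_integrable.
have mQ0 := cumulant_moment e0 (product_integrable ie N).
have mQ := moment_cumulant_map lab mQ0.
have mP := moment_cumulant_map lab (kac_cumulant_moment kacF t0).
have mixed0 (s : seq bool) : (0 < count negb s)%N -> (0 < count id s)%N ->
    cumulant (product_probability nu N) (map lab s) = 0.
  rewrite -!has_count => /hasP[[]// a _] /hasP[[]// b _].
  apply: (product_mixed_cumulant e0 ie (i := i0) (j := i1)); last exact: i01.
    by apply/mapP; exists false.
  by apply/mapP; exists true.
have kQ (s : seq bool) : (0 < size s <= n0)%N ->
    `|cumulant (product_probability nu N) (map lab s)| <= K ^+ (size s ^ 2).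
  move=> /[dup] sn /andP[s1 _]; case: (label_nseq s) => [E|E|[h1 h2]].
  - by move: (label_cumulant_le sn); rewrite E size_nseq map_nseq same_site_product_cumulant.
  - by move: (label_cumulant_le sn); rewrite E size_nseq map_nseq same_site_product_cumulant.
  by rewrite mixed0// normr0 exprn_ge0// (le_trans ler01 K_ge1).
have kPQ (s : seq bool) : (0 < size s <= n0)%N ->
    `|cumulant (F t) (map lab s) - cumulant (product_probability nu N) (map lab s)|
    <= eps * K ^+ (size s ^ 2).
  move=> /[dup] sn /andP[s1 _].
  have z : 0 <= eps * K ^+ (size s ^ 2).
    by rewrite mulr_ge0 ?powR_ge0// exprn_ge0// (le_trans ler01 K_ge1).
  case: (label_nseq s) => [E|E|[h1 h2]].
  - by rewrite [in map lab s]E map_nseq same_site_product_cumulant// subrr normr0.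
  - by rewrite [in map lab s]E map_nseq same_site_product_cumulant// subrr normr0.
  by rewrite mixed0// subr0; exact: label_mixed_le.
have := moment_lipschitz K_ge1 (powR_ge0 _ _) mP mQ label_cumulant_le kQ kPQ
  (s := nseq (n - k) false ++ nseq k true).
have sz : size (nseq (n - k) false ++ nseq k true) = n.
  by rewrite size_cat !size_nseq subnK// ltnW.
rewrite sz => /(_ nn0); rewrite /= map_cat !map_nseq /= -/(pair_seq _ _ _ _).
have -> // : energy_moment (product_probability nu N) (pair_seq i0 i1 (n - k) k) =
  energy_moment (F t) (nseq (n - k) i0) * energy_moment (F t) (nseq k i0).
rewrite (product_energy_moment e0 ie) (bigD1 i0)//= (bigD1 i1)/=; last first.
  by rewrite eq_sym i01.
rewrite big1 ?mulr1; last first.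
  move=> j /andP[j0 j1]; rewrite count_cat !count_nseq /=.
  by rewrite -[_ == j](eq_sym j) (negbTE j0) -[_ == j](eq_sym j) (negbTE j1) site_moment0.
rewrite !count_cat !count_nseq /= !eqxx !mul1n (negbTE (@i01 M)).
by rewrite [i1 == i0]eq_sym (negbTE (@i01 M)) !mul0n addn0 add0n !(first_marginal_site_moment _ Fnu).
Qed.

End PairMoments.

(** * Comparison of the cumulants *)

Section Comparison.
Context {R : realType} {M : nat}.
Local Notation N := M.+2.
Variable F : R -> probability (N.-tuple R) R.
Hypothesis kacF : kac_law F.
Hypothesis sym0 : symmetric_measure (F 0).
Variables (t0 alpha c1 : R) (n0 : nat).
Hypothesis t00 : 0 <= t0.
Hypothesis alpha01 : 0 < alpha < 1.
Hypothesis c1_ge1 : 1 <= c1.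
Hypothesis n0N : (n0 <= N)%N.
Hypothesis norm_le : forall t, t0 <= t -> forall n, (0 < n <= n0)%N ->
  cumulant_norm N alpha (@classifier_cumulant R N n (F t)) <= 2 * c1 ^+ (n ^ 2) * n`!%:R.
Variable mu : R -> probability R R.
Hypothesis bk : boltzmann_kac_solution mu.
Hypothesis Fmu : first_marginal (F t0) (mu 0).

Local Notation eps := ((N%:R - 1) `^ (- alpha) : R).
Local Notation i0 := (ord0 : 'I_N).
Local Notation i1 := (inord 1 : 'I_N).
Local Notation L := (2 * (16 * c1)).

Lemma initial_trunc_le n k : 0 < k -> trunc_moment (mu 0) n k <= (N%:R : R) ^+ n.
Proof. exact: first_marginal_trunc_le (kacF.1 t0 t00) Fmu. Qed.

Lemma limit_exp_integrable T : 0 <= T -> exists2 e : R, 0 < e &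
  (mu T).-integrable setT (EFin \o (fun v => expR (e * v ^+ 2))).
Proof. exact: (bk_exp_integrable bk (ltr0Sn _ _) initial_trunc_le). Qed.

Lemma limit_energy T : 0 <= T -> site_moment (mu T) 1 = 1.
Proof.
move=> T0; have E t : site_moment (mu t) 1 = fine (\int[mu t]_v ((v ^+ 2)%R)%:E)%E.
  by rewrite /site_moment; under eq_Rintegral do rewrite expr1.
rewrite E (bk.2 T T0) -E (first_marginal_site_moment _ Fmu).
exact: kac_energy_moment1 kacF sym0 _ t00 _.
Qed.

Lemma site_moment_close n T : (n <= n0)%N -> 0 <= T ->
  `|energy_moment (F (t0 + T)) (nseq n i0) - site_moment (mu T) n|
  <= eps * (16 * L) ^+ (n ^ 2).
Proof.
have shift t : 0 <= t -> 0 <= t0 + t by move=> ?; exact: addr_ge0.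
have tle t : 0 <= t -> t0 <= t0 + t by rewrite lerDl.
apply: (@moment_comparison R mu bk N%:R _ _
  (fun k t => energy_moment (F (t0 + t)) (nseq k i0))
  (fun k l t => energy_moment (F (t0 + t)) (pair_seq i0 i1 k l)) n0 L eps).
- by rewrite ltr0n.
- exact: initial_trunc_le.
- by have := c1_ge1; lra.
- by rewrite powR_ge0 decay_le1.
- by move=> k; exact: (deriv_nonneg_time t00 (deriv_site_moment (@i01 M) kacF sym0 k)).
- by move=> k t _; rewrite /pair_seq cats0.
- move=> k t tt; rewrite /pair_seq /=.
  by rewrite -(energy_moment_sym kacF sym0 (tperm i0 i1) _ (shift t tt)) map_nseq tpermR.
- move=> k t tt kn; apply: (site_moment_bound kacF sym0 (shift t tt) alpha01 c1_ge1 n0N) => //.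
  exact: norm_le (tle t tt).
- move=> k l t tt lk kn.
  have [nu Fnu] := exists_first_marginal (F (t0 + t)).
  by apply: (pair_moment_close kacF sym0 (shift t tt) alpha01 c1_ge1 n0N (norm_le (tle t tt)) Fnu).
- by move=> k; rewrite addr0 (first_marginal_site_moment _ Fmu).
- by move=> t tt; rewrite energy_moment_nil.
- by move=> t tt; rewrite limit_energy// (kac_energy_moment1 kacF sym0 (shift t tt)).
Qed.

Lemma product_classifier_cumulantE n (r : n.-tuple 'I_n.+1) T : 0 <= T ->
  classifier_cumulant (product_probability (mu T) N) r =
  cumulant (product_probability (mu T) N) (classifier_labels N r).
Proof.
move=> T0; have [e e0 ie] := limit_exp_integrable T0.
exact: energy_cumulantE e0 (product_integrable ie N) _.
Qed.

Lemma same_site_cumulant_close n T : (0 < n <= n0)%N -> 0 <= T ->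
  `|cumulant (F (t0 + T)) (nseq n i0) - cumulant (product_probability (mu T) N) (nseq n i0)|
  <= eps * (2 * (2 * (16 * L))) ^+ (n ^ 2).
Proof.
move=> nn T0; have [e e0 ie] := limit_exp_integrable T0.
have s0 : 0 <= t0 + T by exact: addr_ge0.
have sle : t0 <= t0 + T by rewrite lerDl.
have mQ := moment_cumulant_map (fun _ : unit => i0) (cumulant_moment e0 (product_integrable ie N)).
have mP := moment_cumulant_map (fun _ : unit => i0) (kac_cumulant_moment kacF s0).
have E u : [seq i0 | _ <- u] = nseq (@size unit u) i0 by elim: u => //= a u ->.
have EQ k : energy_moment (product_probability (mu T) N) (nseq k i0) = site_moment (mu T) k.
  rewrite (product_energy_moment e0 ie) (bigD1 i0)//= big1 ?mulr1; last first.
    move=> j /negbTE ji; rewrite count_nseq /= -[_ == j](eq_sym j) ji mul0n site_moment0//.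
  by rewrite count_nseq /= mul1n.
have K1 : 1 <= 2 * (16 * L) by have := c1_ge1; lra.
have D0 : 0 <= 16 * L by have := c1_ge1; lra.
have L0 : 0 <= L by have := c1_ge1; lra.
have LD : L <= 16 * L by lra.
have LK : L <= 2 * (16 * L) by lra.
have DK : 16 * L <= 2 * (16 * L) by lra.
have K0 : 0 <= 2 * (16 * L) := le_trans ler01 K1.
have bP k : (k <= n0)%N -> `|energy_moment (F (t0 + T)) (nseq k i0)| <= L ^+ (k ^ 2).
  exact: (site_moment_bound kacF sym0 s0 alpha01 c1_ge1 n0N (norm_le sle)).
have bD k : (k <= n0)%N -> `|energy_moment (F (t0 + T)) (nseq k i0) - site_moment (mu T) k|
    <= eps * (16 * L) ^+ (k ^ 2).
  by move=> kn; exact: site_moment_close.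
pose EP : seq unit -> R := energy_moment (F (t0 + T)) \o map (fun=> i0).
pose EQ' : seq unit -> R := energy_moment (product_probability (mu T) N) \o map (fun=> i0).
have EPE u : EP u = energy_moment (F (t0 + T)) (nseq (size u) i0) by rewrite /EP /comp E.
have EQE u : EQ' u = site_moment (mu T) (size u) by rewrite /EQ' /comp E EQ.
have bEP u : (size u <= n0)%N -> `|EP u| <= (2 * (16 * L)) ^+ (size u ^ 2).
  by move=> un; rewrite EPE; apply: le_trans (bP _ un) _; rewrite lerXn2r ?nnegrE.
have bEQ u : (size u <= n0)%N -> `|EQ' u| <= (2 * (16 * L)) ^+ (size u ^ 2).
  (* The factor 2 from the triangle inequality fits in 2^(k^2) only for k > 0, hence the separate
     case of order 0. *)
  move=> un; rewrite EQE; have [->|u0] := posnP (size u).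
    by rewrite site_moment0 normr1.
  rewrite -[site_moment _ _](subKr (energy_moment (F (t0 + T)) (nseq (size u) i0))).
  apply: le_trans (ler_normB _ _) _.
  apply: (@le_trans _ _ (2 * (16 * L) ^+ (size u ^ 2))).
    rewrite mulr_natl mulr2n lerD//.
      by apply: le_trans (bP _ un) _; rewrite lerXn2r ?nnegrE.
    apply: le_trans (bD _ un) _.
    by rewrite ler_piMl ?decay_le1// exprn_ge0.
  rewrite [leRHS]exprMn ler_wpM2r ?exprn_ge0// -[leLHS]expr1 ler_weXn2l ?ler1n//.
  by rewrite expn_gt0 u0.
have bEPQ u : (size u <= n0)%N -> `|EP u - EQ' u| <= eps * (2 * (16 * L)) ^+ (size u ^ 2).
  move=> un; rewrite EPE EQE; apply: le_trans (bD _ un) _; rewrite ler_wpM2l ?powR_ge0//.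
  by rewrite lerXn2r ?nnegrE.
have := cumulant_lipschitz K1 (powR_ge0 (N%:R - 1) (- alpha)) mP mQ bEP bEQ bEPQ (s := nseq n tt).
by rewrite size_nseq => /(_ nn); rewrite /comp E size_nseq.
Qed.

Lemma classifier_cumulant_close n (r : n.-tuple 'I_n.+1) T : (0 < n <= n0)%N ->
  0 <= T -> r \in classifiers n ->
  `|classifier_cumulant (F (t0 + T)) r -
    classifier_cumulant (product_probability (mu T) N) r|
  <= eps * (2 * (2 * (16 * L))) ^+ (n ^ 2).
Proof.
move=> nn T0 rc; have /andP[n1 nn0] := nn; have nN := leq_trans nn0 n0N.
have s0 : 0 <= t0 + T by exact: addr_ge0.
have sle : t0 <= t0 + T by rewrite lerDl.
have [e e0 ie] := limit_exp_integrable T0.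
have iQ := product_integrable ie N.
rewrite product_classifier_cumulantE//.
have nnN : (0 < n <= N)%N by rewrite n1.
case: (@classifier_dichotomy N n r i0 erefl rc nnN) => [p|[rl [i [j [ir jr ij]]]]].
  rewrite (classifier_cumulantE kacF s0 p) (cumulant_perm e0 iQ p).
  exact: same_site_cumulant_close.
rewrite (product_mixed_cumulant e0 ie ir jr ij) subr0.
apply: le_trans (mixed_classifier_cumulant_le kacF sym0 s0 alpha01 (bound_ge0 c1_ge1 n) n1 nN
  (norm_le sle nn) rc rl) _.
rewrite mulrAC [leRHS]mulrC ler_wpM2r ?powR_ge0//.
apply: le_trans (bound_margin c1_ge1 n1) _.
by rewrite lerXn2r ?nnegrE//; have := c1_ge1; lra.
Qed.

End Comparison.

(** For N >= 2 one has N <= 2 (N - 1), and 2^alpha <= 2. *)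
Lemma powR_pred_bigO (R : realType) (alpha a : R) : 0 < alpha < 1 -> 0 < a ->
  (fun N : nat => a * (N%:R - 1) `^ (- alpha) : R^o)
  =O_\oo (fun N : nat => N%:R `^ (- alpha) : R^o).
Proof.
move=> /andP[a0 a1] ap; apply/eqO_exP; exists (a * 2); first by rewrite mulr_gt0.
near=> N; have N2 : (2 <= N)%N by near: N; exists 2%N.
have NR : 2 <= N%:R :> R by rewrite ler_nat.
rewrite normrM !ger0_norm ?powR_ge0 ?(ltW ap)// -mulrA ler_pM2l// !powRN.
have p1 : 0 < (N%:R - 1 : R) `^ alpha by rewrite powR_gt0; lra.
have p2 : 0 < (N%:R : R) `^ alpha by rewrite powR_gt0; lra.
rewrite ler_pdivlMr// mulrC ler_pdivrMr//.
apply: (@le_trans _ _ ((2 * (N%:R - 1)) `^ alpha)).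
  by apply: ge0_ler_powR; rewrite ?nnegrE; lra.
rewrite powRM; [|lra|lra]; rewrite ler_pM2r//.
by rewrite -[leRHS]powRr1//; apply: ler_powR; rewrite ?ler1n// ltW.
Unshelve. all: by end_near.
Qed.

(** After t_0 the transient is at most 1, for lower orders as well since c >= 0, so the last factor
    is at most 2. The absolute value allows for a negative [a]. *)
Lemma chaos_norm_le (R : realType) (c alpha c1 t0 t a : R) (N n nstar : nat)
  (kappa : n.-tuple 'I_n.+1 -> R) :
  0 <= c -> (0 < n <= nstar)%N -> (0 < N)%N -> t0 <= t -> `|a| <= c1 ->
  N%:R `^ (c * (nstar%:R - 1)) * expR (- t0 / 4) <= 1 ->
  cumulant_norm N alpha kappa
    <= a ^+ (n ^ 2) * n`!%:R * (N%:R `^ (c * (n%:R - 1)) * expR (- t / 4) + 1) ->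
  cumulant_norm N alpha kappa <= 2 * c1 ^+ (n ^ 2) * n`!%:R.
Proof.
move=> c0 /andP[n1 nn] N0 tt ac h /le_trans; apply.
have f0 : 0 <= N%:R `^ (c * (n%:R - 1)) * expR (- t / 4) :> R.
  by rewrite mulr_ge0 ?powR_ge0 ?expR_ge0.
have f1 : N%:R `^ (c * (n%:R - 1)) * expR (- t / 4) <= 1 :> R.
  apply: le_trans h; apply: ler_pM; rewrite ?powR_ge0 ?expR_ge0//.
    by apply: ler_powR; rewrite ?ler1n// ler_wpM2l// lerB// ler_nat.
  by rewrite ler_expR; lra.
have ap : a ^+ (n ^ 2) <= c1 ^+ (n ^ 2).
  apply: le_trans (ler_norm _) _; rewrite normrX lerXn2r ?nnegrE//.
  exact: le_trans ac.
have c10 : 0 <= c1 ^+ (n ^ 2) by rewrite exprn_ge0// (le_trans (normr_ge0 a)).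
rewrite -[2 * _ * _]mulrA [leRHS]mulrC.
apply: (@le_trans _ _ (c1 ^+ (n ^ 2) * n`!%:R * (N%:R `^ (c * (n%:R - 1)) * expR (- t / 4) + 1))).
  by rewrite ler_wpM2r// ?ler_wpM2r// addr_ge0.
by rewrite ler_wpM2l ?mulr_ge0//; lra.
Qed.

Theorem theorem2p18 (R : realType) (C1 : R -> R) :
  exists C : R -> R,
  forall (c alpha : R) (nstar N0 : nat),
    0 <= c -> 0 < alpha < 1 -> (1 <= nstar)%N -> (2 <= N0)%N ->
    generation_of_chaos C1 c alpha nstar N0 ->
  forall B : R, 1 <= B ->
    (forall (N : nat) (F : R -> probability (N.-tuple R) R)
        (t0 : R) (mu : R -> probability R R),
      (N0 <= N)%N ->
      kac_law F -> symmetric_measure (F 0) ->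
      initial_cumulant_bound c alpha B nstar (F 0) ->
      0 <= t0 -> N%:R `^ (c * (nstar%:R - 1)) * expR (- t0 / 4) <= 1 ->
      boltzmann_kac_solution mu -> first_marginal (F t0) (mu 0) ->
      forall (T : R) (n : nat) (r : n.-tuple 'I_n.+1),
        0 <= T -> (1 <= n <= nstar)%N -> (n <= N)%N -> r \in classifiers n ->
        `| classifier_cumulant (F (t0 + T)) r
           - classifier_cumulant (product_probability (mu T) N) r |
        <= 2 * (N%:R - 1) `^ (- alpha) * C B ^+ (n ^ 2) * n`!%:R)
    /\
    (forall n : nat,
      (fun N : nat => 2 * (N%:R - 1) `^ (- alpha) * C B ^+ (n ^ 2) * n`!%:R : R^o)
      =O_\oo (fun N : nat => N%:R `^ (- alpha) : R^o)).
Proof.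
(* 16 c1 absorbs the factor 2 n^2 n! in the cumulant bounds; the other factors
   are lost in passing from cumulants to moments (2), in the Gronwall step (16),
   in bounding the moments of mu_T (2), and in returning to cumulants (2). *)
exists (fun B => 2 * (2 * (16 * (2 * (16 * Num.max 1 `|C1 B|))))) => c alpha nstar N0 c0 alpha01 ns1 N02 chaos B B1.
(* [C1 B] is an arbitrary real, whereas the inductions need a base of at least 1. *)
set c1 := Num.max 1 `|C1 B|.
have c1_ge1 : 1 <= c1 by rewrite le_max lexx.
have C1c1 : `|C1 B| <= c1 by rewrite le_max lexx orbT.
have C0 : 0 < 2 * (2 * (16 * (2 * (16 * c1)))) by lra.
split; last first.
  move=> n; pose a : R := 2 * (2 * (2 * (16 * (2 * (16 * c1))))) ^+ (n ^ 2) * n`!%:R.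
  have a0 : 0 < a by rewrite !mulr_gt0 ?exprn_gt0// ltr0n fact_gt0.
  rewrite (_ : (fun N : nat => _) = (fun N : nat => a * (N%:R - 1) `^ (- alpha) : R^o)).
    exact: powR_pred_bigO.
  by apply/funext => N; rewrite /a; ring.
move=> N F t0 mu N0N kacF sym0 init t00 decay bk Fmu T n r T0 /andP[n1 nn] nN rc.
have N2 : (2 <= N)%N := leq_trans N02 N0N.
have [M E] : exists M, N = M.+2 
  by case: (N) N2 => [|[|M]]// _; exists M.
(* Generation of chaos is granted only for orders at most N, hence the minimum. *)
have norm_le t : t0 <= t -> forall k, (0 < k <= minn nstar N)%N ->
    cumulant_norm N alpha (@classifier_cumulant R N k (F t)) <= 2 * c1 ^+ (k ^ 2) * k`!%:R.
  move=> tt k; rewrite leq_min => /and3P[k1 kn kN].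
  apply: (chaos_norm_le c0 _ (ltnW N2) tt C1c1 decay); first by rewrite k1.
  by apply: (chaos B B1 N N0N F kacF sym0 init); rewrite ?k1// (le_trans t00).
move: N E F r N0N N2 nN kacF sym0 init decay Fmu norm_le rc.
move=> _ -> F r N0N N2 nN kacF sym0 init decay Fmu norm_le rc.
have nm : (0 < n <= minn nstar M.+2)%N by rewrite n1 leq_min nn nN.
apply: le_trans (classifier_cumulant_close kacF sym0 t00 alpha01 c1_ge1 (geq_minr _ _)
  norm_le bk Fmu nm T0 rc) _.
set X := _ `^ _; set Y := _ ^+ _.
have XY : 0 <= X * Y by rewrite mulr_ge0 ?powR_ge0// exprn_ge0// ltW.
(* The comparison already holds without the factor 2 n!, which is at least 1. *)
have f1 : 1 <= n`!%:R :> R by rewrite ler1n fact_gt0.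
have -> : 2 * X * Y * n`!%:R = X * Y * (2 * n`!%:R) by ring.
by rewrite -[leLHS]mulr1 ler_wpM2l//; lra.
Qed.
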